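(* Let $T>0$ and let $b:[0,T]\times\mathbb{R}^d\times\mathcal{P}_2(\mathbb{R}^d)\to\mathbb{R}^d$ and $\sigma:[0,T]\times\mathbb{R}^d\times\mathcal{P}_2(\mathbb{R}^d)\to\mathbb{R}^d\otimes\mathbb{R}^d$ be Borel measurable functions such that: (a) there exists $C>0$ with $|b(t,x,\mu)|+|\sigma(t,x,\mu)|\le C(1+|x|)$ for all $(t,x,\mu)\in[0,T]\times\mathbb{R}^d\times\mathcal{P}_2(\mathbb{R}^d)$; (b) there exists $L>0$ such that for all $t\in[0,T]$, $x,x'\in\mathbb{R}^d$, $\mu,\mu'\in\mathcal{P}_2(\mathbb{R}^d)$, $$|b(t,x,\mu)-b(t,x',\mu')|\le L[|x-x'|+W_2(\mu,\mu')],\qquad |\sigma(t,x,\mu)-\sigma(t,x',\mu')|\le L[|x-x'|+W_2(\mu,\mu')].$$ For $x\in\mathbb{R}^d$ let $X^x=(X^x_t)_{t\in[0,T]}$ be the unique solution of $$dX^x_t=b(t,X^x_t,\mathbb{P}_{X^x_t})\,dt+\sigma(t,X^x_t,\mathbb{P}_{X^x_t})\,dB_t,\qquad X^x_0=x.$$ Then the mapping $\Phi:\mathbb{R}^d\to L^2(\Omega,\mathcal{C}([0,T],\mathbb{R}^d))$ defined by $\Phi(x)=(X^x_t)_{t\in[0,T]}$ is continuous.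
   Context: $(\Omega,\mathcal{F},P)$ is a probability space with a filtration $(\mathcal{F}_t)$ satisfying the usual conditions and $B$ is a $d$-dimensional $(\mathcal{F}_t,P)$-Brownian motion. $\mathbb{P}_{X}$ denotes the law of a random variable $X$. $\mathcal{P}_2(\mathbb{R}^d)$ is the set of probability measures on $\mathbb{R}^d$ with finite second moment, and $W_2(\mu,\nu)=\inf_{\pi\in\Pi(\mu,\nu)}\left[\int|x-y|^2\,d\pi(x,y)\right]^{1/2}$, where $\Pi(\mu,\nu)$ is the set of couplings of $\mu$ and $\nu$. Under (a) and (b) it is known that the equation has a unique continuous adapted solution with $E[\sup_{t\le T}|X_t|^2]<+\infty$. The space $L^2(\Omega,\mathcal{C}([0,T],\mathbb{R}^d))$ has norm $\left(E[\sup_{t\le T}|X_t|^2]\right)^{1/2}$. *)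

(* Defs.v *)
From HB Require Import structures.
From mathcomp Require Import all_boot all_order all_algebra.
From mathcomp Require Import all_classical all_reals all_analysis.

Set Implicit Arguments.
Unset Strict Implicit.
Unset Printing Implicit Defensive.

Import Order.TTheory GRing.Theory Num.Theory.
Import numFieldNormedType.Exports.
Local Open Scope classical_set_scope.
Local Open Scope ring_scope.

(* MathComp-Analysis norms matrices by the maximum of their entries; [enorm]
   is the Euclidean norm of a vector and the Frobenius norm of a matrix.  The
   topology of 'cV[R]_d and 'M[R]_d is the same for both. *)
Definition enorm {R : realType} {m n : nat} (A : 'M[R]_(m, n)) : R :=
  Num.sqrt (\sum_(i < m) \sum_(j < n) A i j ^+ 2).

(* R^d with its Borel sigma-algebra; the carrier is 'cV[R]_d. *)
Notation borelV R d := (g_sigma_algebraType (@open 'cV[R]_d)).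

(* The restriction of f to D is measurable from (the trace on D of) the
   sigma-algebra G to the Borel sigma-algebra of U. *)
Definition borel_measurable {T : Type} {U : topologicalType}
    (G : set (set T)) (D : set T) (f : T -> U) : Prop :=
  forall V : set U, <<s open >> V -> G (D `&` f @^-1` V).

Section wasserstein.
Context {R : realType} {d : nat}.
Local Open Scope ereal_scope.

Record P2 := MkP2 {
  P2_measure :> probability (borelV R d) R ;
  P2_second_moment :
    \int[P2_measure]_x ((enorm (x : 'cV[R]_d)) ^+ 2)%:E < +oo }.

Definition couplings (mu nu : P2) :
    set (probability (borelV R d * borelV R d)%type R) :=
  [set pi | forall A : set (borelV R d), measurable A ->
     pi (A `*` setT) = mu A /\ pi (setT `*` A) = nu A].

Definition W2 (mu nu : P2) : \bar R :=
  ereal_inf [set (\int[pi]_z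
      ((enorm ((z.1 : 'cV[R]_d) - (z.2 : 'cV[R]_d))) ^+ 2)%:E) `^ 2^-1
    | pi in couplings mu nu].

Definition W2_open : set (set P2) :=
  [set U | forall mu, U mu ->
    exists2 e : R, (0 < e)%R & forall nu, W2 mu nu < e%:E -> U nu].

Lemma W2_openT : W2_open setT.
Proof. by move=> mu _; exists 1%R. Qed.

Lemma W2_openI : setI_closed W2_open.
Proof.
move=> U V oU oV mu [/oU[e e0 eU] /oV[f f0 fV]].
exists (Num.min e f); first by rewrite lt_min e0 f0.
move=> nu; rewrite EFin_min lt_min => /andP[ne nf].
by split; [exact: eU|exact: fV].
Qed.

Lemma W2_open_bigcup (I : Type) (U : I -> set P2) :
  (forall i, W2_open (U i)) -> W2_open (\bigcup_i U i).
Proof.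
move=> oU mu [i _ /oU[e e0 eU]].
by exists e => // nu /eU ?; exists i.
Qed.

HB.instance Definition _ := gen_eqMixin P2.
HB.instance Definition _ := gen_choiceMixin P2.
HB.instance Definition _ :=
  isOpenTopological.Build P2 W2_openT W2_openI W2_open_bigcup.

End wasserstein.
Arguments P2 : clear implicits.

Section stochastic_calculus.
Context {R : realType} {disp : measure_display} {Omega : measurableType disp}.
Variables (P : probability Omega R) (F : R -> set (set Omega)).
Local Notation leb := (@lebesgue_measure R).

(* Filtrations are indexed by the t : R with 0 <= t. *)
Definition usual_filtration : Prop :=
  [/\ forall t : R, 0 <= t -> sigma_algebra setT (F t),
      forall t : R, 0 <= t -> F t `<=` measurable,
      forall s t : R, 0 <= s -> s <= t -> F s `<=` F t,
      forall t : R, 0 <= t -> \bigcap_(s in [set s | t < s]) F s = F t &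
      P.-negligible `<=` F 0].

Definition adapted (I : set R) (U : topologicalType)
    (X : R -> Omega -> U) : Prop :=
  forall t, I t -> borel_measurable (F t) setT (X t).

Definition progressive (T : R) (U : topologicalType)
    (H : R -> Omega -> U) : Prop :=
  forall t : R, 0 <= t <= T ->
    borel_measurable
      <<s [set A `*` C | A in (@measurable _ (measurableTypeR R)) & C in F t] >>
      (`[0, t] `*` setT) (fun z : R * Omega => H z.1 z.2).

Section dimension.
Context {d : nat}.
Implicit Types (B X M : R -> Omega -> 'cV[R]_d) (H : R -> Omega -> 'M[R]_d).

Definition brownian_motion B : Prop :=
  [/\ adapted [set t | 0 <= t] B,
      forall w, {within [set t | 0 <= t], continuous (fun t => B t w)},
      {ae P, forall w, B 0 w = 0},
      forall s t : R, 0 <= s -> s < t ->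
        forall (A : set Omega) (V : set (borelV R d)), F s A -> measurable V ->
          P (A `&` [set w | V (B t w - B s w)]) =
          (P A * P [set w | V (B t w - B s w)%R])%E &
      (* B t - B s has law N(0, (t - s) I_d), the d-fold product of
         N(0, t - s); [normal_prob] takes the standard deviation *)
      forall s t : R, 0 <= s -> s < t ->
        forall V : 'I_d -> set (measurableTypeR R),
          (forall i, measurable (V i)) ->
          P [set w | forall i, V i ((B t w - B s w) i 0)] =
          (\prod_(i < d) normal_prob 0 (Num.sqrt (t - s)) (V i))%E].

(* The simple integrand sum_k xi_k 1_]t_k, t_k+1], k < sp_size. *)
Record simple_process := SimpleProcess {
  sp_size : nat ;
  sp_time : nat -> R ;
  sp_coef : nat -> Omega -> 'M[R]_d }.

Definition simple (T : R) (S : simple_process) : Prop :=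
  [/\ 0 <= sp_time S 0,
      forall k, (k < sp_size S)%N -> sp_time S k <= sp_time S k.+1,
      sp_time S (sp_size S) <= T,
      forall k, (k < sp_size S)%N ->
        borel_measurable (F (sp_time S k)) setT (sp_coef S k) &
      exists K : R, forall k w, (k < sp_size S)%N -> enorm (sp_coef S k w) <= K].

Definition sp_val (S : simple_process) (t : R) (w : Omega) : 'M[R]_d :=
  \sum_(k < sp_size S | sp_time S k < t <= sp_time S k.+1) sp_coef S k w.

Definition sp_integral B (S : simple_process) (t : R) (w : Omega) : 'cV[R]_d :=
  \sum_(k < sp_size S)
    sp_coef S k w *m (B (Num.min (sp_time S k.+1) t) w -
                      B (Num.min (sp_time S k) t) w).

(* The distance of two integrands in L^2([0, T] x Omega, dt x P). *)
Definition integrand_dist2 (T : R) H H' : \bar R :=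
  (\int[P]_w \int[leb]_(t in `[0%R, T])
    ((enorm (H t w - H' t w)) ^+ 2)%:E)%E.

(* M is (a version of) the Ito integral (int_0^t H_s dB_s)_{0 <= t <= T} of an
   integrand in L^2([0, T] x Omega): the continuous adapted process whose value
   at each t is the L^2(P)-limit of the integrals of simple integrands
   converging to H. *)
Definition ito_integral B (T : R) H M : Prop :=
  [/\ progressive T H,
      (integrand_dist2 T H (fun _ _ => 0%R) < +oo)%E,
      adapted `[0, T] M,
      forall w, {within `[0, T], continuous (fun t => M t w)} &
      exists S : nat -> simple_process,
        [/\ forall n, simple T (S n),
            integrand_dist2 T H (sp_val (S n)) @[n --> \oo] --> 0%E &
            forall t : R, 0 <= t <= T ->
              (\int[P]_w ((enorm (sp_integral B (S n) t w - M t w)) ^+ 2)%:E)%E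
                @[n --> \oo] --> 0%E]].

(* The norm of L^2(Omega, C([0, T], R^d)), read on representatives. *)
Definition L2C_norm (T : R) X : \bar R :=
  (((\int[P]_w ereal_sup [set ((enorm (X t w)) ^+ 2)%:E | t in `[0%R, T]])
    `^ 2^-1)%E).

Definition vec_integral (t : R) (f : R -> 'cV[R]_d) : 'cV[R]_d :=
  \col_i Rintegral leb `[0, t] (fun s => f s i 0).

Definition has_law (Y : Omega -> 'cV[R]_d) (mu : P2 R d) : Prop :=
  forall V : set (borelV R d), measurable V -> mu V = P (Y @^-1` V).

(* mu_t is the law of X_t; the second moments that make it a member of P2
   come from the condition on the norm of X. *)
Definition mckean_vlasov_solution B (T : R)
    (b : R -> 'cV[R]_d -> P2 R d -> 'cV[R]_d)
    (sigma : R -> 'cV[R]_d -> P2 R d -> 'M[R]_d)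
    (x : 'cV[R]_d) X : Prop :=
  [/\ adapted `[0, T] X,
      forall w, {within `[0, T], continuous (fun t => X t w)},
      (L2C_norm T X < +oo)%E &
      exists (mu : R -> P2 R d) M,
        [/\ forall t : R, 0 <= t <= T -> has_law (X t) (mu t),
            ito_integral B T (fun t w => sigma t (X t w) (mu t)) M &
            {ae P, forall w, forall t : R, 0 <= t <= T ->
              X t w =
              x + vec_integral t (fun s => b s (X s w) (mu s)) + M t w}]].

End dimension.
End stochastic_calculus.

(* Main.v *)
Require Import Defs.
From HB Require Import structures.
From mathcomp Require Import all_boot all_order all_algebra.
From mathcomp Require Import all_classical all_reals all_analysis.
From mathcomp Require Import measurable_realfun ring lra.

(* Two solutions are compared in mean square. The joint law of X_t and X'_t is a
   coupling of their laws, so W_2 (law X_t) (law X'_t) ^ 2 <= E |X_t - X'_t| ^ 2,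
   and the Lipschitz condition bounds the differences of the coefficients along
   the two paths by |X_t - X'_t| + (E |X_t - X'_t| ^ 2)^(1/2). The Cauchy-Schwarz
   inequality for the drift and the Ito isometry for the martingale part then give
     E |X_t - X'_t| ^ 2 <= 3 |x - x'| ^ 2 + k int_0^t E |X_s - X'_s| ^ 2 ds,
   so Gronwall's lemma bounds the left-hand side by a multiple of |x - x'| ^ 2,
   and Doob's inequality moves the supremum inside the expectation.

   The drifts s |-> b (s, X_s, mu_s) are not known to be measurable, because
   nothing is known about s |-> mu_s; their integrals are only lower integrals,
   which costs a factor 2 in the drift estimate. *)

Set Implicit Arguments.
Unset Strict Implicit.
Unset Printing Implicit Defensive.

Import Order.TTheory GRing.Theory Num.Theory.
Import numFieldNormedType.Exports.
Local Open Scope classical_set_scope.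
Local Open Scope ring_scope.

(** * Lower integrals *)

(** The Ito integral is given only as a mean-square limit of simple integrals. Its martingale
    property and its isometry are therefore proved for simple integrands, from the increments of the
    Brownian motion, and passed to the limit; the isometry survives as an inequality with a larger
    constant, which is enough for Gronwall's lemma.

    Conditional expectations are avoided. A variable with zero mean on every set of a sigma-algebra
    is orthogonal to the functions measurable for it ([Rintegral_mul_eq0]), and both independence
    and the martingale property are exploited through this fact. Doob's inequality is derived
    pathwise on finite time grids, and path continuity turns maxima over grids into suprema.

    The drift difference is replaced at once by a jointly measurable majorant [h], to which
    Tonelli's theorem and the Cauchy-Schwarz inequality apply; the diffusion coefficients are
    measurable because [ito_integral] asks for progressive integrands. Gronwall's lemma needs an a
    priori finite bound, supplied by the finite norms of the two solutions. *)

Section nonmeasurable_integrands.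
Context {d} {T : measurableType d} {R : realType}.
Variable mu : {measure set T -> \bar R}.
Local Open Scope ereal_scope.
Import HBNNSimple.

(* Without measurability the library integral is a lower integral: it is still
   monotone, and subadditive as soon as one of the two summands is measurable. *)
Lemma ge0_le_lower_integral (D : set T) (f g : T -> \bar R) :
  (forall x, D x -> 0 <= f x) -> (forall x, D x -> f x <= g x) ->
  \int[mu]_(x in D) f x <= \int[mu]_(x in D) g x.
Proof.
move=> f0 fg; rewrite !ge0_integralE //; last first.
  by move=> x Dx; exact: le_trans (f0 _ Dx) (fg _ Dx).
apply: le_ereal_sup => _ [h hf <-]; exists h => // x.
by apply: le_trans (hf x) _; exact: lee_restrict.
Qed.

Lemma ge0_lower_integral_leD (D : set T) (f g h : T -> \bar R) :
  measurable D -> (forall x, D x -> 0 <= f x) -> (forall x, D x -> 0 <= g x) ->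
  (forall x, D x -> 0 <= h x) -> measurable_fun D h ->
  (forall x, D x -> f x <= g x + h x) ->
  \int[mu]_(x in D) f x <= \int[mu]_(x in D) g x + \int[mu]_(x in D) h x.
Proof.
move=> mD f0 g0 h0 mh fgh; rewrite ge0_integralE//.
apply: ub_ereal_sup => _ [s sf <-].
pose hD := h \_ D.
have mhD : measurable_fun setT hD by apply/(measurable_restrictT _ mD).
have hD0 x : 0 <= hD x by apply: erestrict_ge0.
(* [s] is a simple function below [f]. Its excess over [h], cut off at zero, is measurable and lies
   below [g], so additivity is used only for the measurable sum [u + hD]. *)
pose u x := maxe ((s x)%:E - hD x) 0.
have u0 x : 0 <= u x by rewrite /u le_max lexx orbT.
have ms : measurable_fun setT (fun x => (s x)%:E) by exact/measurable_EFinP.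
have mu' : measurable_fun setT u.
  by apply: measurable_maxe => //; exact: emeasurable_funB.
rewrite -integralT_nnsfun.
apply: (@le_trans _ _ (\int[mu]_x (u x + hD x))).
  apply: ge0_le_integral => //.
  - by move=> x _; rewrite lee_fin.
  - exact: emeasurable_funD.
  - move=> x _ /=; rewrite /u; move: (hD0 x).
    case: (hD x) => [r| |] //; last (move=> _; rewrite ?addeNy ?maxNye ?add0e; exact: leey).
    by rewrite -EFinB -EFin_max -EFinD !lee_fin => r0; rewrite -lerBlDr le_max lexx.
rewrite (ge0_integralD mu measurableT)// leeD//; last by rewrite -integral_mkcond.
rewrite [leRHS]integral_mkcond; apply: ge0_le_lower_integral => // x _.
rewrite /u ge_max; apply/andP; split; last by apply: erestrict_ge0.
have := sf x; rewrite /hD !patchE; case: ifPn => xD sx.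
  have Dx := set_mem xD.
  have := le_trans sx (fgh x Dx); move: (h0 x Dx).
  case: (h x) => [r| |] // _; last by rewrite addeNy ?leNye.
  by rewrite leeBlDr.
by rewrite sube0.
Qed.

(** The library integral is the difference of the lower integrals of the positive and the negative
    part. Each of these changes by at most the integral of [h] when [f] is replaced by [g], whence
    the factor 2. The majorant [k] keeps all these integrals finite, since [fine] would send an
    infinite one to 0. *)
Lemma le_Rintegral_dist (D : set T) (f g h k : T -> R) : measurable D ->
  (forall x, D x -> `|f x| <= k x)%R -> (forall x, D x -> `|g x| <= k x)%R ->
  (forall x, D x -> `|f x - g x| <= h x)%R -> measurable_fun D h ->
  \int[mu]_(x in D) (k x)%:E < +oo -> \int[mu]_(x in D) (h x)%:E < +oo ->
  (`|Rintegral mu D f - Rintegral mu D g| <= 2 * Rintegral mu D h)%R.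
Proof.
move=> mD fk gk fgh mh ik ih.
have k0 x : D x -> (0 <= k x)%R by move=> /fk; exact: le_trans.
have h0 x : D x -> (0 <= h x)%R by move=> /fgh; exact: le_trans.
(* [e] stands for the positive or the negative part: both are 1-Lipschitz and bounded by the
   absolute value. *)
have pn_le (e : R -> R) (f' g' : T -> R) : (forall a, 0 <= e a <= `|a|)%R ->
   (forall a b, e a <= e b + `|a - b|)%R ->
   (forall x, D x -> `|f' x| <= k x)%R -> (forall x, D x -> `|g' x| <= k x)%R ->
   (forall x, D x -> `|f' x - g' x| <= h x)%R ->
   (Rintegral mu D (e \o f') <= Rintegral mu D (e \o g') + Rintegral mu D h)%R /\
   \int[mu]_(x in D) (e (f' x))%:E \is a fin_num.
  move=> e0 eL fk' gk' fgh'.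
  have fin f'' : (forall x, D x -> `|f'' x| <= k x)%R ->
      \int[mu]_(x in D) (e (f'' x))%:E \is a fin_num.
    move=> fk''; rewrite ge0_fin_numE; last first.
      by apply: integral_ge0 => x _; rewrite lee_fin; case/andP: (e0 (f'' x)).
    apply: le_lt_trans ik; apply: ge0_le_lower_integral => x Dx; rewrite lee_fin.
      by case/andP: (e0 (f'' x)).
    by case/andP: (e0 (f'' x)) => _ /le_trans; apply; exact: fk''.
  split; last exact: fin.
  rewrite -lee_fin EFinD !fineK ?fin//; last first.
    by rewrite ge0_fin_numE//; apply: integral_ge0 => x Dx; rewrite lee_fin h0.
  apply: ge0_lower_integral_leD => //.
  - by move=> x _; rewrite lee_fin; case/andP: (e0 (f' x)).
  - by move=> x _; rewrite lee_fin; case/andP: (e0 (g' x)).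
  - exact/measurable_EFinP.
  - move=> x Dx; rewrite -EFinD lee_fin.
    by rewrite (le_trans (eL _ (g' x)))// lerD2l fgh'.
have gfh x : D x -> (`|g x - f x| <= h x)%R by move=> Dx; rewrite distrC fgh.
pose p (a : R) := Num.max a 0%R; pose n (a : R) := Num.max (- a)%R 0%R.
have p1 a : (0 <= p a <= `|a|)%R.
  by rewrite /p le_max lexx orbT ge_max normr_ge0 ler_norm.
have p2 a b : (p a <= p b + `|a - b|)%R.
  rewrite /p ge_max; apply/andP; split; last by rewrite addr_ge0// le_max lexx orbT.
  by rewrite -lerBlDr (le_trans _ (_ : b <= _)%R) ?le_max ?lexx// lerBlDl -lerBlDr ler_norm.
have n1 a : (0 <= n a <= `|a|)%R by rewrite -normrN; exact: p1.
have n2 a b : (n a <= n b + `|a - b|)%R.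
  by have := p2 (- a)%R (- b)%R; rewrite opprK [(- a + b)%R]addrC distrC.
have E f' : (forall x, D x -> `|f' x| <= k x)%R ->
   Rintegral mu D f' = (Rintegral mu D (p \o f') - Rintegral mu D (n \o f'))%R.
  move=> fk'; rewrite [LHS]/Rintegral integralE.
  have -> : \int[mu]_(x in D) (fun x => (f' x)%:E)^\+ x = \int[mu]_(x in D) (p (f' x))%:E.
    by apply: eq_integral => x _; rewrite funeposE /p EFin_max.
  have -> : \int[mu]_(x in D) (fun x => (f' x)%:E)^\- x = \int[mu]_(x in D) (n (f' x))%:E.
    by apply: eq_integral => x _; rewrite funenegE /n EFin_max EFinN.
  have f'f' x : D x -> (`|f' x - f' x| <= h x)%R by rewrite subrr normr0; exact: h0.
  by rewrite fineB//; [exact: (pn_le p f' f' _ _ _ _ _).2|exact: (pn_le n f' f' _ _ _ _ _).2].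
rewrite (E f)// (E g)//.
have [a1 _] := pn_le p f g p1 p2 fk gk fgh.
have [a2 _] := pn_le p g f p1 p2 gk fk gfh.
have [b1 _] := pn_le n f g n1 n2 fk gk fgh.
have [b2 _] := pn_le n g f n1 n2 gk fk gfh.
rewrite ler_norml; apply/andP; split; lra.
Qed.

End nonmeasurable_integrands.

(** * Real-valued and square integrable functions *)

Section real_integrals.
Context {d} {T : measurableType d} {R : realType}.
Variable mu : {measure set T -> \bar R}.
Implicit Types f g h : T -> R.

Lemma Rintegral_sum (D : set T) (I : Type) (s : seq I) (f : I -> T -> R) :
  measurable D -> (forall i, mu.-integrable D (EFin \o f i)) ->
  Rintegral mu D (fun x => \sum_(i <- s) f i x) = \sum_(i <- s) Rintegral mu D (f i).
Proof.
move=> mD fi; rewrite /Rintegral.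
under eq_integral do rewrite -sumEFin.
rewrite integral_sum// -[RHS]/(fine (_%:E)) -EFin_sum_fine//.
by move=> i _; apply: integrable_fin_num => //; exact: fi.
Qed.

Lemma integrable_sumR (D : set T) (I : Type) (s : seq I) (f : I -> T -> R) :
  measurable D -> (forall i, mu.-integrable D (EFin \o f i)) ->
  mu.-integrable D (EFin \o (fun x => \sum_(i <- s) f i x)).
Proof.
move=> mD fi; have -> : EFin \o (fun x => \sum_(i <- s) f i x) =
    (fun x => \sum_(i <- s) (f i x)%:E)%E by apply/funext => x /=; rewrite sumEFin.
by apply: integrable_sum => // i _; exact: fi.
Qed.

Lemma le_integrableR (D : set T) f g : measurable D -> measurable_fun D f ->
  (forall x, D x -> `|f x| <= g x) -> mu.-integrable D (EFin \o g) ->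
  mu.-integrable D (EFin \o f).
Proof.
move=> mD mf fg; apply: le_integrable => //; first exact/measurable_EFinP.
by move=> x Dx /=; rewrite lee_fin (le_trans (fg x Dx))// ler_norm.
Qed.

Lemma ge0_integrableR (D : set T) f : measurable_fun D f ->
  (forall x, D x -> 0 <= f x) -> (\int[mu]_(x in D) (f x)%:E < +oo)%E ->
  mu.-integrable D (EFin \o f).
Proof.
move=> mf f0 fi; apply/integrableP; split; first exact/measurable_EFinP.
rewrite (eq_integral (fun x => (f x)%:E))// => x /set_mem Dx.
by rewrite /= ger0_norm// f0.
Qed.

Lemma EFin_Rintegral (D : set T) f : measurable D -> mu.-integrable D (EFin \o f) ->
  (Rintegral mu D f)%:E = (\int[mu]_(x in D) (f x)%:E)%E.
Proof. by move=> mD fi; rewrite fineK//; exact: integrable_fin_num. Qed.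

Lemma le_RintegralR (D : set T) f g : measurable D ->
  mu.-integrable D (EFin \o f) -> mu.-integrable D (EFin \o g) ->
  (forall x, D x -> f x <= g x) -> Rintegral mu D f <= Rintegral mu D g.
Proof.
move=> mD fi gi fg; rewrite -lee_fin !EFin_Rintegral//.
by apply: le_integral => // x /set_mem Dx; rewrite /= lee_fin fg.
Qed.

(** Integrating [0 <= (h - c) ^ 2] gives [2 c A <= Q + c ^ 2 m] for every constant [c]; the mean
    value [c = A / m] is the best choice. *)
Lemma Rintegral_sqr_le (D : set T) h (m : R) : measurable D -> mu D = m%:E ->
  mu.-integrable D (EFin \o h) -> mu.-integrable D (EFin \o (fun x => h x ^+ 2)) ->
  (Rintegral mu D h) ^+ 2 <= m * Rintegral mu D (fun x => h x ^+ 2).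
Proof.
move=> mD muD hi h2i.
have m0 : 0 <= m by rewrite -lee_fin -muD.
have ci c : mu.-integrable D (EFin \o cst c).
  apply/integrableP; split; first exact/measurable_EFinP.
  by rewrite (eq_integral (cst `|c|%:E))// integral_cst// muD -EFinM ltry.
have rc c : Rintegral mu D (cst c) = c * m.
  by rewrite Rintegral_cst// muD.
set A := Rintegral mu D h; set Q := Rintegral mu D _.
have zi c : mu.-integrable D (EFin \o (fun x => c * h x)).
  by have := integrableZl mD c hi; apply: eq_integrable.
have key c : 2 * c * A <= Q + c ^+ 2 * m.
  rewrite /A -RintegralZl// -rc -RintegralD//; last exact: ci.
  apply: le_RintegralR => //.
    have := integrableD mD h2i (ci (c ^+ 2)); exact: eq_integrable.
  by move=> x _; have := sqr_ge0 (h x - c); rewrite /cst sqrrB; lra.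
have [m0'|mp] := eqVneq m 0.
  have A0 : A = 0.
    apply/eqP; rewrite -[_ == _]negbK; apply/negP => A0.
    (* For [m = 0] the right-hand side of [key] is the constant [Q], while this [c] makes the
       left-hand side [Q + 1]. *)
    have := key ((Q + 1) / (2 * A)); rewrite m0' mulr0 addr0.
    rewrite (_ : 2 * _ * A = Q + 1); first by lra.
    by field.
  by rewrite A0 m0' mul0r expr0n.
have mpos : 0 < m by rewrite lt_neqAle eq_sym mp.
have := key (A / m).
rewrite (_ : 2 * (A / m) * A = 2 * (A ^+ 2 / m)); last by field.
rewrite (_ : (A / m) ^+ 2 * m = A ^+ 2 / m); last by field.
by move=> k; rewrite mulrC -ler_pdivrMr//; lra.
Qed.

Definition square_integrable f :=
  measurable_fun setT f /\ (\int[mu]_x (f x ^+ 2)%:E < +oo)%E.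

Lemma square_integrableP f : square_integrable f <->
  measurable_fun setT f /\ mu.-integrable setT (EFin \o (fun x => f x ^+ 2)).
Proof.
split=> [[mf fi]|[mf /integrableP[_ fi]]]; split=> //.
  by apply: ge0_integrableR => [|x _|//]; [exact: measurable_funX|exact: sqr_ge0].
by under eq_integral do rewrite -[X in X%:E]ger0_norm ?sqr_ge0//.
Qed.

Lemma square_integrableM f g : square_integrable f -> square_integrable g ->
  mu.-integrable setT (EFin \o (fun x => f x * g x)).
Proof.
move=> /square_integrableP[mf fi] /square_integrableP[mg gi].
apply: (@le_integrableR _ _ (fun x => f x ^+ 2 + g x ^+ 2)) => //.
- exact: measurable_funM.
- move=> x _; rewrite normrM -[f x ^+ 2]real_normK ?num_real// -[g x ^+ 2]real_normK ?num_real//.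
  by have := sqr_ge0 (`|f x| - `|g x|); rewrite sqrrB; have := mulr_ge0 (normr_ge0 (f x)) (normr_ge0 (g x)); lra.
- by have := integrableD measurableT fi gi; exact: eq_integrable.
Qed.

Lemma le_square_integrable f g : measurable_fun setT f ->
  (forall x, f x ^+ 2 <= g x) -> mu.-integrable setT (EFin \o g) -> square_integrable f.
Proof.
move=> mf fg gi; apply/square_integrableP; split=> //.
by apply: (@le_integrableR _ _ g) => //; [exact: measurable_funX|move=> x _; rewrite ger0_norm ?sqr_ge0].
Qed.

Lemma square_integrableD f g : square_integrable f -> square_integrable g ->
  square_integrable (fun x => f x + g x).
Proof.
move=> /square_integrableP[mf fi] /square_integrableP[mg gi].
apply: (@le_square_integrable _ (fun x => 2 * (f x ^+ 2 + g x ^+ 2))).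
- exact: measurable_funD.
- by move=> x; have := sqr_ge0 (f x - g x); rewrite sqrrB sqrrD; lra.
- have := integrableZl measurableT 2 (integrableD measurableT fi gi).
  exact: eq_integrable.
Qed.

Lemma bounded_square_integrableM f g (K : R) : measurable_fun setT f ->
  (forall x, `|f x| <= K) -> square_integrable g ->
  square_integrable (fun x => f x * g x).
Proof.
move=> mf fK /square_integrableP[mg gi].
apply: (@le_square_integrable _ (fun x => K ^+ 2 * g x ^+ 2)).
- exact: measurable_funM.
- move=> x; rewrite exprMn ler_wpM2r ?sqr_ge0// -[leLHS]real_normK ?num_real//.
  by rewrite ler_pXn2r ?nnegrE// (le_trans _ (fK x)).
- have := integrableZl measurableT (K ^+ 2) gi; exact: eq_integrable.
Qed.

Lemma square_integrableZ (c : R) f : square_integrable f ->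
  square_integrable (fun x => c * f x).
Proof. exact: (@bounded_square_integrableM (cst c) _ `|c|). Qed.

Lemma square_integrableB f g : square_integrable f -> square_integrable g ->
  square_integrable (fun x => f x - g x).
Proof.
move=> fi gi; have := square_integrableD fi (square_integrableZ (-1) gi).
by under [in X in _ -> X]eq_fun do rewrite -mulN1r.
Qed.

Lemma square_integrable0 : square_integrable (fun=> 0).
Proof.
split; first exact: measurable_cst.
by under eq_integral do rewrite expr0n; rewrite integral0.
Qed.

Lemma square_integrable_sum (I : Type) (s : seq I) (f : I -> T -> R) :
  (forall i, square_integrable (f i)) ->
  square_integrable (fun x => \sum_(i <- s) f i x).
Proof.
move=> fi; elim: s => [|i s ih].
  by under eq_fun do rewrite big_nil; exact: square_integrable0.
by under eq_fun do rewrite big_cons; exact: square_integrableD.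
Qed.

End real_integrals.

(** * Orthogonality to a sub-sigma-algebra *)

Section sub_sigma_algebra.
Context {d} {T : measurableType d} {R : realType}.
Variables (mu : {measure set T -> \bar R}) (G : set (set T)).
Hypotheses (sG : sigma_algebra setT G) (GM : G `<=` @measurable d T).

Lemma g_sigma_measurable (A : set (g_sigma_algebraType G)) : measurable A <-> G A.
Proof. by have := measurable_g_measurableTypeE sG => ->. Qed.

Lemma sub_measurable_fun d' (U : measurableType d') (f : T -> U) :
  measurable_fun setT (f : g_sigma_algebraType G -> U) -> measurable_fun setT f.
Proof.
move=> mf _ Y mY; apply: GM; apply/g_sigma_measurable.
exact: (mf measurableT Y mY).
Qed.

Import HBNNSimple.

Let ge0_Rintegral_mul_eq0 (f Z : T -> R) :
  measurable_fun setT (f : g_sigma_algebraType G -> R) -> (forall x, 0 <= f x) ->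
  mu.-integrable setT (EFin \o Z) -> mu.-integrable setT (EFin \o (fun x => f x * Z x)) ->
  (forall A, G A -> Rintegral mu setT (fun x => \1_A x * Z x) = 0) ->
  Rintegral mu setT (fun x => f x * Z x) = 0.
Proof.
move=> mf f0 Zi fZi Z0.
have mef : measurable_fun setT (EFin \o f : g_sigma_algebraType G -> \bar R).
  exact/measurable_EFinP.
(* The approximation is taken for the measurable structure generated by [G], so that the level sets
   of every [g n] belong to [G]. *)
pose g n : T -> R := nnsfun_approx measurableT mef n.
have mg n : measurable_fun setT (g n).
  apply: sub_measurable_fun; rewrite /g; exact: measurable_funP.
have mZ : measurable_fun setT Z by move/integrableP : Zi => [/measurable_EFinP].
have gZ n : Rintegral mu setT (fun x => g n x * Z x) = 0.
  rewrite /g; set h := nnsfun_approx _ _ n.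
  pose s := finmap.enum_fset (fset_set (range h)).
  have hA i : G (h @^-1` [set s`_i]).
    by apply/g_sigma_measurable; exact: measurable_sfunP.
  have AZi i : mu.-integrable setT (EFin \o (fun x => \1_(h @^-1` [set s`_i]) x * Z x)).
    apply: (@le_integrableR _ _ _ _ _ _ (fun x => `|Z x|)) => //.
    - by apply: measurable_funM => //; apply: measurable_indic; exact: GM.
    - move=> x _; rewrite normrM ler_piMl// ger0_norm ?indicE//.
      by case: (_ \in _).
    - exact: integrable_norm.
  have -> : (fun x => h x * Z x) =
      (fun x => \sum_(i < size s) s`_i * (\1_(h @^-1` [set s`_i]) x * Z x)).
    apply/funext => x; rewrite fimfunEord big_distrl /=.
    by apply: eq_bigr => i _; rewrite mulrA.
  rewrite Rintegral_sum//; last first.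
    move=> i; have := integrableZl measurableT s`_i (AZi i).
    exact: eq_integrable.
  by apply: big1 => i _; rewrite RintegralZl// Z0// mulr0.
have mfT : measurable_fun setT f by exact: sub_measurable_fun.
have [|||||_ _] := @dominated_convergence _ _ _ mu setT measurableT
   (fun n x => (g n x * Z x)%:E) (fun x => (f x * Z x)%:E) (fun x => `|f x * Z x|%:E).
- by move=> n; apply/measurable_EFinP; exact: measurable_funM.
- by apply/measurable_EFinP; exact: measurable_funM.
- apply: aeW => x _.
  apply: cvg_EFin; first by near=> n.
  have gf : g n x @[n --> \oo] --> f x.
    have := @cvg_nnsfun_approx _ _ _ _ measurableT _ mef (fun x _ => f0 x) x I.
    by move/fine_cvgP => [_]; apply: cvg_trans; apply: near_eq_cvg; near=> n.
  by apply: cvgMl.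
- exact: integrable_norm.
- apply: aeW => x n _; rewrite /= lee_fin !normrM ler_wpM2r//.
  rewrite !ger0_norm// /g ?nnsfun_approxE//.
  by have := @le_approx _ (g_sigma_algebraType G) R setT (EFin \o f) n x (fun x _ => f0 x) I.
move=> /cvg_lim h; rewrite /Rintegral -h//.
rewrite (_ : (fun n => _) = cst 0%E); first by rewrite lim_cst.
apply/funext => n; rewrite -EFin_Rintegral// ?gZ//.
apply: (@le_integrableR _ _ _ _ _ _ (fun x => `|f x * Z x|)) => //.
- exact: measurable_funM.
- move=> x _; rewrite !normrM ler_wpM2r//.
  rewrite !ger0_norm// /g ?nnsfun_approxE//.
  by have := @le_approx _ (g_sigma_algebraType G) R setT (EFin \o f) n x (fun x _ => f0 x) I.
- exact: integrable_norm.
Unshelve. all: by end_near. Qed.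

(** This replaces conditional expectation: the last hypothesis says that [Z] has conditional mean
    zero given [G], and the conclusion takes the [G]-measurable factor [f] out. Linearity and
    dominated convergence lead from indicators to nonnegative [f], and the positive and negative
    parts give the general case. *)
Lemma Rintegral_mul_eq0 (f Z : T -> R) :
  measurable_fun setT (f : g_sigma_algebraType G -> R) ->
  mu.-integrable setT (EFin \o Z) -> mu.-integrable setT (EFin \o (fun x => f x * Z x)) ->
  (forall A, G A -> Rintegral mu setT (fun x => \1_A x * Z x) = 0) ->
  Rintegral mu setT (fun x => f x * Z x) = 0.
Proof.
move=> mf Zi fZi Z0.
have mZ : measurable_fun setT Z by move/integrableP : Zi => [/measurable_EFinP].
have part (e : R -> R) : measurable_fun setT e -> (forall a, 0 <= e a <= `|a|) ->
   Rintegral mu setT (fun x => e (f x) * Z x) = 0 /\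
   mu.-integrable setT (EFin \o (fun x => e (f x) * Z x)).
  move=> me e0.
  have mef : measurable_fun setT (e \o f : g_sigma_algebraType G -> R).
    exact: measurableT_comp.
  have efZ : mu.-integrable setT (EFin \o (fun x => e (f x) * Z x)).
    apply: (@le_integrableR _ _ _ _ _ _ (fun x => `|f x * Z x|)) => //.
    - by apply: measurable_funM => //; exact: (sub_measurable_fun mef).
    - move=> x _; rewrite !normrM ler_wpM2r//.
      by case/andP: (e0 (f x)) => a b; rewrite ger0_norm.
    - exact: integrable_norm.
  split=> //; apply: ge0_Rintegral_mul_eq0 => // x; by case/andP: (e0 (f x)).
have [||p0 p1] := part (fun a => Num.max a 0).
- exact: measurable_maxr.
- by move=> a; rewrite le_max lexx orbT ge_max normr_ge0 ler_norm.
have [||n0 n1] := part (fun a => Num.max (- a) 0).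
- by apply: measurable_maxr => //; exact: measurable_funN.
- by move=> a; rewrite le_max lexx orbT ge_max normr_ge0 -normrN ler_norm.
rewrite (_ : (fun x => f x * Z x) =
    (fun x => Num.max (f x) 0 * Z x) \- (fun x => Num.max (- f x) 0 * Z x)).
  by rewrite RintegralB// p0 n0 subrr.
apply/funext => x /=; rewrite -mulrBl; congr (_ * _).
by rewrite !maxElt; case: ltP => ?; case: ltP => ?; lra.
Qed.

End sub_sigma_algebra.

(** * Moments of the normal distribution *)

Section density.
Context {d} {T : measurableType d} {R : realType}.
Variables (mu nu : {measure set T -> \bar R}) (p : T -> R).
Hypotheses (mp : measurable_fun setT p) (p0 : forall x, 0 <= p x).
Hypothesis nuE : forall A, measurable A -> nu A = (\int[mu]_(x in A) (p x)%:E)%E.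
Local Open Scope ereal_scope.
Import HBNNSimple.

Lemma ge0_integral_density (f : T -> \bar R) : measurable_fun setT f ->
  (forall x, 0 <= f x) -> \int[nu]_x f x = \int[mu]_x (f x * (p x)%:E).
Proof.
move=> mf f0; pose g n : T -> R := nnsfun_approx measurableT mf n.
have g0 n x : (0 <= g n x)%R by rewrite /g.
have mg n : measurable_fun setT (g n) by exact: measurable_funP.
have nd x : {homo g ^~ x : n m / (n <= m)%N >-> (n <= m)%R}.
  by move=> m n mn; exact/lefP/nd_nnsfun_approx.
have gf x : limn (fun n => (g n x)%:E) = f x.
  by apply/cvg_lim => //; apply: cvg_nnsfun_approx.
have gfp x : limn (fun n => (g n x * p x)%:E) = f x * (p x)%:E.
  apply/cvg_lim => //; under eq_fun do rewrite EFinM.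
  by apply: cvgeZr => //; apply: cvg_nnsfun_approx.
under eq_integral do rewrite -gf.
under [RHS]eq_integral do rewrite -gfp.
rewrite (@monotone_convergence _ _ _ nu _ measurableT (fun n x => (g n x)%:E)); first last.
- by move=> x _ m n mn; rewrite lee_fin nd.
- by move=> n x _; rewrite lee_fin.
- by move=> n; exact/measurable_EFinP.
rewrite (@monotone_convergence _ _ _ mu _ measurableT (fun n x => (g n x * p x)%:E)); first last.
- by move=> x _ m n mn; rewrite lee_fin ler_wpM2r// nd.
- by move=> n x _; rewrite lee_fin mulr_ge0.
- by move=> n; apply/measurable_EFinP; exact: measurable_funM.
congr (limn _); apply/funext => n; rewrite /g; set h := nnsfun_approx _ _ n.
pose s := finmap.enum_fset (fset_set (range h)).
have mA i : measurable (h @^-1` [set s`_i]) by exact: measurable_sfunP.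
have s0 i : (i < size s)%N -> (0 <= s`_i)%R.
  move=> /(mem_nth 0%R); rewrite -/s /s.
  by rewrite in_fset_set// inE => -[x _ <-].
have hE x : h x = (\sum_(i < size s) s`_i * \1_(h @^-1` [set s`_i]) x)%R by rewrite fimfunEord.
under eq_integral do rewrite hE -sumEFin.
under [RHS]eq_integral do rewrite hE big_distrl -sumEFin.
have mI (i : 'I_(size s)) : measurable_fun setT (fun x => s`_i * \1_(h @^-1` [set s`_i]) x)%R.
  by apply: measurable_funM => //; exact: measurable_indic.
have I0 (i : 'I_(size s)) x : (0 <= s`_i * \1_(h @^-1` [set s`_i]) x)%R by rewrite mulr_ge0// s0.
rewrite (@ge0_integral_sum _ _ _ nu _ measurableT _
    (fun (i : 'I_(size s)) x => (s`_i * \1_(h @^-1` [set s`_i]) x)%:E)%R); first last.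
- by move=> i x _; rewrite lee_fin.
- by move=> i; exact/measurable_EFinP.
rewrite (@ge0_integral_sum _ _ _ mu _ measurableT _
    (fun (i : 'I_(size s)) x => (s`_i * \1_(h @^-1` [set s`_i]) x * p x)%:E)%R); first last.
- by move=> i x _; rewrite lee_fin mulr_ge0.
- by move=> i; apply/measurable_EFinP; exact: measurable_funM.
apply: eq_bigr => i _.
under eq_integral do rewrite EFinM.
under [RHS]eq_integral do rewrite -mulrA EFinM.
rewrite ge0_integralZl_EFin ?s0//; last first.
  by apply/measurable_EFinP; exact: measurable_indic.
rewrite ge0_integralZl_EFin ?s0//; first last.
- by apply/measurable_EFinP/measurable_funM => //; exact: measurable_indic.
- by move=> x _; rewrite lee_fin mulr_ge0.
congr (_ * _); rewrite integral_indic// setIT nuE// integral_mkcond.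
apply: eq_integral => x _; rewrite patchE indicE.
by case: ifPn => _; rewrite ?mul1r ?mul0r.
Qed.

End density.

Section lebesgue_change.
Context {R : realType}.
Local Open Scope ereal_scope.
Notation leb := (@lebesgue_measure R).

Lemma ge0_integral_lebesgueN (f : R -> \bar R) : measurable_fun setT f ->
  (forall x, 0 <= f x) -> \int[leb]_x f x = \int[leb]_x f (- x)%R.
Proof.
move=> mf f0; have := @ge0_integral_pushforward _ _ (measurableTypeR R) (measurableTypeR R) R (-%R) (@oppr_measurable R setT) leb setT f measurableT mf (fun x _ => f0 x).
rewrite preimage_setT => <-; apply: eq_measure_integral => A mA _.
exact/esym/lebesgue_measureN.
Qed.

Lemma ge0_integral_lebesgueM (s : R) (f : R -> \bar R) : (0 < s)%R ->
  measurable_fun setT f -> (forall x, 0 <= f x) ->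
  \int[leb]_x f x = s%:E * \int[leb]_x f (s * x)%R.
Proof.
move=> s0 mf f0; have := @ge0_integral_pushforward _ _ (measurableTypeR R) (measurableTypeR R) R ( *%R s) (@mulrl_measurable R setT s) leb setT f measurableT mf (fun x _ => f0 x).
rewrite preimage_setT /= => <-.
have s0' : (0 <= s)%R by exact: ltW.
pose m : {measure set (measurableTypeR R) -> \bar R} :=
  pushforward leb ( *%R s : measurableTypeR R -> measurableTypeR R).
rewrite -[s%:E]/((NngNum s0')%:num%:E) -ge0_integral_mscale//.
apply: eq_measure_integral => A mA _.
(* [s] times the image of Lebesgue measure under multiplication by [s] has the right value on
   half-open intervals. *)
apply: lebesgue_measure_unique => // X [[a b] _ <-].
have H : *%R s @^-1` `]a, b]%classic = `](a / s)%R, (b / s)%R]%classic :> set R.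
  by apply/seteqP; split => x /=; rewrite !in_itv/= ltr_pdivrMr// ler_pdivlMr// mulrC.
transitivity (s%:E * leb `](a / s)%R, (b / s)%R]%classic); last by rewrite -H.
rewrite !lebesgue_measure_itv/= !lte_fin ltr_pM2r ?invr_gt0//.
case: ifPn => _; last by rewrite mule0.
by rewrite -!EFinB -EFinM -mulrBl mulrC divfK// gt_eqF.
Qed.

End lebesgue_change.

Section normal_moments.
Context {R : realType}.
Notation leb := (@lebesgue_measure R).

Lemma ge0_integral_normal_prob (s : R) (f : R -> \bar R) : measurable_fun setT f ->
  (forall x, 0 <= f x)%E ->
  (\int[normal_prob 0 s]_x f x = \int[leb]_x (f x * (normal_pdf 0 s x)%:E))%E.
Proof.
move=> mf f0; apply: ge0_integral_density => //.
- exact: measurable_normal_pdf.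
- exact: normal_pdf_ge0.
Qed.

Lemma normal_pdf_scale (s x : R) : 0 < s -> s * normal_pdf 0 s (s * x) = normal_pdf 0 1 x.
Proof.
move=> s0; rewrite !normal_pdfE ?oner_neq0 ?gt_eqF// /normal_fun /normal_peak.
rewrite !subr0 expr1n mul1r.
have -> : - (s * x) ^+ 2 / (s ^+ 2 *+ 2) = - x ^+ 2 / (1 *+ 2).
  by field; rewrite gt_eqF.
rewrite mulrA; congr (_ * _).
rewrite -mulrnAr sqrtrM ?sqr_ge0// sqrtr_sqr gtr0_norm// invfM mulrA divff ?mul1r//.
by rewrite gt_eqF.
Qed.

Lemma normal_pdfN (s x : R) : normal_pdf 0 s (- x) = normal_pdf 0 s x \/ s = 0.
Proof.
have [->|s0] := eqVneq s 0; [by right|left].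
by rewrite !normal_pdfE// /normal_fun !subr0 sqrrN.
Qed.

(** The second moment is finite because the integrand is dominated by a multiple of the density of
    variance 2: [x ^ 2 / 4 <= expR (x ^ 2 / 4)] trades the square for half of the Gaussian
    exponent. *)
Lemma sqr_normal_pdf_le (x : R) : x ^+ 2 * normal_pdf 0 1 x <=
  4 * (normal_peak 1 / normal_peak (Num.sqrt 2)) * normal_pdf 0 (Num.sqrt 2) x.
Proof.
have s2 : Num.sqrt 2 != 0 :> R by rewrite gt_eqF// sqrtr_gt0.
rewrite !normal_pdfE ?oner_neq0//.
have := normal_peak_gt0 (oner_neq0 R); set p1 := normal_peak 1 => p10.
have := normal_peak_gt0 s2; set p2 := normal_peak (Num.sqrt 2) => p20.
rewrite (_ : 4 * (p1 / p2) * (p2 * _) = p1 * (4 * normal_fun 0 (Num.sqrt 2) x)); last first.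
  by field; rewrite gt_eqF.
rewrite mulrCA ler_pM2l// /normal_fun !subr0 sqr_sqrtr// expr1n.
rewrite (_ : - x ^+ 2 / (1 *+ 2) = - (x ^+ 2 / 4) + - (x ^+ 2 / 4)); last by field.
rewrite (_ : - x ^+ 2 / (2 *+ 2) = - (x ^+ 2 / 4)); last by field.
rewrite expRD mulrA ler_wpM2r ?expR_ge0//.
rewrite expRN ler_pdivrMr ?expR_gt0//.
have := expR_ge1Dx (x ^+ 2 / 4); lra.
Qed.

(** The substitution [x = s y] extracts [s ^ 2] and leaves the second moment of the standard normal
    law. That moment is the constant [c]; it is shown to be finite and left unevaluated. *)
Lemma normal_second_moment : exists2 c : R, 0 <= c & forall s : R, 0 < s ->
  (\int[normal_prob 0 s]_x (x ^+ 2)%:E = (c * s ^+ 2)%:E)%E.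
Proof.
have m2 : measurable_fun setT (fun x : R => (x ^+ 2)%:E).
  by apply/measurable_EFinP; exact: measurable_funX.
pose I := (\int[leb]_x (x ^+ 2 * normal_pdf 0 1 x)%:E)%E.
have I0 : (0 <= I)%E.
  by apply: integral_ge0 => x _; rewrite lee_fin mulr_ge0 ?sqr_ge0 ?normal_pdf_ge0.
have Ifin : I \is a fin_num.
  rewrite ge0_fin_numE//.
  have k0 : 0 <= 4 * (normal_peak 1 / normal_peak (Num.sqrt 2)) :> R.
    by rewrite mulr_ge0// divr_ge0// normal_peak_ge0.
  apply: (@le_lt_trans _ _ (\int[leb]_x ((4 * (normal_peak 1 / normal_peak (Num.sqrt 2)))%:E * (normal_pdf 0 (Num.sqrt 2) x)%:E))%E).
    apply: ge0_le_lower_integral => x _.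
      by rewrite lee_fin mulr_ge0 ?sqr_ge0 ?normal_pdf_ge0.
    by rewrite -EFinM lee_fin sqr_normal_pdf_le.
  rewrite ge0_integralZl_EFin//; first by rewrite integral_normal_pdf mule1 ltry.
    by move=> x _; rewrite lee_fin normal_pdf_ge0.
  by apply/measurable_EFinP; exact: measurable_normal_pdf.
exists (fine I); first exact: fine_ge0.
move=> s s0; rewrite ge0_integral_normal_prob//; last first.
  by move=> x; rewrite lee_fin sqr_ge0.
rewrite (ge0_integral_lebesgueM s0)//; last 2 first.
- apply: emeasurable_funM => //; apply/measurable_EFinP; exact: measurable_normal_pdf.
- by move=> x; rewrite mule_ge0// lee_fin ?sqr_ge0 ?normal_pdf_ge0.
have mI : measurable_fun setT (fun x : R => (x ^+ 2 * normal_pdf 0 1 x)%:E).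
  apply/measurable_EFinP/measurable_funM; first exact: measurable_funX.
  exact: measurable_normal_pdf.
have s0' : s != 0 by rewrite gt_eqF.
transitivity (s%:E * \int[leb]_x (s%:E * (x ^+ 2 * normal_pdf 0 1 x)%:E))%E.
  congr (_ * _)%E; apply: eq_integral => x _.
  by rewrite -!EFinM -(normal_pdf_scale x s0) exprMn; congr EFin; ring.
rewrite ge0_integralZl_EFin ?ltW//.
  by rewrite -/I -(fineK Ifin) -!EFinM mulrA -expr2 mulrC.
by move=> x _; rewrite lee_fin mulr_ge0 ?sqr_ge0 ?normal_pdf_ge0.
Qed.

(** Vanishing of the mean in a form with nonnegative integrands only, to which the reflection
    [x -> - x] applies directly. *)
Lemma normal_mean (s : R) : 0 < s ->
  (\int[normal_prob 0 s]_x (Num.max x 0)%:E = \int[normal_prob 0 s]_x (Num.max (- x) 0)%:E)%E.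
Proof.
move=> s0.
have mm (f : R -> R) : measurable_fun setT f -> measurable_fun setT (fun x : R => (Num.max (f x) 0)%:E).
  by move=> mf; apply/measurable_EFinP; exact: measurable_maxr.
have m0 (f : R -> R) x : (0 <= (Num.max (f x) 0)%:E)%E by rewrite lee_fin le_max lexx orbT.
rewrite !ge0_integral_normal_prob; try by [move=> x; exact: (m0 id)|move=> x; exact: (m0 -%R)|exact: (mm id)|exact: mm].
rewrite ge0_integral_lebesgueN.
- apply: eq_integral => x _; congr (_ * _%:E)%E.
  by case: (normal_pdfN s x) => // s00; move: s0; rewrite s00 ltxx.
- apply: emeasurable_funM => //; first exact: (mm id).
  apply/measurable_EFinP; exact: measurable_normal_pdf.
- by move=> x; rewrite mule_ge0 ?(m0 id)// lee_fin normal_pdf_ge0.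
Qed.

End normal_moments.

(** * The Euclidean norm and continuous processes *)

Section frobenius_norm.
Context {R : realType} {m n : nat}.
Implicit Types A B C : 'M[R]_(m, n).

Lemma enorm_ge0 A : 0 <= enorm A.
Proof. exact: sqrtr_ge0. Qed.

Lemma sqr_enorm A : enorm A ^+ 2 = \sum_(i < m) \sum_(j < n) A i j ^+ 2.
Proof.
by rewrite sqr_sqrtr// sumr_ge0// => i _; rewrite sumr_ge0// => j _; exact: sqr_ge0.
Qed.

Lemma coord_le_enorm A i j : `|A i j| <= enorm A.
Proof.
rewrite -(ler_pXn2r (n := 2))// ?nnegrE ?enorm_ge0// sqr_enorm real_normK ?num_real//.
rewrite (bigD1 i)//= (bigD1 j)//= -addrA lerDl addr_ge0// sumr_ge0// => k _.
  exact: sqr_ge0.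
by rewrite sumr_ge0// => l _; exact: sqr_ge0.
Qed.

Lemma sqr_enormD A B : enorm (A + B) ^+ 2 <= 2 * (enorm A ^+ 2 + enorm B ^+ 2).
Proof.
rewrite !sqr_enorm -big_split/= mulr_sumr; apply: ler_sum => i _.
rewrite -big_split/= mulr_sumr; apply: ler_sum => j _.
by rewrite !mxE; have := sqr_ge0 (A i j - B i j); rewrite sqrrB sqrrD; lra.
Qed.

Lemma enormN A : enorm (- A) = enorm A.
Proof.
by congr Num.sqrt; apply: eq_bigr => i _; apply: eq_bigr => j _; rewrite mxE sqrrN.
Qed.

Lemma sqr_enormB A B : enorm (A - B) ^+ 2 <= 2 * (enorm A ^+ 2 + enorm B ^+ 2).
Proof. by rewrite -(enormN B); exact: sqr_enormD. Qed.

Lemma enorm_distC A B : enorm (A - B) = enorm (B - A).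
Proof. by rewrite -enormN opprB. Qed.

Lemma sqr_enormD3 A B C : enorm (A + B + C) ^+ 2 <=
  3 * (enorm A ^+ 2 + enorm B ^+ 2 + enorm C ^+ 2).
Proof.
rewrite !sqr_enorm -!big_split/= mulr_sumr; apply: ler_sum => i _.
rewrite -!big_split/= mulr_sumr; apply: ler_sum => j _.
rewrite !mxE; move: (A i j) (B i j) (C i j) => a b c.
have := sqr_ge0 (a - b); have := sqr_ge0 (b - c); have := sqr_ge0 (a - c).
by rewrite !sqrrB !sqrrD !mulrDl; lra.
Qed.

Lemma enorm0 : enorm (0 : 'M[R]_(m, n)) = 0.
Proof.
rewrite /enorm big1 ?sqrtr0// => i _; rewrite big1// => j _.
by rewrite mxE expr0n.
Qed.

Lemma continuous_enorm : continuous (@enorm R m n).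
Proof.
move=> A; apply: (@continuous_comp _ _ _ (fun A : 'M[R]_(m, n) => \sum_(i < m) \sum_(j < n) A i j ^+ 2) Num.sqrt); last exact: sqrt_continuous.
apply: (@cvg_big _ _ +%R 0 xpredT (@add_continuous _) _ _ _ _ _ (nbhs_filter A)) => i _.
apply: (@cvg_big _ _ +%R 0 xpredT (@add_continuous _) _ _ _ _ _ (nbhs_filter A)) => j _.
apply: (@continuous_comp _ _ _ (fun A : 'M[R]_(m, n) => A i j) (fun x : R => x ^+ 2)).
  exact: coord_continuous.
exact: exprn_continuous.
Qed.

Lemma measurable_enorm d (T : measurableType d) (D : set T) (f : T -> 'M[R]_(m, n)) :
  (forall i j, measurable_fun D (fun x => f x i j)) ->
  measurable_fun D (fun x => enorm (f x)).
Proof.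
move=> mf; apply: (measurableT_comp (f := @Num.sqrt R)).
  by apply: continuous_measurable_fun; exact: sqrt_continuous.
apply: measurable_sum => i; apply: measurable_sum => j; exact: measurable_funX.
Qed.

End frobenius_norm.

Section borel.
Context {R : realType}.

Lemma measurable_continuous (U : ptopologicalType) (f : U -> R) :
  continuous f -> measurable_fun setT (f : g_sigma_algebraType (@open U) -> R).
Proof.
move=> cf; apply: (measurability (@RGenOInfty.G R)); first exact: RGenOInfty.measurableE.
move=> _ [_ [r ->] <-]; rewrite setTI; apply: sub_sigma_algebra.
by apply: open_comp => [x _|]; [exact: cf|exact: interval_open].
Qed.

Lemma borel_measurable_comp (T : pointedType) (G : set (set T)) (D : set T)
    (U : ptopologicalType) (h : T -> U) (f : U -> R) (V : set R) :
  borel_measurable G D h -> continuous f -> measurable V ->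
  G (D `&` (f \o h) @^-1` V).
Proof.
move=> mh cf mV; apply: (mh (f @^-1` V)); rewrite -[X in _ X]setTI.
exact: (measurable_continuous cf).
Qed.

End borel.

(** * Time grids *)

Section time_grid.
Context {R : realType}.
Variables (T : R).
Hypothesis T0 : 0 < T.

Definition grid (n k : nat) : R := T * k%:R / n.+1%:R.

(** The projection onto [[0, T]]. Processes are controlled only on [[0, T]]; composition with [clip]
    makes them jointly measurable on all of [R * Omega], where Tonelli's theorem is applied. *)
Definition clip (s : R) : R := Num.min (Num.max s 0) T.

Lemma clip_itv s : 0 <= clip s <= T.
Proof. by rewrite /clip le_min ge_min lexx orbT le_max lexx orbT ltW. Qed.

Lemma clip_id s : 0 <= s <= T -> clip s = s.
Proof. by move=> /andP[s0 sT]; rewrite /clip max_l// min_l. Qed.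

Lemma measurable_clip : measurable_fun setT clip.
Proof. by apply: measurable_minr => //; exact: measurable_maxr. Qed.

Lemma grid_itv n k : (k <= n.+1)%N -> 0 <= grid n k <= T.
Proof.
move=> kn; rewrite /grid divr_ge0 ?mulr_ge0 ?(ltW T0)//= ler_pdivrMr// ler_wpM2l ?(ltW T0)//.
by rewrite ler_nat.
Qed.

Lemma le_grid n k l : (k <= l)%N -> grid n k <= grid n l.
Proof. by move=> kl; rewrite /grid ler_wpM2r// ler_wpM2l ?(ltW T0)// ler_nat. Qed.

Definition grid_index (n : nat) (u : R) : nat := Num.truncn (u * n.+1%:R / T).

Lemma grid_index_le n u : u <= T -> (grid_index n u <= n.+1)%N.
Proof.
move=> uT; rewrite truncn_le_nat ltr_pdivrMr// -[n.+2%:R]natr1 mulrDl mul1r.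
have : u * n.+1%:R <= T * n.+1%:R by rewrite ler_wpM2r.
by move: T0; lra.
Qed.

Lemma grid_index_dist n u : 0 <= u -> `|u - grid n (grid_index n u)| <= T / n.+1%:R.
Proof.
move=> u0; have /truncn_itv : 0 <= u * n.+1%:R / T by rewrite divr_ge0 ?mulr_ge0 ?(ltW T0).
rewrite -/(grid_index n u) -[(grid_index n u).+1%:R]natr1 ler_pdivlMr// ltr_pdivrMr// => /andP[a b].
have n0 : 0 < n.+1%:R :> R by [].
rewrite /grid ger0_norm.
  by rewrite lerBlDr -mulrDl ler_pdivlMr//; lra.
by rewrite subr_ge0 ler_pdivrMr// mulrC.
Qed.

Lemma cvg_grid (V : topologicalType) (f : R -> V) u : 0 <= u <= T ->
  {within `[0, T], continuous f} ->
  f (grid n (grid_index n u)) @[n --> \oo] --> f u.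
Proof.
move=> /andP[u0 uT] /subspace_continuousP/(_ u); rewrite /= in_itv/= u0 uT => /(_ isT).
apply: cvg_comp => A [/= e e0 eA].
have [N _ hN] := near_infty_natSinv_lt (PosNum (divr_gt0 e0 T0)).
exists N => // n /= Nn; apply: eA => /=.
  apply: le_lt_trans (grid_index_dist n u0) _.
  by have := hN n Nn; rewrite /= ltr_pdivlMr// mulrC.
by rewrite in_itv/= grid_itv// grid_index_le.
Qed.

(** By compactness the supremum is attained at some [c], and the value at the last grid point before
    [c] squeezes the maxima from below. Finite maxima thus give the measurability of suprema over
    [[0, T]] and carry Doob's inequality to them. The default value 0 of the maximum is harmless for
    nonnegative [f]. *)
Lemma cvg_max_grid (f : R -> R) : {within `[0, T], continuous f} ->
  (forall t, 0 <= t <= T -> 0 <= f t) ->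
  ((\big[Num.max/0]_(k < n.+2) f (grid n k))%:E @[n --> \oo] -->
     ereal_sup [set (f t)%:E | t in `[0%R, T]])%E.
Proof.
move=> cf f0; have [c cT fc] := EVT_max (ltW T0) cf.
have -> : ereal_sup [set (f t)%:E | t in `[0%R, T]] = (f c)%:E.
  apply/eqP; rewrite eq_le; apply/andP; split.
    by apply: ub_ereal_sup => _ [t /= tT <-]; rewrite lee_fin fc.
  by apply: ereal_sup_ubound; exists c.
apply: cvg_EFin; first by near=> n.
move: cT; rewrite in_itv/= => cT.
apply: (@squeeze_cvgr _ _ _ _ (fun n => f (grid n (grid_index n c))) (fun _ => f c)).
- near=> n; apply/andP; split.
    have hk : (grid_index n c < n.+2)%N by rewrite ltnS grid_index_le//; case/andP: cT.
    exact: (le_bigmax 0 (fun k : 'I_n.+2 => f (grid n k)) (Ordinal hk)).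
  apply: bigmax_le => [|k _]; first exact: f0.
  by apply: fc; rewrite in_itv/= grid_itv// -ltnS.
- exact: cvg_grid.
- exact: cvg_cst.
Unshelve. all: by end_near. Qed.

End time_grid.

Section continuous_process.
Context {R : realType} {disp : measure_display} {Omega : measurableType disp}.
Variables (T : R) (X : R -> Omega -> R).
Hypotheses (T0 : 0 < T) (cX : forall w, {within `[0, T], continuous (fun t => X t w)}).
Hypothesis mX : forall t, 0 <= t <= T -> measurable_fun setT (X t).

Lemma measurable_continuous_process :
  measurable_fun setT (fun z : R * Omega => X (clip T z.1) z.2).
Proof.
(* The process frozen at the last grid point before the current time. It is a finite sum with a
   single nonzero term, hence jointly measurable, and converges to the process by path
   continuity. *)
pose h n (z : R * Omega) := \sum_(k < n.+2)
  (if grid_index T n (clip T z.1) == k then 1 else 0) * X (grid T n k) z.2.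
have hE n z : h n z = X (grid T n (grid_index T n (clip T z.1))) z.2.
  have /andP[u0 uT] := clip_itv T0 z.1.
  have hk : (grid_index T n (clip T z.1) < n.+2)%N by rewrite ltnS grid_index_le.
  rewrite /h (bigD1 (Ordinal hk))//= eqxx mul1r big1 ?addr0// => i.
  by rewrite -val_eqE /= eq_sym => /negPf->; rewrite mul0r.
apply: (@measurable_fun_cvg _ _ _ _ h) => [n|z _]; last first.
  rewrite (_ : h ^~ z = fun n => X (grid T n (grid_index T n (clip T z.1))) z.2).
    exact: (cvg_grid T0 (clip_itv T0 z.1) (@cX z.2)).
  by apply/funext.
apply: measurable_sum => k; apply: measurable_funM; last first.
  by apply: (measurableT_comp (mX _)) => //; rewrite grid_itv// -ltnS.
apply: measurable_fun_ifT => //.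
have -> : (fun z : R * Omega => grid_index T n (clip T z.1) == k) =
   (fun z => (k%:R <= clip T z.1 * n.+1%:R / T) && (clip T z.1 * n.+1%:R / T < k.+1%:R)).
  apply/funext => z; have /andP[u0 uT] := clip_itv T0 z.1.
  by rewrite truncn_eq// divr_ge0 ?mulr_ge0 ?(ltW T0).
have mc : measurable_fun setT (fun z : R * Omega => clip T z.1 * n.+1%:R / T).
  apply: measurable_funM => //; apply: measurable_funM => //.
  by apply: measurableT_comp => //; exact: measurable_clip.
by apply: measurable_and; [exact: measurable_fun_ler|exact: measurable_fun_ltr].
Qed.

End continuous_process.

Section expectation_tools.
Context {d} {T : measurableType d} {R : realType} (P : probability T R).

Lemma integrable_indicR (A : set T) : measurable A ->
  P.-integrable setT (EFin \o (\1_A : T -> R)).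
Proof. by move=> mA; exact: integrable_indic. Qed.

Lemma integrable_cstR (c : R) : P.-integrable setT (EFin \o (fun=> c)).
Proof. exact: (finite_measure_integrable_cst P c measurableT). Qed.

Lemma Rintegral_indicR (A : set T) : measurable A ->
  Rintegral P setT (\1_A : T -> R) = fine (P A).
Proof. by move=> mA; rewrite /Rintegral integral_indic// setIT. Qed.

Lemma Rintegral_cstR (c : R) : Rintegral P setT (fun=> c) = c.
Proof.
rewrite Rintegral_cst// -[RHS]mulr1; congr (_ * _).
exact: (congr1 fine (probability_setT P)).
Qed.

Lemma square_integrable_integrable (f : T -> R) : square_integrable P f ->
  P.-integrable setT (EFin \o f).
Proof.
move=> fi; have : square_integrable P (fun=> 1 : R).
  by apply: (@le_square_integrable _ _ _ _ _ (fun=> 1)) => //; exact: integrable_cstR.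
by move/(square_integrableM fi); apply: eq_integrable => // x _; rewrite /= mulr1.
Qed.

Lemma bounded_square_integrable (f : T -> R) (K : R) : measurable_fun setT f ->
  (forall x, `|f x| <= K) -> square_integrable P f.
Proof.
move=> mf fK; apply: (@le_square_integrable _ _ _ _ _ (fun=> K ^+ 2)) => //.
  by move=> x; rewrite -real_normK ?num_real// ler_pXn2r ?nnegrE// (le_trans _ (fK x)).
exact: integrable_cstR.
Qed.

Lemma bounded_integrableM (f g : T -> R) (K : R) : measurable_fun setT f ->
  (forall x, `|f x| <= K) -> P.-integrable setT (EFin \o g) ->
  P.-integrable setT (EFin \o (fun x => f x * g x)).
Proof.
move=> mf fK gi; have mg : measurable_fun setT g by move/measurable_int/measurable_EFinP : gi.
apply: (@le_integrableR _ _ _ _ _ _ (fun x => K * `|g x|)) => //.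
- exact: measurable_funM.
- by move=> x _; rewrite normrM ler_wpM2r.
- have := integrableZl measurableT K (integrable_norm gi); exact: eq_integrable.
Qed.

End expectation_tools.

(** * Independence and products of expectations *)

Section independence.
Context {d} {T : measurableType d} {R : realType} (P : probability T R).
Variables (G : set (set T)).
Hypotheses (sG : sigma_algebra setT G) (GM : G `<=` @measurable d T).
Context {d'} {U : measurableType d'} (Y : T -> U).
Hypotheses (mY : measurable_fun setT Y).
Hypothesis indGY : forall A V, G A -> measurable V ->
  P (A `&` Y @^-1` V) = (P A * P (Y @^-1` V))%E.
Local Notation E := (Rintegral P setT).

Let Rintegral_indicM (phi : U -> R) (A : set T) : G A -> measurable_fun setT phi ->
  P.-integrable setT (EFin \o (phi \o Y)) ->
  E (fun x => \1_A x * phi (Y x)) = fine (P A) * E (phi \o Y).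
Proof.
move=> GA mphi iphi; have mA := GM GA.
pose G' := preimage_set_system setT Y (@measurable _ U).
have sG' : sigma_algebra setT G'.
  by apply: sigma_algebra_preimage; exact: sigma_algebra_measurable.
have G'M : G' `<=` @measurable d T by move=> _ [V mV <-]; exact: mY.
pose Z x : R := \1_A x - fine (P A).
have mZ : measurable_fun setT Z by apply: measurable_funB => //; exact: measurable_indic.
have iZ : P.-integrable setT (EFin \o Z).
  have := integrableB measurableT (integrable_indicR P mA) (integrable_cstR P (fine (P A))).
  exact: eq_integrable.
have Zb x : `|Z x| <= 1 + `|fine (P A)|.
  rewrite (le_trans (ler_normB _ _))// lerD2r indicE; case: (_ \in _); rewrite ?normr1 ?normr0//.
have iAphi : P.-integrable setT (EFin \o (fun x => \1_A x * phi (Y x))).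
  apply: (@bounded_integrableM _ _ _ _ _ _ 1) => // x.
  by rewrite indicE; case: (_ \in _); rewrite ?normr1 ?normr0.
have icphi : P.-integrable setT (EFin \o (fun x => fine (P A) * phi (Y x))).
  have := integrableZl measurableT (fine (P A)) iphi; exact: eq_integrable.
have := @Rintegral_mul_eq0 _ _ _ P G' sG' G'M (phi \o Y) Z.
have -> : (fun x => (phi \o Y) x * Z x) =
    (fun x => \1_A x * phi (Y x)) \- (fun x => fine (P A) * phi (Y x)).
  by apply/funext => x /=; rewrite /Z mulrBr mulrC [phi _ * fine _]mulrC.
move=> H; apply/eqP; rewrite -subr_eq0 -RintegralZl// -RintegralB//; apply/eqP.
apply: H => //.
- apply: measurableT_comp => //; exact: preimage_set_system_measurable_fun.
- by have := integrableB measurableT iAphi icphi; exact: eq_integrable.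
- move=> _ [V mV <-]; rewrite setTI.
  have mYV : measurable (Y @^-1` V) by rewrite -[X in measurable X]setTI; exact: mY.
  rewrite (_ : (fun x => _) = (\1_(A `&` Y @^-1` V) : T -> R) \- (fun x => fine (P A) * \1_(Y @^-1` V) x)); last first.
    apply/funext => x /=; rewrite /Z mulrBr [\1_(Y @^-1` V) x * fine _]mulrC indicI/=.
    by rewrite mulrC.
  rewrite RintegralB//; last 2 first.
  + by apply: integrable_indicR; exact: measurableI.
  + have := integrableZl measurableT (fine (P A)) (integrable_indicR P mYV); exact: eq_integrable.
  rewrite RintegralZl//; last exact: integrable_indicR.
  rewrite !Rintegral_indicR//; last exact: measurableI.
  by rewrite indGY// fineM ?fin_num_measure// subrr.
Qed.

(** [Rintegral_mul_eq0] is used twice. Applied to the sigma-algebra generated by [Y] and to the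
    centred indicator of [A], it gives [Rintegral_indicM]; applied to [G] and to the centred
    variable [phi (Y x) - m], it passes from indicators of sets in [G] to [f]. *)
Lemma Rintegral_indepM (f : T -> R) (phi : U -> R) :
  measurable_fun setT (f : g_sigma_algebraType G -> R) -> measurable_fun setT phi ->
  P.-integrable setT (EFin \o f) -> P.-integrable setT (EFin \o (phi \o Y)) ->
  P.-integrable setT (EFin \o (fun x => f x * phi (Y x))) ->
  E (fun x => f x * phi (Y x)) = E f * E (phi \o Y).
Proof.
move=> mf mphi fi phii fphii; set m := E (phi \o Y).
have cfi : P.-integrable setT (EFin \o (fun x => m * f x)).
  have := integrableZl measurableT m fi; exact: eq_integrable.
have ci := integrable_cstR P m.
have H := @Rintegral_mul_eq0 _ _ _ P G sG GM f (fun x => phi (Y x) - m) mf.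
apply/eqP; rewrite -subr_eq0 mulrC -RintegralZl// -RintegralB//; apply/eqP.
rewrite -[RHS]H; last first.
- move=> A GA; have mA := GM GA.
  have iAphi : P.-integrable setT (EFin \o (fun x => \1_A x * phi (Y x))).
    apply: (@bounded_integrableM _ _ _ _ _ _ 1) => // x.
    by rewrite indicE; case: (_ \in _); rewrite ?normr1 ?normr0.
  rewrite (_ : (fun x => _) = (fun x => \1_A x * phi (Y x)) \- (fun x => m * \1_A x)); last first.
    by apply/funext => x /=; rewrite mulrBr [m * _]mulrC.
  rewrite RintegralB//; last first.
    have := integrableZl measurableT m (integrable_indicR P mA); exact: eq_integrable.
  rewrite RintegralZl//; last exact: integrable_indicR.
  by rewrite Rintegral_indicM// Rintegral_indicR// mulrC subrr.
- have := integrableB measurableT fphii cfi; apply: eq_integrable => // x _.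
  by rewrite /= -EFinB mulrBr [m * _]mulrC.
- by have := integrableB measurableT phii ci; exact: eq_integrable.
by congr E; apply/funext => x /=; rewrite mulrBr [m * _]mulrC.
Qed.

End independence.

(** * Brownian increments and the Ito isometry *)

Section brownian.
Context {R : realType} {disp : measure_display} {Omega : measurableType disp}.
Variables (P : probability Omega R) (F : R -> set (set Omega)).
Context {d : nat}.
Variable B : R -> Omega -> 'cV[R]_d.
Hypotheses (hF : usual_filtration P F) (hB : brownian_motion P F B).
Local Notation E := (Rintegral P setT).
Local Notation L2 := (square_integrable P).
Local Notation F_measurable s f :=
  (measurable_fun setT ((f : Omega -> R) : g_sigma_algebraType (F s) -> R)).

Lemma filtration_sigma_algebra t : 0 <= t -> sigma_algebra setT (F t).
Proof. by case: hF => H _ _ _ _; exact: H. Qed.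

Lemma filtration_measurable t : 0 <= t -> F t `<=` @measurable _ Omega.
Proof. by case: hF => _ H _ _ _; exact: H. Qed.

Lemma filtration_le s t : 0 <= s -> s <= t -> F s `<=` F t.
Proof. by case: hF => _ _ H _ _; exact: H. Qed.

Lemma F_measurable_le s t (f : Omega -> R) : 0 <= s -> s <= t ->
  F_measurable s f -> F_measurable t f.
Proof.
move=> s0 st mf _ Y mY; apply: sub_sigma_algebra; apply: (filtration_le s0 st).
apply/(g_sigma_measurable (filtration_sigma_algebra s0)).
exact: mf.
Qed.

Lemma F_measurable_measurable s (f : Omega -> R) : 0 <= s ->
  F_measurable s f -> measurable_fun setT f.
Proof.
by move=> s0; apply: sub_measurable_fun; [exact: filtration_sigma_algebra|exact: filtration_measurable].
Qed.

Lemma F_measurable_indic s A : F s A -> F_measurable s (\1_A).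
Proof. by move=> FA; apply: measurable_indic; apply: sub_sigma_algebra. Qed.

Lemma F_measurable_coord (m n : nat) t (Y : Omega -> 'M[R]_(m, n)) i j :
  borel_measurable (F t) setT Y -> F_measurable t (fun w => Y w i j).
Proof.
move=> mY _ V mV; apply: sub_sigma_algebra.
apply: (borel_measurable_comp (f := fun A : 'M[R]_(m, n) => A i j) mY) => //.
exact: coord_continuous.
Qed.

Definition incr (s t : R) (i : 'I_d) (w : Omega) : R := B t w i 0 - B s w i 0.

Lemma F_measurable_incr s t u i : 0 <= s -> s <= u -> 0 <= t -> t <= u ->
  F_measurable u (incr s t i).
Proof.
move=> s0 su t0 tu; case: hB => aB _ _ _ _.
by apply: measurable_funB; [apply: (F_measurable_le t0 tu)|apply: (F_measurable_le s0 su)];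
  apply: F_measurable_coord => //; exact: aB.
Qed.

Lemma measurable_incr s t i : 0 <= s -> 0 <= t -> measurable_fun setT (incr s t i).
Proof.
move=> s0 t0; have u0 : 0 <= Num.max s t by rewrite le_max s0.
apply: (F_measurable_measurable u0); apply: F_measurable_incr => //.
  by rewrite le_max lexx.
by rewrite le_max lexx orbT.
Qed.

Lemma incr_law2 s t i j (V W : set R) : 0 <= s -> s < t -> i != j ->
  measurable V -> measurable W ->
  P (incr s t i @^-1` V `&` incr s t j @^-1` W) =
  (normal_prob 0 (Num.sqrt (t - s)) V * normal_prob 0 (Num.sqrt (t - s)) W)%E.
Proof.
move=> s0 st ij mV mW; case: hB => _ _ _ _ law.
(* The law of the increment is given on boxes; the coordinates other than [i] and [j] are left
   unconstrained and contribute factors 1. *)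
pose K k : set (measurableTypeR R) := if k == i then V else if k == j then W else setT.
have mK k : measurable (K k) by rewrite /K; case: ifP => // _; case: ifP.
have := law s t s0 st K mK.
have -> : [set w | forall k, K k ((B t w - B s w) k 0)] =
    incr s t i @^-1` V `&` incr s t j @^-1` W.
  apply/seteqP; split => w /=.
    move=> H; split.
      by have := H i; rewrite /K eqxx !mxE.
    by have := H j; rewrite /K eq_sym (negPf ij) eqxx !mxE.
  move=> [Vi Wj] k; rewrite /K !mxE; case: eqP => [->//|_]; by case: eqP => [->|].
move=> ->; rewrite (bigD1 i)//= (bigD1 j) 1?eq_sym//=.
rewrite /K eqxx (eq_sym j i) (negPf ij) eqxx big1 ?mule1// => k /andP[/negPf-> /negPf->].
by rewrite probability_setT.
Qed.

Lemma incr_law s t i (V : set R) : 0 <= s -> s < t -> measurable V ->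
  P (incr s t i @^-1` V) = normal_prob 0 (Num.sqrt (t - s)) V.
Proof.
move=> s0 st mV; case: hB => _ _ _ _ law.
pose K k : set (measurableTypeR R) := if k == i then V else setT.
have mK k : measurable (K k) by rewrite /K; case: ifP.
have := law s t s0 st K mK.
have -> : [set w | forall k, K k ((B t w - B s w) k 0)] = incr s t i @^-1` V.
  apply/seteqP; split => w /=; first by move=> /(_ i); rewrite /K eqxx !mxE.
  by move=> Vi k; rewrite /K !mxE; case: eqP => [->//|_].
move=> ->; rewrite (bigD1 i)//= /K eqxx big1 ?mule1// => k /negPf->.
by rewrite probability_setT.
Qed.

Lemma ge0_integral_incr s t i (f : R -> \bar R) : 0 <= s -> s < t ->
  measurable_fun setT f -> (forall x, 0 <= f x)%E ->
  (\int[P]_w f (incr s t i w) = \int[normal_prob 0 (Num.sqrt (t - s))]_x f x)%E.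
Proof.
move=> s0 st mf f0; have t0 : 0 <= t by rewrite (le_trans s0)// ltW.
have mi : measurable_fun setT (incr s t i) by exact: measurable_incr.
have := @ge0_integral_pushforward _ _ Omega (measurableTypeR R) R (incr s t i) mi P setT f measurableT mf (fun x _ => f0 x).
rewrite preimage_setT => <-; apply: eq_measure_integral => A mA _.
exact: incr_law.
Qed.

(* The value of the constant, one, plays no role. *)
Lemma incr_moments : exists2 c : R, 0 <= c & forall s t i, 0 <= s -> s < t ->
  [/\ L2 (incr s t i), E (incr s t i) = 0 &
      E (fun w => incr s t i w ^+ 2) = c * (t - s)].
Proof.
have [c c0 hc] := normal_second_moment (R := R).
exists c => // s t i s0 st; have t0 : 0 <= t by rewrite (le_trans s0)// ltW.
have ts : 0 < t - s by rewrite subr_gt0.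
have sts : 0 < Num.sqrt (t - s) by rewrite sqrtr_gt0.
have sq : (\int[P]_w (incr s t i w ^+ 2)%:E = (c * (t - s))%:E)%E.
  rewrite (@ge0_integral_incr s t i (fun x => (x ^+ 2)%:E))//.
  - by rewrite hc// sqr_sqrtr// ltW.
  - by apply/measurable_EFinP; exact: measurable_funX.
  - by move=> x; rewrite lee_fin sqr_ge0.
have mi := measurable_incr i s0 t0.
have L2i : L2 (incr s t i) by split => //; rewrite sq ltry.
have ii := square_integrable_integrable L2i.
split=> //; last by rewrite /Rintegral sq.
have mp : measurable_fun setT (fun x : R => Num.max x 0) by exact: measurable_maxr.
have mn : measurable_fun setT (fun x : R => Num.max (- x) 0).
  by apply: measurable_maxr => //; exact: measurable_funN.
have ip (f : R -> R) : measurable_fun setT f -> (forall x, `|f x| <= `|x|) ->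
    P.-integrable setT (EFin \o (f \o incr s t i)).
  move=> mf fx; apply: (@le_integrableR _ _ _ _ _ _ (fun w => `|incr s t i w|)) => //.
  - exact: measurableT_comp.
  - by move=> w _; exact: fx.
  - exact: integrable_norm.
have pb (x : R) : `|Num.max x 0| <= `|x|.
  by rewrite ger0_norm ?le_max ?lexx ?orbT// ge_max normr_ge0 ler_norm.
rewrite (_ : incr s t i = (fun w => Num.max (incr s t i w) 0) \- (fun w => Num.max (- incr s t i w) 0)); last first.
  by apply/funext => w /=; rewrite !maxElt; case: ltP => ?; case: ltP => ?; lra.
rewrite RintegralB//; last 2 first.
- by apply: (ip (fun x => Num.max x 0)).
- by apply: (ip (fun x => Num.max (- x) 0)) => // x; rewrite -[leRHS]normrN.
rewrite /Rintegral (@ge0_integral_incr s t i (fun x => (Num.max x 0)%:E))//; last 2 first.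
- exact/measurable_EFinP.
- by move=> x; rewrite lee_fin le_max lexx orbT.
rewrite (@ge0_integral_incr s t i (fun x => (Num.max (- x) 0)%:E))//; last 2 first.
- exact/measurable_EFinP.
- by move=> x; rewrite lee_fin le_max lexx orbT.
by rewrite normal_mean// subrr.
Qed.

(** A function of two coordinates at once serves both the first moments, with [phi] a projection,
    and the products of two coordinates. *)
Let expect_indep_incr s t i j (f : Omega -> R) (phi : R * R -> R) : 0 <= s -> s < t ->
  F_measurable s f -> measurable_fun setT phi ->
  P.-integrable setT (EFin \o f) ->
  P.-integrable setT (EFin \o (fun w => phi (incr s t i w, incr s t j w))) ->
  P.-integrable setT (EFin \o (fun w => f w * phi (incr s t i w, incr s t j w))) ->
  E (fun w => f w * phi (incr s t i w, incr s t j w)) =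
  E f * E (fun w => phi (incr s t i w, incr s t j w)).
Proof.
move=> s0 st mf mphi fi phii fphii; have t0 : 0 <= t by rewrite (le_trans s0)// ltW.
apply: (@Rintegral_indepM _ _ _ P (F s) (filtration_sigma_algebra s0)
  (filtration_measurable s0) _ _ (fun w => (incr s t i w, incr s t j w))) => //.
  by apply: measurable_fun_pair; exact: measurable_incr.
move=> A V FA mV; case: hB => _ _ _ ind _.
have mco k : measurable_fun setT ((fun v : 'cV[R]_d => v k 0) : borelV R d -> R).
  by apply: measurable_continuous; exact: coord_continuous.
have := ind s t s0 st A ((fun v : 'cV[R]_d => (v i 0, v j 0)) @^-1` V) FA.
rewrite (_ : [set w | ((fun v : 'cV[R]_d => (v i 0, v j 0)) @^-1` V) (B t w - B s w)] =
  (fun w => (incr s t i w, incr s t j w)) @^-1` V); last first.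
  by apply/seteqP; split => w /=; rewrite !mxE.
apply; rewrite -[X in measurable X]setTI.
exact: (measurable_fun_pair (mco i) (mco j)).
Qed.

Lemma expect_mul_incr s t i (f : Omega -> R) : 0 <= s -> s <= t ->
  F_measurable s f -> L2 f -> E (fun w => f w * incr s t i w) = 0.
Proof.
move=> s0; rewrite le_eqVlt => /predU1P[<- _ _|st mf fi].
  rewrite (_ : (fun w => _) = fun=> 0) ?Rintegral_cstR//.
  by apply/funext => w; rewrite /incr subrr mulr0.
have [c c0 /(_ s t i s0 st)[ii i0 _]] := incr_moments.
have := @expect_indep_incr s t i i f fst s0 st mf measurable_fst.
rewrite /= => ->.
- by rewrite -[X in _ * X]/(E (incr s t i)) i0 mulr0.
- exact: square_integrable_integrable.
- exact: square_integrable_integrable.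
- exact: square_integrableM.
Qed.

Lemma square_integrable_incr s t i : 0 <= s -> 0 <= t -> L2 (incr s t i).
Proof.
move=> s0 t0; have [c c0 H] := incr_moments.
have [st|ts|<-] := ltgtP s t.
- by have [] := H s t i s0 st.
- have [] := H t s i t0 ts => /(square_integrableZ (-1)) + _ _.
  by under eq_fun do rewrite mulN1r opprB.
- by rewrite /incr; under eq_fun do rewrite subrr; exact: square_integrable0.
Qed.

(** Distinct coordinates of one increment are independent and centred; [Rintegral_indepM] is applied
    to the sigma-algebra generated by coordinate [i]. *)
Lemma expect_incr_incr s t i j : 0 <= s -> s < t -> i != j ->
  E (fun w => incr s t i w * incr s t j w) = 0.
Proof.
move=> s0 st ij; have t0 : 0 <= t by rewrite (le_trans s0)// ltW.
have mi := measurable_incr i s0 t0.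
pose G := preimage_set_system setT (incr s t i) (@measurable _ R).
have sG : sigma_algebra setT G.
  by apply: sigma_algebra_preimage; exact: sigma_algebra_measurable.
have GM : G `<=` @measurable _ Omega by move=> _ [V mV <-]; exact: mi.
have [c c0 H] := incr_moments.
have [Li i0 _] := H s t i s0 st; have [Lj j0 _] := H s t j s0 st.
have := @Rintegral_indepM _ _ _ P G sG GM _ _ (incr s t j) (measurable_incr j s0 t0) _ (incr s t i) id.
rewrite i0 mul0r; apply.
- move=> _ W [V mV <-] mW; rewrite setTI incr_law2// incr_law//.
  by rewrite (@incr_law s t j W).
- exact: preimage_set_system_measurable_fun.
- exact: measurable_id.
- exact: square_integrable_integrable.
- exact: square_integrable_integrable.
- exact: square_integrableM.
Qed.

Lemma expect_mul_incr_incr : exists2 c : R, 0 <= c & forall s t i j (f : Omega -> R) (K : R),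
  0 <= s -> s <= t -> F_measurable s f -> (forall w, `|f w| <= K) ->
  E (fun w => f w * (incr s t i w * incr s t j w)) = (i == j)%:R * c * (t - s) * E f.
Proof.
have [c c0 H] := incr_moments; exists c => // s t i j f K s0.
rewrite le_eqVlt => /predU1P[<- _ _|st mf fK].
  rewrite subrr mulr0 mul0r (_ : (fun w => _) = fun=> 0) ?Rintegral_cstR//.
  by apply/funext => w; rewrite /incr !subrr !mulr0.
have t0 : 0 <= t by rewrite (le_trans s0)// ltW.
have [Li i0 isq] := H s t i s0 st; have [Lj j0 _] := H s t j s0 st.
have mfT := F_measurable_measurable s0 mf.
have := @expect_indep_incr s t i j f (fun z => z.1 * z.2) s0 st mf.
rewrite /= => ->.
- case: eqP => [<-|/eqP ij]; last by rewrite expect_incr_incr// !mul0r mulr0.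
  by rewrite mul1r mulrC -isq; congr (E _ * _); apply/funext => w; rewrite expr2.
- by apply: measurable_funM.
- by apply: square_integrable_integrable; exact: (bounded_square_integrable P mfT fK).
- exact: square_integrableM.
- by apply: (@bounded_integrableM _ _ _ _ _ _ K) => //; exact: square_integrableM.
Qed.

End brownian.

Section ito_isometry.
Context {R : realType} {disp : measure_display} {Omega : measurableType disp}.
Variables (P : probability Omega R) (F : R -> set (set Omega)).
Context {d : nat}.
Variable B : R -> Omega -> 'cV[R]_d.
Hypotheses (hF : usual_filtration P F) (hB : brownian_motion P F B).
Local Notation E := (Rintegral P setT).
Local Notation L2 := (square_integrable P).
Local Notation leb := (@lebesgue_measure R).
Local Notation F_measurable s f :=
  (measurable_fun setT ((f : Omega -> R) : g_sigma_algebraType (F s) -> R)).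
Local Notation dB := (incr B).

(* The length of ]a, b] `&` ]a', b']. *)
Definition overlap (a b a' b' : R) : R := Num.max 0 (Num.min b b' - Num.max a a').

Lemma overlapC a b a' b' : overlap a b a' b' = overlap a' b' a b.
Proof. by rewrite /overlap minC [Num.max a _]maxC. Qed.

Lemma incrD s t u i w : dB s u i w = dB s t i w + dB t u i w.
Proof. by rewrite /incr; ring. Qed.

Let expect_pair_ordered : exists2 c : R, 0 <= c & forall a b a' b' j j' f K,
  0 <= a -> a <= a' -> a < b -> a' < b' -> F_measurable a' f -> (forall w, `|f w| <= K) ->
  E (fun w => f w * (dB a b j w * dB a' b' j' w)) =
  (j == j')%:R * c * overlap a b a' b' * E f.
Proof.
have [c c0 H] := expect_mul_incr_incr hF hB; exists c => // a b a' b' j j' f K a0 aa' ab a'b' mf fK.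
have a'0 : 0 <= a' by rewrite (le_trans a0).
have b0 : 0 <= b by rewrite (le_trans a0)// ltW.
have b'0 : 0 <= b' by rewrite (le_trans a'0)// ltW.
have mfT := F_measurable_measurable hF a'0 mf.
have L2i s t i : 0 <= s -> 0 <= t -> L2 (dB s t i) by move=> *; exact: (square_integrable_incr hF hB).
have L2f g : L2 g -> L2 (fun w => f w * g w) by exact: (@bounded_square_integrableM _ _ _ _ _ _ K).
rewrite /overlap (max_r aa').
have [ba'|a'b] := leP b a'.
  rewrite max_l; last by rewrite subr_le0 ge_min ba'.
  rewrite mulr0 mul0r (_ : (fun w => _) = (fun w => (f w * dB a b j w) * dB a' b' j' w)).
    apply: (expect_mul_incr hF hB) => //; first exact: ltW.
      by apply: measurable_funM => //; exact: (F_measurable_incr hF hB).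
    exact/L2f/L2i.
  by apply/funext => w; rewrite mulrA.
(* Both increments are cut at [a'] and at [m]. Only the product over the common interval from [a']
   to [m] survives: in the other products the later increment is centred given the past, and of the
   two pieces after [m] one is zero. *)
set m := Num.min b b'.
have a'm : a' < m by rewrite lt_min a'b.
have mb : m <= b by rewrite ge_min lexx.
have mb' : m <= b' by rewrite ge_min lexx orbT.
have m0 : 0 <= m by rewrite (le_trans a'0)// ltW.
have meq w : dB m b j w * dB m b' j' w = 0.
  rewrite /incr /m; case: (leP b b') => _; first by rewrite subrr mul0r.
  by rewrite subrr mulr0.
rewrite max_r ?subr_ge0 ?ltW//.
rewrite (_ : (fun w => _) = (fun w => (f w * dB a a' j w) * dB a' b' j' w) \+
   ((fun w => f w * (dB a' m j w * dB a' m j' w)) \+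
   ((fun w => (f w * dB a' m j w) * dB m b' j' w) \+
    (fun w => (f w * dB a' m j' w) * dB m b j w)))); last first.
  apply/funext => w /=; have := meq w.
  rewrite (incrD a a' b) (incrD a' m b) (incrD a' m b').
  move: (dB a a' j w) (dB a' m j w) (dB m b j w) (dB a' m j' w) (dB m b' j' w).
  move=> x1 x2 x3 x4 x5 e.
  transitivity (f w * (x1 * (x4 + x5)) + f w * (x2 * x4) + f w * (x2 * x5) + f w * (x4 * x3) + f w * (x3 * x5)); first by ring.
  by rewrite e mulr0; ring.
have i1 : P.-integrable setT (EFin \o (fun w => (f w * dB a a' j w) * dB a' b' j' w)).
  by apply: square_integrableM; [exact/L2f/L2i|exact: L2i].
have i2 : P.-integrable setT (EFin \o (fun w => f w * (dB a' m j w * dB a' m j' w))).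
  by apply: (@bounded_integrableM _ _ _ _ _ _ K) => //; apply: square_integrableM; exact: L2i.
have i3 : P.-integrable setT (EFin \o (fun w => (f w * dB a' m j w) * dB m b' j' w)).
  by apply: square_integrableM; [exact/L2f/L2i|exact: L2i].
have i4 : P.-integrable setT (EFin \o (fun w => (f w * dB a' m j' w) * dB m b j w)).
  by apply: square_integrableM; [exact/L2f/L2i|exact: L2i].
have i34 := integrableD measurableT i3 i4.
have i234 := integrableD measurableT i2 i34.
rewrite (RintegralD measurableT i1 i234) (RintegralD measurableT i2 i34) (RintegralD measurableT i3 i4).
rewrite (H a' m j j' f K)//; last exact: ltW.
have a'm' := ltW a'm.
have mfm : F_measurable m f by exact: (F_measurable_le hF a'0).
rewrite !(expect_mul_incr hF hB)//; first by rewrite !addr0 add0r.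
- by apply: measurable_funM => //; exact: (F_measurable_incr hF hB).
- exact/L2f/L2i.
- by apply: measurable_funM => //; exact: (F_measurable_incr hF hB).
- exact/L2f/L2i.
- exact: ltW.
- by apply: measurable_funM => //; exact: (F_measurable_incr hF hB).
- exact/L2f/L2i.
Qed.

(** Measurability of a coefficient with respect to the left end is asked only for nondegenerate
    intervals. Cutting a simple process at time [t] moves the later intervals to [t], where their
    coefficients need not be known yet, but where the increments vanish. *)
Lemma expect_pair : exists2 c : R, 0 <= c & forall a b a' b' j j' f f' K,
  0 <= a -> a <= b -> 0 <= a' -> a' <= b' ->
  measurable_fun setT f -> measurable_fun setT f' ->
  (a < b -> F_measurable a f) -> (a' < b' -> F_measurable a' f') ->
  (forall w, `|f w| <= K) -> (forall w, `|f' w| <= K) ->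
  E (fun w => (f w * dB a b j w) * (f' w * dB a' b' j' w)) =
  (j == j')%:R * c * overlap a b a' b' * E (fun w => f w * f' w).
Proof.
have [c c0 H] := expect_pair_ordered; exists c => // a b a' b' j j' f f' K a0 ab a'0 a'b' mfT mfT' mf mf' fK fK'.
have ff'K w : `|f w * f' w| <= K * K by rewrite normrM ler_pM.
have [ab'|eab] := ltP a b; last first.
  have {}eab : a = b by apply/eqP; rewrite eq_le ab.
  rewrite /overlap max_l; last first.
    by rewrite subr_le0 eab (@le_trans _ _ b)// ?ge_min ?le_max lexx.
  rewrite mulr0 mul0r (_ : (fun w => _) = fun=> 0) ?Rintegral_cstR//.
  by apply/funext => w; rewrite eab /incr subrr mulr0 mul0r.
have [ab''|eab] := ltP a' b'; last first.
  have {}eab : a' = b' by apply/eqP; rewrite eq_le a'b'.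
  rewrite /overlap max_l; last first.
    by rewrite subr_le0 eab (@le_trans _ _ b')// ?ge_min ?le_max lexx orbT.
  rewrite mulr0 mul0r (_ : (fun w => _) = fun=> 0) ?Rintegral_cstR//.
  by apply/funext => w; rewrite eab /incr subrr !mulr0.
have {}mf := mf ab'; have {}mf' := mf' ab''.
have [aa'|/ltW a'a] := leP a a'.
  rewrite -(H _ _ _ _ j j' _ (K * K))//.
    by congr E; apply/funext => w; rewrite mulrACA.
  by apply: measurable_funM => //; exact: (F_measurable_le hF a0).
rewrite overlapC eq_sym -(H _ _ _ _ j' j _ (K * K))//.
  by congr E; apply/funext => w; rewrite mulrACA [dB a' b' _ _ * _]mulrC.
by apply: measurable_funM => //; exact: (F_measurable_le hF a'0).
Qed.

Definition itv_ind (a b s : R) : R := (a < s <= b)%R%:R.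

Lemma itv_indE a b : itv_ind a b = \1_(`]a, b]%classic).
Proof.
apply/funext => s; rewrite /itv_ind indicE; congr (_%:R).
by rewrite mem_setE in_itv.
Qed.

Lemma measurable_itv_ind a b : measurable_fun setT (itv_ind a b).
Proof. by rewrite itv_indE; exact: measurable_indic. Qed.

Lemma Rintegral_itv_ind a b a' b' :
  leb.-integrable setT (EFin \o (fun s => itv_ind a b s * itv_ind a' b' s)) /\
  Rintegral leb setT (fun s => itv_ind a b s * itv_ind a' b' s) = overlap a b a' b'.
Proof.
have -> : (fun s => itv_ind a b s * itv_ind a' b' s) = itv_ind (Num.max a a') (Num.min b b').
  apply/funext => s; rewrite /itv_ind -natrM mulnb; congr (_%:R).
  by rewrite gt_max le_min; case: (a < s); case: (a' < s); case: (s <= b).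
rewrite itv_indE; set I := `]_, _]%classic.
have IE : (\int[leb]_x (\1_I x)%:E = (overlap a b a' b')%:E)%E.
  transitivity (leb (I `&` setT)); first by rewrite integral_indic//; exact: measurable_itv.
  rewrite setIT lebesgue_measure_itv/= lte_fin /overlap.
  case: ltP => h; last by rewrite max_l// subr_le0.
  by rewrite -EFinD (@max_r _ _ 0)// subr_ge0 ltW.
split; last by rewrite /Rintegral IE.
apply: ge0_integrableR => [|s _|].
- by apply: measurable_indic; exact: measurable_itv.
- by rewrite indicE.
- by rewrite [X in (X < _)%E]IE ltry.
Qed.

(** Expands the squared norm of one row of the integrand into the double sum over pairs that the
    second moment of the integral produces as well, so that the isometry can be checked pair by
    pair. *)
Lemma sum_sqr_groups (I : finType) (col : I -> 'I_d) (x : I -> R) :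
  \sum_j (\sum_(p | col p == j) x p) ^+ 2 =
  \sum_p \sum_q (col p == col q)%:R * (x p * x q).
Proof.
have xE j : \sum_(p | col p == j) x p = \sum_p (col p == j)%:R * x p.
  rewrite big_mkcond; apply: eq_bigr => p _.
  by case: eqP => _; rewrite ?mul1r ?mul0r.
transitivity (\sum_j \sum_p \sum_q ((col p == j)%:R * (col q == j)%:R) * (x p * x q)).
  apply: eq_bigr => j _; rewrite xE expr2 big_distrl; apply: eq_bigr => p _.
  by rewrite big_distrr; apply: eq_bigr => q _; rewrite /= mulrACA.
rewrite exchange_big; apply: eq_bigr => p _; rewrite exchange_big.
apply: eq_bigr => q _; rewrite -big_distrl; congr (_ * _).
rewrite (bigD1 (col p))//= eqxx mul1r big1 ?addr0 1?eq_sym// => j.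
by rewrite eq_sym => /negPf->; rewrite mul0r.
Qed.

(** The intervals may overlap in any way: by [expect_pair] a pair contributes the length of its
    overlap, which is also the time integral of the product of the two indicators. Differences of
    simple processes with unrelated partitions are thus covered without a common refinement. *)
Lemma ito_isometry_elementary : exists2 c : R, 0 <= c &
  forall (I : finType) (a b : I -> R) (col : I -> 'I_d) (f : I -> Omega -> R) (K : R),
  (forall p, 0 <= a p <= b p) -> (forall p, measurable_fun setT (f p)) ->
  (forall p, a p < b p -> F_measurable (a p) (f p)) ->
  (forall p w, `|f p w| <= K) ->
  L2 (fun w => \sum_p f p w * dB (a p) (b p) (col p) w) /\
  (\int[P]_w ((\sum_p f p w * dB (a p) (b p) (col p) w) ^+ 2)%:E =
   c%:E * \int[P]_w \int[leb]_s
     (\sum_j (\sum_(p | col p == j) f p w * itv_ind (a p) (b p) s) ^+ 2)%:E)%E.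
Proof.
have [c c0 H] := expect_pair; exists c => // I a b col f K hab mf Ff fK.
have a0 p : 0 <= a p by case/andP: (hab p).
have ab p : a p <= b p by case/andP: (hab p).
have b0 p : 0 <= b p by rewrite (le_trans (a0 p)).
have L2p p : L2 (fun w => f p w * dB (a p) (b p) (col p) w).
  by apply: (@bounded_square_integrableM _ _ _ _ _ _ K) => //; exact: (square_integrable_incr hF hB).
have L2S : L2 (fun w => \sum_p f p w * dB (a p) (b p) (col p) w).
  exact: square_integrable_sum.
split => //.
have [_ iS] := (square_integrableP _ _).1 L2S.
rewrite -EFin_Rintegral//.
pose ov p q := overlap (a p) (b p) (a q) (b q).
have iff p q : P.-integrable setT (EFin \o (fun w => f p w * f q w)).
  by apply: square_integrableM; exact: (bounded_square_integrable P (mf _) (fK _)).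
have innerE w : (\int[leb]_s
     (\sum_j (\sum_(p | col p == j) f p w * itv_ind (a p) (b p) s) ^+ 2)%:E =
   (\sum_p \sum_q ((col p == col q)%:R * ov p q) * (f p w * f q w))%:E)%E.
  under eq_integral do rewrite sum_sqr_groups.
  pose g p q s := ((col p == col q)%:R * (f p w * f q w)) * (itv_ind (a p) (b p) s * itv_ind (a q) (b q) s).
  have ig p q : leb.-integrable setT (EFin \o g p q).
    have := integrableZl measurableT ((col p == col q)%:R * (f p w * f q w)) (Rintegral_itv_ind (a p) (b p) (a q) (b q)).1.
    exact: eq_integrable.
  have igs p : leb.-integrable setT (EFin \o (fun s => \sum_q g p q s)).
    exact: integrable_sumR.
  transitivity (\int[leb]_s (\sum_p \sum_q g p q s)%:E)%E.
    apply: eq_integral => s _; congr EFin; apply: eq_bigr => p _; apply: eq_bigr => q _.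
    by rewrite /g; ring.
  rewrite -EFin_Rintegral//; last exact: integrable_sumR.
  rewrite Rintegral_sum//; congr EFin; apply: eq_bigr => p _.
  rewrite Rintegral_sum//; apply: eq_bigr => q _.
  have [i1 i2] := Rintegral_itv_ind (a p) (b p) (a q) (b q).
  by rewrite /g RintegralZl// i2 /ov mulrAC.
under [in RHS]eq_integral do rewrite innerE.
have iT p q : P.-integrable setT (EFin \o (fun w => ((col p == col q)%:R * ov p q) * (f p w * f q w))).
  have := integrableZl measurableT ((col p == col q)%:R * ov p q) (iff p q); exact: eq_integrable.
have iTs p : P.-integrable setT (EFin \o (fun w => \sum_q ((col p == col q)%:R * ov p q) * (f p w * f q w))).
  exact: integrable_sumR.
rewrite -EFin_Rintegral//; last exact: integrable_sumR.
rewrite -EFinM; congr EFin; rewrite Rintegral_sum// mulr_sumr.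
rewrite (_ : (fun w => _) = (fun w => \sum_p \sum_q
   (f p w * dB (a p) (b p) (col p) w) * (f q w * dB (a q) (b q) (col q) w))); last first.
  apply/funext => w; rewrite expr2 big_distrl; apply: eq_bigr => p _.
  by rewrite /= big_distrr.
have iJ p q : P.-integrable setT (EFin \o (fun w =>
   (f p w * dB (a p) (b p) (col p) w) * (f q w * dB (a q) (b q) (col q) w))).
  exact: square_integrableM.
rewrite Rintegral_sum//; last by move=> p; exact: integrable_sumR.
apply: eq_bigr => p _; rewrite !Rintegral_sum// mulr_sumr; apply: eq_bigr => q _.
rewrite (H _ _ _ _ _ _ _ _ K)//; last by move=> /Ff.
  by rewrite RintegralZl// -/(ov p q); ring.
by move=> /Ff.
Qed.

End ito_isometry.

Section time_space.
Context {R : realType} {disp : measure_display} {Omega : measurableType disp}.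
Variables (P : probability Omega R) (D : set R) (g : R * Omega -> \bar R).
Hypotheses (mD : measurable D) (mg : measurable_fun setT g) (g0 : forall z, (0 <= g z)%E).
Local Notation leb := (@lebesgue_measure R).

Let gD : R * Omega -> \bar R := fun z => if z.1 \in D then g z else 0%E.

Let mgD : measurable_fun setT gD.
Proof.
apply: measurable_fun_ifT => //.
rewrite (_ : (fun z : R * Omega => z.1 \in D) = (fun s => s \in D) \o fst)//.
apply: measurableT_comp; last exact: measurable_fst.
apply: (measurable_fun_bool true); rewrite setTI [X in measurable X](_ : _ = D)//.
by apply/seteqP; split => s /=; [move/set_mem|move/mem_set].
Qed.

Let gD0 z : (0 <= gD z)%E. Proof. by rewrite /gD; case: ifP. Qed.

Let gDE w : (\int[leb]_(s in D) g (s, w) = \int[leb]_s gD (s, w))%E.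
Proof. by rewrite integral_mkcond; apply: eq_integral => s _; rewrite patchE. Qed.

Lemma measurable_time_integral :
  measurable_fun setT (fun w => \int[leb]_(s in D) g (s, w))%E.
Proof.
under eq_fun do rewrite gDE.
exact: (@measurable_fun_fubini_tonelli_G _ _ (measurableTypeR R) Omega R leb gD mgD gD0).
Qed.

Lemma measurable_space_integral : measurable_fun setT (fun s => \int[P]_w g (s, w))%E.
Proof.
exact: (@measurable_fun_fubini_tonelli_F _ _ (measurableTypeR R) Omega R P g mg g0).
Qed.

Lemma tonelli_time :
  (\int[P]_w \int[leb]_(s in D) g (s, w) = \int[leb]_(s in D) \int[P]_w g (s, w))%E.
Proof.
under eq_integral do rewrite gDE.
rewrite -(@fubini_tonelli _ _ (measurableTypeR R) Omega R leb P gD mgD gD0).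
rewrite [RHS]integral_mkcond; apply: eq_integral => s _; rewrite patchE /gD /=.
by case: ifP => // _; rewrite integral0.
Qed.

End time_space.

(** * Integrals of simple processes *)

Section simple_integrals.
Context {R : realType} {disp : measure_display} {Omega : measurableType disp}.
Variables (P : probability Omega R) (F : R -> set (set Omega)).
Context {d : nat}.
Variable B : R -> Omega -> 'cV[R]_d.
Hypotheses (hF : usual_filtration P F) (hB : brownian_motion P F B).
Local Notation E := (Rintegral P setT).
Local Notation L2 := (square_integrable P).
Local Notation leb := (@lebesgue_measure R).
Local Notation F_measurable s f :=
  (measurable_fun setT ((f : Omega -> R) : g_sigma_algebraType (F s) -> R)).
Local Notation dB := (incr B).
Implicit Types S : @simple_process R _ Omega d.

Lemma sqr_enorm_cV (v : 'cV[R]_d) : enorm v ^+ 2 = \sum_i v i 0 ^+ 2.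
Proof. by rewrite sqr_enorm; apply: eq_bigr => i _; rewrite big_ord1. Qed.

Lemma sp_time_ge0 T S k : simple F T S -> (k <= sp_size S)%N -> 0 <= sp_time S k.
Proof.
case=> S0 mono _ _ _; elim: k => // k ih kn.
by rewrite (le_trans (ih (ltnW kn)))// mono.
Qed.

Lemma sp_coef_measurable T S k i j : simple F T S -> (k < sp_size S)%N ->
  F_measurable (sp_time S k) (fun w => sp_coef S k w i j).
Proof.
move=> [_ _ _ mc _] kn; by apply: F_measurable_coord => //; exact: mc.
Qed.

Lemma measurable_sp_coef T S k i j : simple F T S -> (k < sp_size S)%N ->
  measurable_fun setT (fun w => sp_coef S k w i j).
Proof.
move=> hS kn; apply: (F_measurable_measurable hF (sp_time_ge0 hS (ltnW kn))).
exact: (sp_coef_measurable _ _ hS kn).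
Qed.

Lemma sp_coef_bounded T S : simple F T S -> exists2 K : R, 0 <= K &
  forall k w i j, (k < sp_size S)%N -> `|sp_coef S k w i j| <= K.
Proof.
case=> _ _ _ _ [K hK]; exists `|K| => // k w i j kn.
by rewrite (le_trans (coord_le_enorm _ _ _))// (le_trans (hK k w kn))// ler_norm.
Qed.

Lemma sp_integralE S t w i : sp_integral B S t w i 0 =
  \sum_(k < sp_size S) \sum_j sp_coef S k w i j *
    dB (Num.min (sp_time S k) t) (Num.min (sp_time S k.+1) t) j w.
Proof.
rewrite /sp_integral summxE; apply: eq_bigr => k _.
by rewrite mxE; apply: eq_bigr => j _; rewrite !mxE.
Qed.

Lemma sp_valE S s w i j : sp_val S s w i j =
  \sum_(k < sp_size S) sp_coef S k w i j * itv_ind (sp_time S k) (sp_time S k.+1) s.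
Proof.
rewrite /sp_val summxE big_mkcond; apply: eq_bigr => k _.
by rewrite /itv_ind; case: ifP => _; rewrite ?mulr1 ?mulr0.
Qed.

Lemma measurable_sp_val T S i j : simple F T S ->
  measurable_fun setT (fun z : R * Omega => sp_val S z.1 z.2 i j).
Proof.
move=> hS; under eq_fun do rewrite sp_valE.
apply: measurable_sum => k; apply: measurable_funM.
  exact: (measurableT_comp (measurable_sp_coef i j hS (ltn_ord k)) measurable_snd).
by apply: measurableT_comp => //; exact: measurable_itv_ind.
Qed.

Lemma sp_integral_isometry : exists2 c : R, 0 <= c & forall T S S' t,
  simple F T S -> simple F T S' -> 0 <= t ->
  (forall i, L2 (fun w => (sp_integral B S t w - sp_integral B S' t w) i 0)) /\
  (\int[P]_w (enorm (sp_integral B S t w - sp_integral B S' t w) ^+ 2)%:E =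
   c%:E * \int[P]_w \int[leb]_(s in `[0%R, t])
      (enorm (sp_val S s w - sp_val S' s w) ^+ 2)%:E)%E.
Proof.
have [c c0 H] := ito_isometry_elementary hF hB; exists c => // T S S' t hS hS' t0.
have [K K0 SK] := sp_coef_bounded hS; have [K' K0' SK'] := sp_coef_bounded hS'.
pose n := sp_size S; pose n' := sp_size S'.
(* The difference of the two processes is treated as a single family: the index is an interval of
   [S] or of [S'] together with a coordinate of the Brownian motion. The times are cut at [t], and
   the coefficients of [S'] carry a minus sign. *)
pose I := (('I_n + 'I_n') * 'I_d)%type.
pose a (p : I) := Num.min (match p.1 with inl k => sp_time S k | inr k => sp_time S' k end) t.
pose b (p : I) := Num.min (match p.1 with inl k => sp_time S k.+1 | inr k => sp_time S' k.+1 end) t.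
pose f i (p : I) w := match p.1 with inl k => sp_coef S k w i p.2 | inr k => - sp_coef S' k w i p.2 end.
have hab p : 0 <= a p <= b p.
  rewrite /a /b; case: p => -[k|k] j /=; apply/andP; split.
  - by rewrite le_min t0 (sp_time_ge0 hS)// ltnW.
  - by rewrite le_min2// ; case: hS => _ + _ _ _; apply.
  - by rewrite le_min t0 (sp_time_ge0 hS')// ltnW.
  - by rewrite le_min2// ; case: hS' => _ + _ _ _; apply.
have mf i p : measurable_fun setT (f i p).
  case: p => -[k|k] j /=; first exact: (measurable_sp_coef _ _ hS (ltn_ord _)).
  by apply: measurable_funN; exact: (measurable_sp_coef _ _ hS' (ltn_ord _)).
(* [a p < b p] forces the left end to lie before [t], so that cutting at [t] has not moved it. *)
have Ff i p : a p < b p -> F_measurable (a p) (f i p).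
  rewrite /a /b; case: p => -[k|k] j /= h.
  - rewrite min_l; first exact: (sp_coef_measurable _ _ hS (ltn_ord _)).
    by move: h; rewrite gt_min !lt_min !ltxx andbF orbF => /andP[_ /ltW].
  - rewrite min_l; first by apply: measurable_funN; exact: (sp_coef_measurable _ _ hS' (ltn_ord _)).
    by move: h; rewrite gt_min !lt_min !ltxx andbF orbF => /andP[_ /ltW].
have fK i p w : `|f i p w| <= K + K'.
  case: p => -[k|k] j /=.
    by rewrite (le_trans (SK k w i j _))// lerDl.
  by rewrite /f /= normrN (le_trans (SK' k w i j _))// lerDr.
have intE i w : (sp_integral B S t w - sp_integral B S' t w) i 0 =
    \sum_(p : I) f i p w * dB (a p) (b p) p.2 w.
  rewrite !mxE !sp_integralE -(pair_bigA _ (fun q j => f i (q, j) w * dB (a (q, j)) (b (q, j)) j w)) big_sumType /=.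
  congr (_ + _); rewrite -sumrN; apply: eq_bigr => k _; rewrite -sumrN.
  by apply: eq_bigr => j _; rewrite /f /= mulNr.
have valE i j w s : 0 <= s <= t -> (sp_val S s w - sp_val S' s w) i j =
    \sum_(p : I | p.2 == j) f i p w * itv_ind (a p) (b p) s.
  move=> /andP[s0 st]; rewrite big_mkcond -(pair_bigA _ (fun q l => if l == j then f i (q, l) w * itv_ind (a (q, l)) (b (q, l)) s else 0)) /=.
  rewrite (eq_bigr (fun q => f i (q, j) w * itv_ind (a (q, j)) (b (q, j)) s)); last first.
    by move=> q _; rewrite -big_mkcond big_pred1_eq.
  have ie u v : itv_ind (Num.min u t) (Num.min v t) s = itv_ind u v s.
    by rewrite /itv_ind gt_min le_min st andbT [t < s]ltNge st orbF.
  rewrite !mxE !sp_valE big_sumType /=; congr (_ + _).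
    by apply: eq_bigr => k _; rewrite /a /b /= ie.
  by rewrite -sumrN; apply: eq_bigr => k _; rewrite /a /b /f /= ie mulNr.
(* The cut family vanishes outside [[0, t]], so the integral over the whole line in
   [ito_isometry_elementary] reduces to one over [[0, t]]. *)
have val0 i j w s : ~ (0 <= s <= t) ->
    \sum_(p : I | p.2 == j) f i p w * itv_ind (a p) (b p) s = 0.
  move=> st; apply: big1 => p _; rewrite /itv_ind.
  case: (boolP (a p < s <= b p)) => [/andP[as' sb]|_]; last by rewrite mulr0.
  exfalso; apply: st; apply/andP; split.
    by case/andP: (hab p) => a0 _; rewrite (le_trans a0)// ltW.
  by rewrite (le_trans sb)// /b ge_min lexx orbT.
have Hi i := H I a b (fun p => p.2) (f i) (K + K') hab (mf i) (Ff i) (fK i).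
split.
  by move=> i; under eq_fun do rewrite intE; have [] := Hi i.
pose g i (z : R * Omega) : R := \sum_j (\sum_(p : I | p.2 == j) f i p z.2 * itv_ind (a p) (b p) z.1) ^+ 2.
have mg i : measurable_fun setT (fun z => (g i z)%:E).
  apply/measurable_EFinP; apply: measurable_sum => j; apply: measurable_funX.
  rewrite (_ : (fun z => _) = (fun z : R * Omega => \sum_(p : I)
      if p.2 == j then f i p z.2 * itv_ind (a p) (b p) z.1 else 0)); last first.
    by apply/funext => z; rewrite big_mkcond.
  apply: measurable_sum => p; case: (p.2 == j) => //; apply: measurable_funM.
    exact: (measurableT_comp (mf i p) measurable_snd).
  by apply: measurableT_comp => //; exact: measurable_itv_ind.
have g0 i z : (0 <= (g i z)%:E)%E.
  by rewrite lee_fin sumr_ge0// => j _; exact: sqr_ge0.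
transitivity (\int[P]_w (\sum_i ((\sum_(p : I) f i p w * dB (a p) (b p) p.2 w) ^+ 2)%:E))%E.
  by apply: eq_integral => w _; rewrite sqr_enorm_cV sumEFin; congr EFin; apply: eq_bigr => i _; rewrite intE.
rewrite ge0_integral_sum//; last 2 first.
- move=> i; apply/measurable_EFinP/measurable_funX.
  by have [[]] := Hi i.
- by move=> i w _; rewrite lee_fin sqr_ge0.
rewrite (eq_bigr (fun i => c%:E * \int[P]_w \int[leb]_s (g i (s, w))%:E)%E); last first.
  by move=> i _; have [_ e] := Hi i; exact: e.
rewrite -ge0_sume_distrr; last first.
  by move=> i _; apply: integral_ge0 => w _; exact: integral_ge0.
congr (_ * _)%E; rewrite -ge0_integral_sum//; last 2 first.
- by move=> i; exact: (@measurable_time_integral _ _ _ setT (fun z => (g i z)%:E)).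
- by move=> i w _; exact: integral_ge0.
apply: eq_integral => w _.
rewrite -ge0_integral_sum//; last first.
- by move=> i; have := @measurable_fun_pair1 _ _ _ (measurableTypeR R) Omega _ _ w (mg i).
rewrite [RHS]integral_mkcond; apply: eq_integral => s _.
rewrite patchE mem_setE in_itv/=; case: ifP => [st|/negP st].
  rewrite sqr_enorm sumEFin; congr EFin; apply: eq_bigr => i _; apply: eq_bigr => j _.
  by rewrite valE.
rewrite big1// => i _; rewrite /g big1// => j _; by rewrite val0// expr0n.
Qed.

Lemma square_integrable_sp_integral T S t i : simple F T S -> 0 <= t ->
  L2 (fun w => sp_integral B S t w i 0).
Proof.
move=> hS t0; under eq_fun do rewrite sp_integralE.
apply: square_integrable_sum => k; apply: square_integrable_sum => j.
have [K K0 SK] := sp_coef_bounded hS.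
apply: (@bounded_square_integrableM _ _ _ _ _ _ K).
- exact: (measurable_sp_coef _ _ hS (ltn_ord _)).
- by move=> w; exact: SK.
- by apply: (square_integrable_incr hF hB); rewrite le_min t0 (sp_time_ge0 hS)// ltnW.
Qed.

Lemma sp_integral_martingale T S s t i A : simple F T S -> 0 <= s -> s <= t -> F s A ->
  E (fun w => \1_A w * (sp_integral B S t w i 0 - sp_integral B S s w i 0)) = 0.
Proof.
move=> hS s0 st FA; have t0 := le_trans s0 st.
have [K K0 SK] := sp_coef_bounded hS.
have mA : measurable A by exact: (filtration_measurable hF s0).
have A1 w : `|\1_A w : R| <= 1 by rewrite indicE; case: (_ \in _); rewrite ?normr1 ?normr0.
pose J (k : 'I_(sp_size S)) j w := \1_A w * (sp_coef S k w i j *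
  (dB (Num.min (sp_time S k) t) (Num.min (sp_time S k.+1) t) j w -
   dB (Num.min (sp_time S k) s) (Num.min (sp_time S k.+1) s) j w)).
rewrite (_ : (fun w => _) = (fun w => \sum_k \sum_j J k j w)); last first.
  apply/funext => w; rewrite !sp_integralE -sumrB mulr_sumr; apply: eq_bigr => k _.
  by rewrite -sumrB mulr_sumr; apply: eq_bigr => j _; rewrite /J -mulrBr.
have tk0 k : (k <= sp_size S)%N -> 0 <= sp_time S k by exact: (sp_time_ge0 hS).
have L2J k j : L2 (J k j).
  apply: (@bounded_square_integrableM _ _ _ _ _ _ 1) => //.
  apply: (@bounded_square_integrableM _ _ _ _ _ _ K).
  - exact: (measurable_sp_coef _ _ hS (ltn_ord _)).
  - by move=> w; exact: SK.
  - by apply: square_integrableB; apply: (square_integrable_incr hF hB); rewrite le_min ?t0 ?s0 tk0// ltnW.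
have iJ k j := square_integrable_integrable (L2J k j).
rewrite Rintegral_sum//; last by move=> k; exact: integrable_sumR.
apply: big1 => k _; rewrite Rintegral_sum//; apply: big1 => j _.
set u := sp_time S k; set v := sp_time S k.+1.
have u0 : 0 <= u by rewrite tk0// ltnW.
have uv : u <= v by case: hS => _ + _ _ _; apply.
have mc : F_measurable u (fun w => sp_coef S k w i j) by exact: (sp_coef_measurable _ _ hS (ltn_ord _)).
(* What an interval contributes between [s] and [t] is an increment that starts after both [s] and
   [u], when the indicator of [A] and the coefficient are already known. The cases below locate the
   interval from [u] to [v] relative to [s] and [t]. *)
have key a c : 0 <= a -> u <= a -> s <= a -> a <= c ->
    (forall w, J k j w = (\1_A w * sp_coef S k w i j) * dB a c j w) -> E (J k j) = 0.
  move=> a0 ua sa ac JE; rewrite (_ : J k j = fun w => (\1_A w * sp_coef S k w i j) * dB a c j w); last exact/funext.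
  apply: (expect_mul_incr hF hB) => //.
    apply: measurable_funM; last exact: (F_measurable_le hF u0).
    by apply: F_measurable_indic; exact: (filtration_le hF s0 sa).
  apply: (@bounded_square_integrable _ _ _ _ _ (1 * K)).
    by apply: measurable_funM; [exact: measurable_indic|exact: (measurable_sp_coef _ _ hS (ltn_ord _))].
  by move=> w; rewrite normrM ler_pM// SK.
have zero : (forall w, J k j w = 0) -> E (J k j) = 0.
  by move=> J0; rewrite (_ : J k j = fun=> 0) ?Rintegral_cstR//; exact/funext.
have [vs|sv] := leP v s.
  apply: zero => w; rewrite /J -/u -/v !min_l ?subrr ?mulr0//; lra.
have [su|us] := leP s u.
  have [tu|ut] := leP t u.
    apply: zero => w; rewrite /J -/u -/v !min_r /incr ?subrr ?mulr0//; lra.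
  apply: (key u (Num.min v t)) => //; first by rewrite le_min uv ltW.
  move=> w; rewrite /J -/u -/v (min_l (ltW ut)) (min_r su) (min_r (ltW sv)).
  by rewrite /incr; ring.
apply: (key s (Num.min v t)) => //; [exact: ltW|by rewrite le_min st ltW|].
move=> w; rewrite /J -/u -/v (@min_l _ _ u t) ?(le_trans (ltW us))// (min_l (ltW us)) (min_r (ltW sv)).
by rewrite /incr; ring.
Qed.

End simple_integrals.

Lemma measurable_bigmax {d} {T : measurableType d} {R : realType} (D : set T) (I : Type)
    (s : seq I) (h : I -> T -> R) : (forall i, measurable_fun D (h i)) ->
  measurable_fun D (fun x => \big[Num.max/0]_(i <- s) h i x).
Proof.
move=> mh; elim: s => [|i s ih].
  by under eq_fun do rewrite big_nil; exact: measurable_cst.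
by under eq_fun do rewrite big_cons; exact: measurable_maxr.
Qed.

(** * Doob's maximal inequality *)

Section doob.
Context {R : realType}.

Fixpoint running_max (x : nat -> R) (n : nat) : R :=
  if n is m.+1 then Num.max (running_max x m) `|x m.+1| else `|x 0%N|.

Definition sign_of (a : R) : R := if 0 <= a then 1 else -1.

Lemma running_max_ge x n k : (k <= n)%N -> `|x k| <= running_max x n.
Proof.
elim: n => [|n ih]; first by rewrite leqn0 => /eqP->.
by rewrite leq_eqVlt => /predU1P[->|kn]; rewrite /= le_max ?lexx ?orbT// ih.
Qed.

Lemma running_max_ge0 x n : 0 <= running_max x n.
Proof. by rewrite (le_trans (normr_ge0 _) (running_max_ge x (leqnn n))). Qed.

(** If the maximum does not move, the first hypothesis and twice the second add up to the claim; if
    it moves to [z], the slack is [(z - m) ^ 2]. *)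
Let running_max_step (m z y S u : R) : m ^+ 2 + 2 * S <= 2 * (m * y) -> u <= m * (z - y) ->
  Num.max m z ^+ 2 + 2 * (S + u) <= 2 * (Num.max m z * z).
Proof.
rewrite maxElt !expr2 => h1 h2; case: ltP => mz; last by lra.
by have := sqr_ge0 (z - m); rewrite expr2; lra.
Qed.

(* The pathwise form of Doob's L^2 inequality: the sum is a martingale transform
   when x is a path of a martingale, hence has zero mean. *)
Lemma pathwise_doob x n :
  running_max x n ^+ 2 +
    2 * \sum_(k < n) running_max x k * sign_of (x k) * (x k.+1 - x k) <=
  2 * (running_max x n * `|x n|).
Proof.
elim: n => [|n ih].
  rewrite big_ord0 mulr0 addr0 /= expr2.
  by have := mulr_ge0 (normr_ge0 (x 0%N)) (normr_ge0 (x 0%N)); lra.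
rewrite big_ord_recr /=.
have m0 := running_max_ge0 x n.
(* [sign_of (x n)] is a subgradient of the absolute value at [x n]. *)
have sx : sign_of (x n) * (x n.+1 - x n) <= `|x n.+1| - `|x n|.
  rewrite /sign_of; case: ifPn => [xn|]; last rewrite -ltNge => xn.
    by rewrite mul1r (ger0_norm xn) lerD2r ler_norm.
  by rewrite mulN1r (ltr0_norm xn) opprB opprK addrC lerD2r -normrN ler_norm.
by apply: running_max_step ih _; rewrite -mulrA ler_wpM2l.
Qed.

Context {disp : measure_display} {Omega : measurableType disp}.
Variables (P : probability Omega R) (F : R -> set (set Omega)).
Hypothesis hF : usual_filtration P F.
Local Notation E := (Rintegral P setT).
Local Notation L2 := (square_integrable P).
Local Notation F_measurable s f :=
  (measurable_fun setT ((f : Omega -> R) : g_sigma_algebraType (F s) -> R)).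

Variables (T : R) (N : R -> Omega -> R).
Hypothesis T0 : 0 < T.
Hypothesis L2N : forall t, 0 <= t <= T -> L2 (N t).
Hypothesis mN : forall t, 0 <= t <= T -> F_measurable t (N t).
Hypothesis martN : forall s t A, 0 <= s -> s <= t -> t <= T -> F s A ->
  E (fun w => \1_A w * (N t w - N s w)) = 0.

Lemma martingale_orthogonal s t f : 0 <= s -> s <= t -> t <= T ->
  F_measurable s f -> L2 f -> E (fun w => f w * (N t w - N s w)) = 0.
Proof.
move=> s0 st tT mf fi.
have L2d : L2 (fun w => N t w - N s w).
  by apply: square_integrableB; apply: L2N; rewrite ?s0 ?(le_trans s0 st) ?(le_trans st).
apply: (Rintegral_mul_eq0 (filtration_sigma_algebra hF s0) (filtration_measurable hF s0) mf).
- exact: square_integrable_integrable.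
- exact: square_integrableM.
- by move=> A FA; exact: martN.
Qed.

Lemma doob_grid n :
  (\int[P]_w (running_max (fun k => N (grid T n k) w) n.+1 ^+ 2)%:E <=
   4%:E * \int[P]_w (N T w ^+ 2)%:E)%E.
Proof.
pose x w k := N (grid T n k) w.
have gT k : (k <= n.+1)%N -> 0 <= grid T n k <= T by exact: grid_itv.
have xT w : x w n.+1 = N T w by rewrite /x /grid mulfK ?pnatr_eq0.
have mM k t : (k <= n.+1)%N -> grid T n k <= t -> F_measurable t (fun w => running_max (x w) k).
  elim: k => [|k ih] kn gt.
    apply: measurableT_comp => //.
    have /andP[g0 gT'] := gT 0%N kn.
    by apply: (F_measurable_le hF g0 gt); apply: mN; exact: gT.
  apply: measurable_maxr.
    by apply: ih; [exact: ltnW|exact: le_trans (le_grid T0 _ (leqnSn k)) gt].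
  apply: measurableT_comp => //.
  have /andP[g0 gT'] := gT k.+1 kn.
  apply: (F_measurable_le hF g0 gt); apply: mN; exact: gT.
have L2x k : (k <= n.+1)%N -> L2 (fun w => x w k) by move=> kn; apply: L2N; exact: gT.
have L2M k : (k <= n.+1)%N -> L2 (fun w => running_max (x w) k).
  move=> kn; have /andP[g0 gT'] := gT k kn.
  (* The square of a running maximum is at most the sum of the squares. *)
  apply: (@le_square_integrable _ _ _ _ _ (fun w => \sum_(j < k.+1) x w j ^+ 2)).
  - by apply: (F_measurable_measurable hF g0); exact: mM.
  - move=> w; elim: k {kn g0 gT'} => [|k ih].
      by rewrite big_ord_recr big_ord0 /= add0r real_normK ?num_real.
    rewrite big_ord_recr /=; set s := \sum_(_ < _) _ in ih *.
    have s0 : 0 <= s by apply: le_trans ih; exact: sqr_ge0.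
    case: (leP (running_max (x w) k)) => _; first by rewrite real_normK ?num_real// lerDr.
    by rewrite (le_trans ih)// lerDl sqr_ge0.
  - have H (j : 'I_k.+1) : P.-integrable setT (EFin \o (fun w => x w j ^+ 2)).
      have jn : (j <= n.+1)%N by rewrite (leq_trans _ kn)// -ltnS.
      by have [_] := (square_integrableP _ _).1 (L2x j jn).
    exact: (integrable_sumR (index_enum 'I_k.+1) measurableT H).
have msg k t : 0 <= t -> (k <= n.+1)%N -> grid T n k <= t -> F_measurable t (fun w => sign_of (x w k)).
  move=> t0 kn gt; have /andP[g0 gT'] := gT k kn.
  have mx : F_measurable t (fun w => x w k).
    by apply: (F_measurable_le hF g0 gt); exact: mN (gT k kn).
  apply: measurable_fun_ifT => //; exact: measurable_fun_ler.
have sg1 a : `|sign_of a| <= 1.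
  by rewrite /sign_of; case: ifP => _; rewrite ?normrN normr1.
pose D k w := running_max (x w) k * sign_of (x w k) * (x w k.+1 - x w k).
have L2Ms k : (k <= n.+1)%N -> L2 (fun w => running_max (x w) k * sign_of (x w k)).
  move=> kn; have /andP[g0 gT'] := gT k kn.
  under eq_fun do rewrite mulrC.
  apply: (@bounded_square_integrableM _ _ _ _ _ _ 1) => //; last exact: L2M.
  by apply: (F_measurable_measurable hF g0); exact: msg.
have ED k : (k < n.+1)%N -> E (D k) = 0.
  move=> kn; have /andP[g0 gT'] := gT k (ltnW kn); have /andP[g0' gT''] := gT k.+1 kn.
  apply: martingale_orthogonal => //; first exact: le_grid.
    by apply: measurable_funM; [apply: mM => //; exact: ltnW|apply: msg => //; exact: ltnW].
  by apply: L2Ms; exact: ltnW.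
have iD k : (k < n.+1)%N -> P.-integrable setT (EFin \o D k).
  move=> kn; apply: square_integrableM; first by apply: L2Ms; exact: ltnW.
  by apply: square_integrableB; apply: L2x => //; exact: ltnW.
have [_ iM2] := (square_integrableP _ _).1 (L2M n.+1 (leqnn _)).
have [_ ix2] := (square_integrableP _ _).1 (L2x n.+1 (leqnn _)).
have iMx : P.-integrable setT (EFin \o (fun w => running_max (x w) n.+1 * `|x w n.+1|)).
  apply: square_integrableM; first exact: L2M.
  apply: (@le_square_integrable _ _ _ _ _ (fun w => x w n.+1 ^+ 2)) => //.
    by apply: measurableT_comp => //; case: (L2x n.+1 (leqnn _)).
  by move=> w; rewrite real_normK ?num_real.
pose S w := \sum_(k < n.+1) D k w.
have iS : P.-integrable setT (EFin \o S) by apply: integrable_sumR => // k; exact: iD.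
have ES : E S = 0.
  by rewrite Rintegral_sum//; [apply: big1 => k _; exact: ED|move=> k; exact: iD].
(* Write [m] for the running maximum and [y] for the last value. Twice [pathwise_doob] bounds
   [2 m ^ 2 + 4 S] by [4 m |y|], which is at most [m ^ 2 + 4 y ^ 2]. Absorbing one [m ^ 2] leaves
   Doob's constant 4, and [S] has mean zero. *)
have h1 : E (fun w => running_max (x w) n.+1 ^+ 2) <=
    E (fun w => 4 * x w n.+1 ^+ 2 - 4 * S w).
  have i4 : P.-integrable setT (EFin \o (fun w => 4 * x w n.+1 ^+ 2)).
    have := integrableZl measurableT 4 ix2; exact: eq_integrable.
  have i4' : P.-integrable setT (EFin \o (fun w => 4 * S w)).
    have := integrableZl measurableT 4 iS; exact: eq_integrable.
  apply: le_RintegralR => //.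
    have := integrableB measurableT i4 i4'; exact: eq_integrable.
  move=> w _; have := pathwise_doob (x w) n.+1; rewrite -/(S w).
  have := sqr_ge0 (running_max (x w) n.+1 - 2 * `|x w n.+1|).
  rewrite sqrrB exprMn real_normK ?num_real//; lra.
rewrite -EFin_Rintegral//.
rewrite -[X in (_ <= _ * X)%E]EFin_Rintegral//; last first.
  by move: ix2; apply: eq_integrable => // w _; rewrite /= xT.
rewrite -EFinM lee_fin; apply: le_trans h1 _.
have i4 : P.-integrable setT (EFin \o (fun w => 4 * x w n.+1 ^+ 2)).
  have := integrableZl measurableT 4 ix2; exact: eq_integrable.
have i4' : P.-integrable setT (EFin \o (fun w => 4 * S w)).
  have := integrableZl measurableT 4 iS; exact: eq_integrable.
rewrite RintegralB// !RintegralZl// ES mulr0 subr0.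
by rewrite le_eqVlt; apply/orP; left; apply/eqP; congr (_ * E _); apply/funext => w; rewrite xT.
Qed.

Hypothesis cN : forall w, {within `[0, T], continuous (fun t => N t w)}.

Lemma sqr_process_cvg w :
  ((\big[Num.max/0]_(k < n.+2) N (grid T n k) w ^+ 2)%:E @[n --> \oo] -->
     ereal_sup [set (N t w ^+ 2)%:E | t in `[0%R, T]])%E.
Proof.
apply: (cvg_max_grid T0 (f := fun t => N t w ^+ 2)) => [|t _]; last exact: sqr_ge0.
apply: (@within_continuous_comp _ _ _ _ _ (fun x : R => x ^+ 2)) => // x _.
exact: exprn_continuous.
Qed.

(** The grids are not nested, so their maxima need not increase with [n]; Fatou's lemma takes the
    place of monotone convergence. *)
Lemma doob_sup :
  (\int[P]_w ereal_sup [set (N t w ^+ 2)%:E | t in `[0%R, T]] <=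
   4%:E * \int[P]_w (N T w ^+ 2)%:E)%E.
Proof.
pose u n w := (\big[Num.max/0]_(k < n.+2) N (grid T n k) w ^+ 2)%:E.
have mNT t : 0 <= t <= T -> measurable_fun setT (N t) by move=> /L2N [].
have mu' n : measurable_fun setT (u n).
  apply/measurable_EFinP.
  apply: measurable_bigmax => k; apply: measurable_funX; apply: mNT.
  by rewrite grid_itv// -ltnS.
have u0 n w : (0 <= u n w)%E.
  rewrite lee_fin; elim/big_ind: _ => // [a c a0 c0|k _]; last exact: sqr_ge0.
  by rewrite le_max a0.
have -> : (\int[P]_w ereal_sup [set (N t w ^+ 2)%:E | t in `[0%R, T]] =
    \int[P]_w limn_einf (u ^~ w))%E.
  apply: eq_integral => w _.
  have [e _] := cvg_limn_einf_sup (@sqr_process_cvg w).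
  by rewrite -[LHS]e.
apply: le_trans (fatou P measurableT mu' (fun n w _ => u0 n w)) _.
rewrite limn_einf_lim; apply: lime_le; first exact: is_cvg_einfs.
near=> n; apply: (@le_trans _ _ (\int[P]_w u n w)%E).
  by apply: ereal_inf_lbound; exists n => /=.
apply: le_trans _ (doob_grid n).
apply: ge0_le_lower_integral => w _; first exact: u0.
rewrite lee_fin; apply: bigmax_le => [|k _]; first exact: sqr_ge0.
rewrite -[leLHS]real_normK ?num_real// ler_pXn2r ?nnegrE ?running_max_ge0//.
by apply: (running_max_ge (fun k => N (grid T n k) w)); rewrite -ltnS.
Unshelve. all: by end_near. Qed.


End doob.

(** * The Ito integral *)

Section time_space_integral.
Context {R : realType} {disp : measure_display} {Omega : measurableType disp}.
Variable P : probability Omega R.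
Local Notation leb := (@lebesgue_measure R).
Implicit Types (f g : R * Omega -> R) (t : R).

Definition time_space_integral t f : \bar R :=
  (\int[P]_w \int[leb]_(s in `[0%R, t]) (f (s, w))%:E)%E.

Lemma time_space_integral_ge0 t f : (forall z, 0 <= f z) -> (0 <= time_space_integral t f)%E.
Proof. by move=> f0; apply: integral_ge0 => w _; apply: integral_ge0 => s _; rewrite lee_fin. Qed.

Lemma le_time_space_integral t f g : (forall z, 0 <= f z) ->
  (forall s w, 0 <= s <= t -> f (s, w) <= g (s, w)) ->
  (time_space_integral t f <= time_space_integral t g)%E.
Proof.
move=> f0 fg; apply: ge0_le_lower_integral => w _.
  by apply: integral_ge0 => s _; rewrite lee_fin.
apply: ge0_le_lower_integral => s /=; rewrite in_itv/= => st; rewrite lee_fin//.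
exact: fg.
Qed.

Lemma time_space_integral_subset t t' f : t <= t' -> (forall z, 0 <= f z) ->
  measurable_fun setT f ->
  (time_space_integral t f <= time_space_integral t' f)%E.
Proof.
move=> tt' f0 mf; apply: ge0_le_lower_integral => w _.
  by apply: integral_ge0 => s _; rewrite lee_fin.
apply: ge0_subset_integral => //.
- apply/measurable_EFinP/measurable_funTS.
  exact: (@measurable_fun_pair1 _ _ _ (measurableTypeR R) Omega _ f w mf).
- by move=> s _; rewrite lee_fin.
- by move=> s /=; rewrite !in_itv/= => /andP[-> /le_trans]; apply.
Qed.

Lemma time_space_integralD t f g : (forall z, 0 <= f z) -> (forall z, 0 <= g z) ->
  measurable_fun setT f -> measurable_fun setT g ->
  time_space_integral t (fun z => f z + g z) =
  (time_space_integral t f + time_space_integral t g)%E.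
Proof.
move=> f0 g0 mf mg; rewrite /time_space_integral -ge0_integralD//; first last.
- by apply: (@measurable_time_integral _ _ _ _ (fun z => (g z)%:E)) => //; exact/measurable_EFinP.
- by move=> w _; apply: integral_ge0 => s _; rewrite lee_fin.
- by apply: (@measurable_time_integral _ _ _ _ (fun z => (f z)%:E)) => //; exact/measurable_EFinP.
- by move=> w _; apply: integral_ge0 => s _; rewrite lee_fin.
apply: eq_integral => w _; rewrite -ge0_integralD//; first last.
- apply/measurable_EFinP/measurable_funTS.
  exact: (@measurable_fun_pair1 _ _ _ (measurableTypeR R) Omega _ g w mg).
- by move=> s _; rewrite lee_fin.
- apply/measurable_EFinP/measurable_funTS.
  exact: (@measurable_fun_pair1 _ _ _ (measurableTypeR R) Omega _ f w mf).
- by move=> s _; rewrite lee_fin.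
Qed.

Lemma time_space_integralZ t k f : 0 <= k -> (forall z, 0 <= f z) ->
  measurable_fun setT f ->
  time_space_integral t (fun z => k * f z) = (k%:E * time_space_integral t f)%E.
Proof.
move=> k0 f0 mf; rewrite /time_space_integral -ge0_integralZl_EFin//; first last.
- by apply: (@measurable_time_integral _ _ _ _ (fun z => (f z)%:E)) => //; exact/measurable_EFinP.
- by move=> w _; apply: integral_ge0 => s _; rewrite lee_fin.
apply: eq_integral => w _; rewrite -ge0_integralZl_EFin//; first last.
- apply/measurable_EFinP/measurable_funTS.
  exact: (@measurable_fun_pair1 _ _ _ (measurableTypeR R) Omega _ f w mf).
- by move=> s _; rewrite lee_fin.
Qed.

Lemma time_space_integral_le3 t f g1 g2 g3 : (forall z, 0 <= f z) ->
  (forall z, 0 <= g1 z) -> (forall z, 0 <= g2 z) -> (forall z, 0 <= g3 z) ->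
  measurable_fun setT g1 -> measurable_fun setT g2 -> measurable_fun setT g3 ->
  (forall z, f z <= 3 * (g1 z + g2 z + g3 z)) ->
  (time_space_integral t f <= 3%:E * (time_space_integral t g1 +
     time_space_integral t g2 + time_space_integral t g3))%E.
Proof.
move=> f0 g10 g20 g30 m1 m2 m3 fg.
have g120 z : 0 <= g1 z + g2 z by rewrite addr_ge0.
have m12 : measurable_fun setT (fun z => g1 z + g2 z) by exact: measurable_funD.
rewrite -(time_space_integralD t g10 g20 m1 m2) -(time_space_integralD t g120 g30 m12 m3).
rewrite -time_space_integralZ//; last 2 first.
- by move=> z; rewrite addr_ge0.
- exact: measurable_funD.
exact: le_time_space_integral.
Qed.

End time_space_integral.

Lemma cvge0_lt {R : realType} (u : nat -> \bar R) (e : R) : (u n @[n --> \oo] --> 0)%E -> 0 < e ->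
  \forall n \near \oo, (u n < e%:E)%E.
Proof.
move=> /fine_cvgP[ufin u0] e0; near=> n.
have un : u n \is a fin_num by near: n.
rewrite -(fineK un) lte_fin; near: n.
exact: (cvgr_lt _ u0 _ e0).
Unshelve. all: by end_near. Qed.

(** The error bookkeeping of [ito_dist_le]. With four errors below [e'], the nested bound is [3 (c 3
    (Q + 2 e') + 2 e') = 9 c Q + (18 c + 6) e'], and [e'] is chosen to make the last term equal to
    [e]. *)
Lemma ereal_approx_bound {R : realType} (c e : R) (X I J Q a a' b b' : \bar R) :
  0 <= c -> 0 < 18 * c + 6 -> 0 < e / (18 * c + 6) -> (0 <= Q)%E ->
  (X <= 3%:E * (I + a + a'))%E -> I = (c%:E * J)%E ->
  (J <= 3%:E * (Q + b + b'))%E ->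
  (a < (e / (18 * c + 6))%:E)%E -> (a' < (e / (18 * c + 6))%:E)%E ->
  (b < (e / (18 * c + 6))%:E)%E -> (b' < (e / (18 * c + 6))%:E)%E ->
  (X <= (9 * c)%:E * Q + e%:E)%E.
Proof.
set e' := e / _ => c0 K0 e'0 Q0 /[swap] -> hX hJ /ltW ha /ltW ha' /ltW hb /ltW hb'.
have e'c : e = e' * (18 * c + 6) by rewrite divfK// gt_eqF.
apply: le_trans hX _.
apply: (@le_trans _ _ (3%:E * (c%:E * (3%:E * (Q + e'%:E + e'%:E)) + e'%:E + e'%:E))%E).
  rewrite lee_wpmul2l ?lee_fin// leeD// leeD// lee_wpmul2l ?lee_fin//.
  by rewrite (le_trans hJ)// lee_wpmul2l ?lee_fin// leeD// leeD.
move: Q0; case: Q hJ => [q| |]// hJ q0.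
  by rewrite -!(EFinD, EFinM) lee_fin e'c; lra.
(* For infinite [Q] the bound is trivial only if [c] is positive, because [0 * +oo = 0]. *)
have [->|cn0] := eqVneq c 0.
  rewrite mulr0 !mul0e !add0e -EFinD -EFinM lee_fin e'c.
  have : 0 <= e' * c by rewrite mulr_ge0// ltW.
  lra.
have c9 : 0 < 9 * c by rewrite mulr_gt0// lt0r cn0.
suff -> : ((9 * c)%:E * +oo + e%:E = +oo)%E by exact: leey.
by rewrite gt0_muley ?lte_fin.
Qed.

Section ito_integral_theory.
Context {R : realType} {disp : measure_display} {Omega : measurableType disp}.
Variables (P : probability Omega R) (F : R -> set (set Omega)).
Context {d : nat}.
Variable B : R -> Omega -> 'cV[R]_d.
Hypotheses (hF : usual_filtration P F) (hB : brownian_motion P F B).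
Local Notation E := (Rintegral P setT).
Local Notation L2 := (square_integrable P).
Local Notation leb := (@lebesgue_measure R).
Local Notation F_measurable s f :=
  (measurable_fun setT ((f : Omega -> R) : g_sigma_algebraType (F s) -> R)).
Variable T : R.
Hypothesis T0 : 0 < T.
Implicit Types (H : R -> Omega -> 'M[R]_d) (M : R -> Omega -> 'cV[R]_d).

(* [progressive T H] says nothing about H outside [0, T]. *)
Definition time_patch H (t : R) (w : Omega) : 'M[R]_d :=
  if 0 <= t <= T then H t w else 0.

Lemma measurable_time_patch H i j : progressive F T H ->
  measurable_fun setT (fun z : R * Omega => time_patch H z.1 z.2 i j).
Proof.
move=> /(_ T); rewrite (ltW T0) lexx => /(_ isT) pH.
pose D : set (R * Omega) := `[0, T] `*` setT.
have mD : measurable D by apply: measurableX.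
pose h (z : R * Omega) := H z.1 z.2 i j.
have mh : measurable_fun D h.
  move=> _ V mV.
  have := borel_measurable_comp (f := fun A : 'M[R]_d => A i j) pH (@coord_continuous _ _ _ i j) mV.
  apply: smallest_sub; first exact: sigma_algebra_measurable.
  move=> _ [A mA [C FC <-]]; apply: measurableX => //.
  exact: (filtration_measurable hF (ltW T0)).
rewrite (_ : (fun z => _) = h \_ D); first exact/(measurable_restrictT _ mD).
apply/funext => z; rewrite patchE /time_patch /h /D.
have -> : (z \in (`[0, T] `*` setT : set (R * Omega))) = (0 <= z.1 <= T).
  apply/idP/idP; first by move/set_mem => [/=]; rewrite in_itv.
  by move=> h'; apply/mem_set; split => //=; rewrite in_itv.
by case: ifP => // _; rewrite mxE.
Qed.

Lemma measurable_sqr_dist (m n : nat) (X Y : R * Omega -> 'M[R]_(m, n)) :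
  (forall i j, measurable_fun setT (fun z => X z i j)) ->
  (forall i j, measurable_fun setT (fun z => Y z i j)) ->
  measurable_fun setT (fun z => enorm (X z - Y z) ^+ 2).
Proof.
move=> mX mY; apply: measurable_funX; apply: measurable_enorm => i j.
by under eq_fun do rewrite !mxE; exact: measurable_funB.
Qed.

Lemma integrand_dist2E H (S : @simple_process R _ Omega d) :
  integrand_dist2 P T H (sp_val S) =
  time_space_integral P T (fun z => enorm (time_patch H z.1 z.2 - sp_val S z.1 z.2) ^+ 2).
Proof.
apply: eq_integral => w _; apply: eq_integral => s; rewrite inE/= in_itv/= => st.
by rewrite /time_patch st.
Qed.

Lemma ito_coord_F_measurable H M t i : ito_integral P F B T H M -> 0 <= t <= T ->
  F_measurable t (fun w => M t w i 0).
Proof.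
move=> [_ _ aM _ _] tT; apply: F_measurable_coord; apply: aM.
by rewrite /= in_itv.
Qed.

(** One simple process serves two times at once, as the martingale property compares the integral at
    [s] with the integral at [t]. *)
Lemma ito_approx H M (e : R) : ito_integral P F B T H M -> 0 < e ->
  forall s t, 0 <= s <= T -> 0 <= t <= T -> exists S : simple_process,
  [/\ simple F T S, (integrand_dist2 P T H (sp_val S) < e%:E)%E,
   (\int[P]_w (enorm (sp_integral B S s w - M s w) ^+ 2)%:E < e%:E)%E &
   (\int[P]_w (enorm (sp_integral B S t w - M t w) ^+ 2)%:E < e%:E)%E].
Proof.
move=> [_ _ _ _ [S [hS Scvg Mcvg]]] e0 s t sT tT.
have h1 := cvge0_lt Scvg e0.
have h2 := cvge0_lt (Mcvg s sT) e0.
have h3 := cvge0_lt (Mcvg t tT) e0.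
have [N _ hN] := filterI h1 (filterI h2 h3).
have [h1N [h2N h3N]] := hN N (leqnn N).
by exists (S N); split; [exact: hS|exact: h1N|exact: h2N|exact: h3N].
Qed.

Lemma sqr_coord_le_enorm (v : 'cV[R]_d) i : v i 0 ^+ 2 <= enorm v ^+ 2.
Proof.
rewrite sqr_enorm_cV (bigD1 i)//= lerDl sumr_ge0// => k _; exact: sqr_ge0.
Qed.

Let approx_coord S M t i (e : R) : simple F T S -> 0 <= t ->
  measurable_fun setT (fun w => M t w i 0) ->
  (\int[P]_w (enorm (sp_integral B S t w - M t w) ^+ 2)%:E < e%:E)%E ->
  L2 (fun w => M t w i 0 - sp_integral B S t w i 0) /\
  (\int[P]_w ((M t w i 0 - sp_integral B S t w i 0) ^+ 2)%:E < e%:E)%E.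
Proof.
move=> hS t0 mM he.
have lt : (\int[P]_w ((M t w i 0 - sp_integral B S t w i 0) ^+ 2)%:E < e%:E)%E.
  apply: le_lt_trans he; apply: ge0_le_lower_integral => w _; rewrite lee_fin ?sqr_ge0//.
  rewrite enorm_distC (le_trans _ (sqr_coord_le_enorm _ i))//.
  by rewrite !mxE.
split => //; split; last exact: lt_trans lt (ltry _).
apply: measurable_funB => //.
by have [] := square_integrable_sp_integral hF hB i hS t0.
Qed.

Lemma ito_square_integrable H M t i : ito_integral P F B T H M -> 0 <= t <= T ->
  L2 (fun w => M t w i 0).
Proof.
move=> hM tT; have /andP[t0 _] := tT.
have [S [hS _ _ hS3]] := ito_approx hM ltr01 tT tT.
have mM : measurable_fun setT (fun w => M t w i 0).
  by apply: (F_measurable_measurable hF t0); exact: ito_coord_F_measurable hM tT.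
have [L2d _] := approx_coord hS t0 mM hS3.
have := square_integrableD L2d (square_integrable_sp_integral hF hB i hS t0).
by under eq_fun do rewrite subrK.
Qed.

(** Simple integrals have the property exactly, so only approximation errors remain: [x] is the mean
    of [u], the difference of the errors at [t] and [s] restricted to [A], and Cauchy-Schwarz bounds
    [x ^ 2] by [2 (e + e)] for every positive [e]. *)
Lemma ito_martingale H M s t i A : ito_integral P F B T H M ->
  0 <= s -> s <= t -> t <= T -> F s A ->
  E (fun w => \1_A w * (M t w i 0 - M s w i 0)) = 0.
Proof.
move=> hM s0 st tT FA; have t0 := le_trans s0 st.
have sT' : 0 <= s <= T by rewrite s0 (le_trans st).
have tT' : 0 <= t <= T by rewrite t0.
have mA : measurable A by exact: (filtration_measurable hF s0).
have A1 w : `|\1_A w : R| <= 1 by rewrite indicE; case: (_ \in _); rewrite ?normr1 ?normr0.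
set x := E _; suff : forall e : R, 0 < e -> x ^+ 2 <= 4 * e.
  move=> H0; apply/eqP; rewrite -sqrf_eq0 eq_le sqr_ge0 andbT.
  by apply/ler_addgt0Pr => e e0; rewrite add0r (le_trans (H0 (e / 4) _)) ?divr_gt0//; lra.
move=> e e0; have [S [hS _ hs ht]] := ito_approx hM e0 sT' tT'.
have mMs : measurable_fun setT (fun w => M s w i 0).
  by apply: (F_measurable_measurable hF s0); exact: ito_coord_F_measurable hM sT'.
have mMt : measurable_fun setT (fun w => M t w i 0).
  by apply: (F_measurable_measurable hF t0); exact: ito_coord_F_measurable hM tT'.
have [L2s es] := approx_coord hS s0 mMs hs; have [L2t et] := approx_coord hS t0 mMt ht.
pose u w := \1_A w * ((M t w i 0 - sp_integral B S t w i 0) - (M s w i 0 - sp_integral B S s w i 0)).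
have L2u : L2 u.
  by apply: (bounded_square_integrableM (measurable_indic mA) A1); exact: square_integrableB.
have L2I : L2 (fun w => \1_A w * (sp_integral B S t w i 0 - sp_integral B S s w i 0)).
  apply: (bounded_square_integrableM (measurable_indic mA) A1).
  by apply: square_integrableB; exact: (square_integrable_sp_integral hF hB i hS).
have xE : x = E u.
  rewrite -[RHS]addr0 -(sp_integral_martingale hF hB i hS s0 st FA) -RintegralD//; last 2 first.
  - exact: square_integrable_integrable.
  - exact: square_integrable_integrable.
  by congr E; apply/funext => w; rewrite /u /=; ring.
have [_ iu2] := (square_integrableP _ _).1 L2u.
have [_ is2] := (square_integrableP _ _).1 L2s.
have [_ it2] := (square_integrableP _ _).1 L2t.
have := Rintegral_sqr_le measurableT (probability_setT P) (square_integrable_integrable L2u) iu2.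
rewrite xE mul1r => /le_trans; apply.
have i2 : P.-integrable setT (EFin \o (fun w => 2 * ((M t w i 0 - sp_integral B S t w i 0) ^+ 2 + (M s w i 0 - sp_integral B S s w i 0) ^+ 2))).
  have := integrableZl measurableT 2 (integrableD measurableT it2 is2); exact: eq_integrable.
apply: (@le_trans _ _ (E (fun w => 2 * ((M t w i 0 - sp_integral B S t w i 0) ^+ 2 + (M s w i 0 - sp_integral B S s w i 0) ^+ 2)))).
  apply: le_RintegralR => // w _; rewrite /u exprMn indicE.
  set p := M t w i 0 - _; set q := M s w i 0 - _.
  have h : (p - q) ^+ 2 <= 2 * (p ^+ 2 + q ^+ 2).
    by have := sqr_ge0 (p + q); rewrite sqrrB sqrrD; lra.
  case: (_ \in _); first by rewrite expr1n mul1r.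
  by rewrite expr0n mul0r (le_trans _ h)// sqr_ge0.
rewrite RintegralZl//; last first.
  by have := integrableD measurableT it2 is2; exact: eq_integrable.
rewrite RintegralD//.
have ht' : E (fun w => (M t w i 0 - sp_integral B S t w i 0) ^+ 2) <= e.
  by rewrite -lee_fin (EFin_Rintegral measurableT it2); exact: ltW et.
have hs' : E (fun w => (M s w i 0 - sp_integral B S s w i 0) ^+ 2) <= e.
  by rewrite -lee_fin (EFin_Rintegral measurableT is2); exact: ltW es.
rewrite (_ : 4 * e = 2 * (e + e)); last by ring.
by rewrite ler_pM2l//; exact: lerD ht' hs'.
Qed.

(** The isometry for two approximating simple processes is combined with two three-term splittings,
    one for the integrals and one for the integrands, each of which costs a factor 3. The constant
    depends neither on the integrands nor on [t]. *)
Lemma ito_dist_le : exists2 c : R, 0 <= c & forall H M H' M' t,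
  ito_integral P F B T H M -> ito_integral P F B T H' M' -> 0 <= t <= T ->
  (\int[P]_w (enorm (M t w - M' t w) ^+ 2)%:E <=
   c%:E * time_space_integral P t (fun z => (enorm (time_patch H z.1 z.2 - time_patch H' z.1 z.2) ^+ 2)%R))%E.
Proof.
have [c c0 iso] := sp_integral_isometry hF hB.
exists (9 * c); first by rewrite mulr_ge0.
move=> H M H' M' t hM hM' tT; have /andP[t0 tT'] := tT.
set Q := time_space_integral _ _ _.
have Q0 : (0 <= Q)%E by apply: time_space_integral_ge0 => z; exact: sqr_ge0.
apply/lee_addgt0Pr => e e0.
pose e' := e / (18 * c + 6).
have K0 : 0 < 18 * c + 6 by lra.
have e'0 : 0 < e' by rewrite divr_gt0.
have [S [hS dS _ iS]] := ito_approx hM e'0 tT tT.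
have [S' [hS' dS' _ iS']] := ito_approx hM' e'0 tT tT.
have [L2I isoE] := iso T S S' t hS hS' t0.
have mMc H0 M0 i : ito_integral P F B T H0 M0 -> measurable_fun setT (fun w => M0 t w i 0).
  by move=> h; apply: (F_measurable_measurable hF t0); exact: ito_coord_F_measurable h tT.
have mIc S0 i : simple F T S0 -> measurable_fun setT (fun w => sp_integral B S0 t w i 0).
  by move=> h; have [] := square_integrable_sp_integral hF hB i h t0.
have mde (X Y : Omega -> 'cV[R]_d) : (forall i, measurable_fun setT (fun w => X w i 0)) ->
   (forall i, measurable_fun setT (fun w => Y w i 0)) -> measurable_fun setT (fun w => (enorm (X w - Y w) ^+ 2)%:E).
  move=> mX mY; apply/measurable_EFinP; apply: measurable_funX; apply: measurable_enorm => i j.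
  by under eq_fun do rewrite !mxE; rewrite (ord1 j); exact: measurable_funB.
have mII : measurable_fun setT (fun w => (enorm (sp_integral B S t w - sp_integral B S' t w) ^+ 2)%:E).
  by apply: mde => i; exact: mIc.
have mIM : measurable_fun setT (fun w => (enorm (sp_integral B S t w - M t w) ^+ 2)%:E).
  by apply: mde => i; [exact: mIc|exact: mMc hM].
have mIM' : measurable_fun setT (fun w => (enorm (sp_integral B S' t w - M' t w) ^+ 2)%:E).
  by apply: mde => i; [exact: mIc|exact: mMc hM'].
have step1 : (\int[P]_w (enorm (M t w - M' t w) ^+ 2)%:E <=
   3%:E * (\int[P]_w (enorm (sp_integral B S t w - sp_integral B S' t w) ^+ 2)%:E +
     \int[P]_w (enorm (sp_integral B S t w - M t w) ^+ 2)%:E +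
     \int[P]_w (enorm (sp_integral B S' t w - M' t w) ^+ 2)%:E))%E.
  pose f1 w := (enorm (sp_integral B S t w - sp_integral B S' t w) ^+ 2)%:E.
  pose f2 w := (enorm (sp_integral B S t w - M t w) ^+ 2)%:E.
  pose f3 w := (enorm (sp_integral B S' t w - M' t w) ^+ 2)%:E.
  have f10 w : (0 <= f1 w)%E by rewrite lee_fin sqr_ge0.
  have f20 w : (0 <= f2 w)%E by rewrite lee_fin sqr_ge0.
  have f30 w : (0 <= f3 w)%E by rewrite lee_fin sqr_ge0.
  have f120 w : (0 <= f1 w + f2 w)%E by rewrite adde_ge0.
  have m12 : measurable_fun setT (fun w => f1 w + f2 w)%E by exact: emeasurable_funD.
  rewrite [leRHS](_ : _ = \int[P]_w (3%:E * (f1 w + f2 w + f3 w)))%E; last first.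
    rewrite ge0_integralZl_EFin//; last 2 first.
    - by move=> w _; rewrite adde_ge0.
    - exact: emeasurable_funD.
    congr (_ * _)%E.
    rewrite (ge0_integralD P measurableT (fun w _ => f120 w) m12 (fun w _ => f30 w) mIM').
    by rewrite (ge0_integralD P measurableT (fun w _ => f10 w) mII (fun w _ => f20 w) mIM).
  apply: ge0_le_lower_integral => w _; first by rewrite lee_fin sqr_ge0.
  rewrite /f1 /f2 /f3 -!EFinD -EFinM lee_fin.
  have := sqr_enormD3 (sp_integral B S t w - sp_integral B S' t w) (M t w - sp_integral B S t w) (sp_integral B S' t w - M' t w).
  rewrite (enorm_distC (M t w)).
  rewrite (_ : _ - _ + _ + _ = M t w - M' t w)//.
  by apply/matrixP => a b; rewrite !mxE; ring.
pose V (z : R * Omega) := sp_val S z.1 z.2; pose V' (z : R * Omega) := sp_val S' z.1 z.2.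
pose G (z : R * Omega) := time_patch H z.1 z.2; pose G' (z : R * Omega) := time_patch H' z.1 z.2.
have mV i j : measurable_fun setT (fun z => V z i j) by exact: (measurable_sp_val hF i j hS).
have mV' i j : measurable_fun setT (fun z => V' z i j) by exact: (measurable_sp_val hF i j hS').
have mG i j : measurable_fun setT (fun z => G z i j) by apply: measurable_time_patch; case: hM.
have mG' i j : measurable_fun setT (fun z => G' z i j) by apply: measurable_time_patch; case: hM'.
have mGG := measurable_sqr_dist mG mG'.
have mGV := measurable_sqr_dist mG mV.
have mGV' := measurable_sqr_dist mG' mV'.
have s0 (X : R * Omega -> 'M[R]_d) z : 0 <= enorm (X z) ^+ 2 by exact: sqr_ge0.
have step2 : (\int[P]_w \int[leb]_(s in `[0%R, t])
      (enorm (sp_val S s w - sp_val S' s w) ^+ 2)%:E <=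
   3%:E * (Q + integrand_dist2 P T H (sp_val S) + integrand_dist2 P T H' (sp_val S')))%E.
  rewrite !integrand_dist2E.
  have bnd z : enorm (V z - V' z) ^+ 2 <=
      3 * (enorm (G z - G' z) ^+ 2 + enorm (G z - V z) ^+ 2 + enorm (G' z - V' z) ^+ 2).
    have := sqr_enormD3 (G z - G' z) (V z - G z) (G' z - V' z).
    rewrite (enorm_distC (V z)) (_ : _ - _ + _ + _ = V z - V' z)//.
    by apply/matrixP => a b; rewrite !mxE; ring.
  have H3 := time_space_integral_le3 P t (s0 (fun z => V z - V' z)) (s0 (fun z => G z - G' z))
    (s0 (fun z => G z - V z)) (s0 (fun z => G' z - V' z)) mGG mGV mGV' bnd.
  apply: le_trans H3 _.
  apply: lee_wpmul2l; first by rewrite lee_fin.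
  apply: leeD; [apply: leeD; first exact: lexx|].
    exact: (time_space_integral_subset P tT' (s0 (fun z => G z - V z)) mGV).
  exact: (time_space_integral_subset P tT' (s0 (fun z => G' z - V' z)) mGV').
exact: (ereal_approx_bound c0 K0 e'0 Q0 step1 isoE step2 iS iS' dS dS').
Qed.

End ito_integral_theory.

(** * Comparison of two solutions *)

Section gronwall.
Context {R : realType}.
Local Notation leb := (@lebesgue_measure R).

Lemma integral_expR_le (k t : R) : 0 < k -> 0 <= t ->
  (\int[leb]_(s in `[0%R, t]) (expR (k * s))%:E <= ((expR (k * t) - 1) / k)%:E)%E.
Proof.
move=> k0; rewrite le_eqVlt => /predU1P[<-|t0].
  by rewrite set_itv1 integral_set1 mulr0 expR0 subrr mul0r.
pose G (s : R) : R := k^-1 * expR (k * s).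
have dl (c s : R) : is_derive s (1 : R) (fun x : R => c * x) c.
  by have := is_deriveZ c (is_derive_id s (1 : R)); rewrite /GRing.scale /= mulr1.
have dG (s : R) : is_derive s (1 : R) G (expR (k * s)).
  have H := @is_derive1_comp _ (fun x => k^-1 * x) (fun x => expR (k * x)) s _ _ (dl k^-1 (expR (k * s)))
    (@is_derive1_comp _ expR (fun x => k * x) s _ _ (is_derive_expR (k * s)) (dl k s)).
  rewrite (_ : expR (k * s) = k^-1 * (expR (k * s) * k)); first exact: H.
  by field; rewrite gt_eqF.
have cG : continuous G.
  move=> s; apply: differentiable_continuous; apply/derivable1_diffP.
  by have [] := dG s.
have cexp : continuous (fun s : R => expR (k * s)).
  move=> s; apply: (@continuous_comp _ _ _ (fun s : R => k * s) expR); first exact: mulrl_continuous.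
  exact: continuous_expR.
rewrite (@continuous_FTC2 _ _ G)//.
- rewrite /G mulr0 expR0 mulr1 -EFinB lee_fin le_eqVlt; apply/orP; left; apply/eqP.
  by field; rewrite gt_eqF.
- by apply: continuous_subspaceT.
- split.
  + by move=> s _; have [] := dG s.
  + by apply: cvg_at_right_filter; exact: cG.
  + by apply: cvg_at_left_filter; exact: cG.
- by move=> s _; rewrite derive1E; have [_] := dG s.
Qed.

(* The weight e^(-2kt) absorbs half of the integral term. *)
Lemma gronwall (T a k K : R) (f : R -> R) : 0 <= T -> 0 <= a -> 0 < k ->
  (forall t, 0 <= t <= T -> 0 <= f t <= K) ->
  (forall t, 0 <= t <= T ->
     ((f t)%:E <= a%:E + k%:E * \int[leb]_(s in `[0%R, t]) (f s)%:E)%E) ->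
  forall t, 0 <= t <= T -> f t <= 2 * a * expR (2 * k * T).
Proof.
move=> T0 a0 k0 fK hf.
pose A := [set x : R | exists2 t, 0 <= t <= T & x = expR (- (2 * k * t)) * f t].
have A0 : A !=set0 by exists (expR (- (2 * k * 0)) * f 0), 0 => //; rewrite lexx.
have ubA : has_ubound A.
  exists K => _ [t tT ->]; have /andP[ft fK'] := fK t tT.
  rewrite (le_trans _ fK')// ler_piMl// -[leRHS]expR0 ler_expR oppr_le0.
  by case/andP: tT => t0 _; rewrite !mulr_ge0// ltW.
(* The a priori bound [K] makes this a finite least upper bound; otherwise [m <= a + m / 2] would
   say nothing. *)
set m := sup A.
have fm t : 0 <= t <= T -> f t <= m * expR (2 * k * t).
  move=> tT; rewrite -ler_pdivrMr ?expR_gt0// -expRN mulrC.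
  by apply: ub_le_sup => //; exists t.
have m0 : 0 <= m.
  have := fm 0; rewrite lexx T0 mulr0 expR0 mulr1 => /(_ isT); apply: le_trans.
  by have := fK 0; rewrite lexx T0 => /(_ isT) /andP[].
have k20 : 0 < 2 * k by rewrite mulr_gt0.
(* Inserting [f s <= m e^(2ks)] bounds the integral term by [m / 2] times [e^(2kt) - 1]; division by
   [e^(2kt) >= 1] leaves at most [a + m / 2]. *)
have m2a : m <= a + m / 2.
  apply: ge_sup => // _ [t tT ->]; have /andP[t0 tT'] := tT.
  have h : f t <= a + k * (m * ((expR (2 * k * t) - 1) / (2 * k))).
    rewrite -lee_fin (le_trans (hf t tT))// EFinD leeD2l// EFinM.
    apply: lee_wpmul2l; first by rewrite lee_fin ltW.
    apply: (@le_trans _ _ (\int[leb]_(s in `[0%R, t]) (m%:E * (expR (2 * k * s))%:E))%E).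
      apply: ge0_le_lower_integral => s /=; rewrite in_itv/= => /andP[s0 st].
        by have := fK s; rewrite lee_fin s0 (le_trans st)// => /(_ isT) /andP[].
      by rewrite -EFinM lee_fin fm// s0 (le_trans st).
    rewrite ge0_integralZl_EFin//; last first.
      apply/measurable_EFinP/measurable_funTS; apply: measurableT_comp => //.
    by rewrite EFinM lee_wpmul2l ?lee_fin// integral_expR_le.
  rewrite expRN mulrC ler_pdivrMr ?expR_gt0// (le_trans h)//.
  have -> : k * (m * ((expR (2 * k * t) - 1) / (2 * k))) = m / 2 * (expR (2 * k * t) - 1).
    by field; rewrite gt_eqF.
  have e1 : 1 <= expR (2 * k * t).
    by rewrite -[leLHS]expR0 ler_expR mulr_ge0// ltW.
  have h1 : a <= a * expR (2 * k * t) by rewrite ler_peMr.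
  move: h1 m0; move: (expR _) => e; lra.
move=> t tT; have /andP[t0 tT'] := tT.
apply: le_trans (fm t tT) _.
apply: ler_pM => //.
  by move: m2a; lra.
by rewrite ler_expR ler_wpM2l// ltW.
Qed.

End gronwall.

Section wasserstein_bound.
Context {R : realType} {disp : measure_display} {Omega : measurableType disp}.
Variable P : probability Omega R.
Context {d : nat}.

Lemma W2_le (mu nu : P2 R d) (X Y : Omega -> 'cV[R]_d) :
  measurable_fun setT (X : Omega -> borelV R d) ->
  measurable_fun setT (Y : Omega -> borelV R d) ->
  has_law P X mu -> has_law P Y nu ->
  (W2 mu nu <= (\int[P]_w (enorm (X w - Y w) ^+ 2)%:E) `^ 2^-1)%E.
Proof.
move=> mX mY lX lY.
pose Z w : borelV R d * borelV R d := (X w, Y w).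
have mZ : Z \in mfun by rewrite inE/=; exact: measurable_fun_pair.
pose pi := distribution P (mfun_Sub mZ).
have coord i : measurable_fun setT ((fun v : 'cV[R]_d => v i 0) : borelV R d -> R).
  by apply: measurable_continuous; exact: coord_continuous.
apply: ereal_inf_lbound; exists pi.
  move=> A mA; split.
    by rewrite lX// /pi /distribution /pushforward; congr (P _); apply/seteqP; split => w //= -[].
  by rewrite lY// /pi /distribution /pushforward; congr (P _); apply/seteqP; split => w //= -[].
congr (_ `^ _)%E; rewrite /pi ge0_integral_distribution//; last first.
  by move=> z; rewrite lee_fin sqr_ge0.
apply/measurable_EFinP; apply: measurable_funX.
apply: (@measurable_enorm R d 1) => i j.
rewrite (ord1 j) (_ : (fun z => _) = (fun z : borelV R d * borelV R d =>
    (fun v : 'cV[R]_d => v i 0) z.1 - (fun v : 'cV[R]_d => v i 0) z.2)); last first.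
  by apply/funext => z; rewrite !mxE.
apply: measurable_funB.
  exact: (measurableT_comp (coord i) measurable_fst).
exact: (measurableT_comp (coord i) measurable_snd).
Qed.

End wasserstein_bound.

Section sup_process.
Context {R : realType} {disp : measure_display} {Omega : measurableType disp}.
Variables (T : R) (f : R -> Omega -> R).
Hypotheses (T0 : 0 < T) (cf : forall w, {within `[0, T], continuous (fun t => f t w)}).
Hypothesis mf : forall t, 0 <= t <= T -> measurable_fun setT (f t).
Hypothesis f0 : forall t w, 0 <= f t w.

Lemma measurable_sup_process :
  measurable_fun setT (fun w => ereal_sup [set (f t w)%:E | t in `[0%R, T]]).
Proof.
pose u n w := (\big[Num.max/0]_(k < n.+2) f (grid T n k) w)%:E.
apply: (@emeasurable_fun_cvg _ _ _ _ u) => [n|w _]; last first.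
  by apply: (cvg_max_grid T0 (@cf w)) => t _.
apply/measurable_EFinP; apply: measurable_bigmax => k; apply: mf.
by rewrite grid_itv// -ltnS.
Qed.

Lemma sup_process_ge0 w : (0 <= ereal_sup [set (f t w)%:E | t in `[0%R, T]])%E.
Proof.
apply: (@le_trans _ _ (f 0 w)%:E); first by rewrite lee_fin.
by apply: ereal_sup_ubound; exists 0 => //=; rewrite in_itv/= lexx ltW.
Qed.

Lemma sup_process_ge t w : 0 <= t <= T ->
  ((f t w)%:E <= ereal_sup [set (f t w)%:E | t in `[0%R, T]])%E.
Proof. by move=> tT; apply: ereal_sup_ubound; exists t => //=; rewrite in_itv. Qed.

End sup_process.

Section continuous_adapted.
Context {R : realType} {disp : measure_display} {Omega : measurableType disp}.
Variables (P : probability Omega R) (F : R -> set (set Omega)).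
Hypothesis hF : usual_filtration P F.
Context {d : nat}.
Variables (T : R) (X : R -> Omega -> 'cV[R]_d).
Hypotheses (T0 : 0 < T) (aX : adapted F `[0, T] X).
Hypothesis cX : forall w, {within `[0, T], continuous (fun t => X t w)}.

Lemma adapted_measurable_coord t i : 0 <= t <= T -> measurable_fun setT (fun w => X t w i 0).
Proof.
move=> tT; have /andP[t0 _] := tT; apply: (F_measurable_measurable hF t0).
by apply: F_measurable_coord; apply: aX; rewrite /= in_itv.
Qed.

Lemma adapted_measurable_borel t : 0 <= t <= T -> measurable_fun setT (X t : Omega -> borelV R d).
Proof.
move=> tT _ V mV; have /andP[t0 _] := tT; apply: (filtration_measurable hF t0).
by apply: (aX _ mV); rewrite /= in_itv.
Qed.

Lemma continuous_coord_process i w : {within `[0, T], continuous (fun t => X t w i 0)}.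
Proof.
apply: (@within_continuous_comp _ _ _ _ _ (fun v : 'cV[R]_d => v i 0)) => [v _|].
  exact: coord_continuous.
exact: cX.
Qed.

Lemma continuous_sqr_enorm_process w : {within `[0, T], continuous (fun t => enorm (X t w) ^+ 2)}.
Proof.
apply: (@within_continuous_comp _ _ _ _ _ (fun v : 'cV[R]_d => enorm v ^+ 2)) => [v _|].
  apply: (@continuous_comp _ _ _ (@enorm R d 1) (fun a : R => a ^+ 2)).
    exact: continuous_enorm.
  exact: exprn_continuous.
exact: cX.
Qed.

Lemma measurable_clip_process i : measurable_fun setT (fun z : R * Omega => X (clip T z.1) z.2 i 0).
Proof.
apply: (measurable_continuous_process T0 (X := fun t w => X t w i 0)).
  by move=> w; exact: continuous_coord_process.
by move=> t; exact: adapted_measurable_coord.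
Qed.

Lemma measurable_sqr_enorm_process t : 0 <= t <= T ->
  measurable_fun setT (fun w => enorm (X t w) ^+ 2).
Proof.
move=> tT; apply: measurable_funX; apply: measurable_enorm => i j.
by rewrite (ord1 j); exact: adapted_measurable_coord.
Qed.

Lemma measurable_sup_sqr_enorm :
  measurable_fun setT (fun w => ereal_sup [set (enorm (X t w) ^+ 2)%:E | t in `[0%R, T]]).
Proof.
apply: (measurable_sup_process (f := fun t w => enorm (X t w) ^+ 2) T0).
- exact: continuous_sqr_enorm_process.
- exact: measurable_sqr_enorm_process.
- by move=> t w; exact: sqr_ge0.
Qed.

Lemma enorm_process_bounded w : exists K : R, forall t, 0 <= t <= T -> enorm (X t w) <= K.
Proof.
have [c _ hc] := EVT_max (ltW T0) (@continuous_sqr_enorm_process w).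
exists (enorm (X c w)) => t tT.
rewrite -(ler_pXn2r (n := 2))// ?nnegrE ?enorm_ge0//.
by apply: hc; rewrite in_itv.
Qed.

End continuous_adapted.

Lemma ereal_sup_sqr_enorm_lty {R : realType} {disp : measure_display} {Omega : measurableType disp}
    (P : probability Omega R) (d : nat) (T : R) (X : R -> Omega -> 'cV[R]_d) :
  (L2C_norm P T X < +oo)%E ->
  (\int[P]_w ereal_sup [set (enorm (X t w) ^+ 2)%:E | t in `[0%R, T]] < +oo)%E.
Proof. by apply: lty_poweRy; rewrite invr_eq0 pnatr_eq0. Qed.

Lemma continuous_within_sub {R : realType} {d : nat} (A : set R) (X Y : R -> 'cV[R]_d) :
  {within A, continuous X} -> {within A, continuous Y} ->
  {within A, continuous (fun t => X t - Y t)}.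
Proof. by move=> cX cY t; apply: cvgB; [exact: cX|exact: cY]. Qed.

Section ito_difference.
Context {R : realType} {disp : measure_display} {Omega : measurableType disp}.
Variables (P : probability Omega R) (F : R -> set (set Omega)).
Context {d : nat}.
Variable B : R -> Omega -> 'cV[R]_d.
Hypotheses (hF : usual_filtration P F) (hB : brownian_motion P F B).
Variables (T : R) (H H' : R -> Omega -> 'M[R]_d) (M M' : R -> Omega -> 'cV[R]_d).
Hypotheses (T0 : 0 < T) (iM : ito_integral P F B T H M) (iM' : ito_integral P F B T H' M').
Let N i t w := M t w i 0 - M' t w i 0.

Lemma ito_difference_square_integrable t i : 0 <= t <= T -> square_integrable P (N i t).
Proof.
move=> tT; apply: square_integrableB.
  exact: (ito_square_integrable hF hB i iM tT).
exact: (ito_square_integrable hF hB i iM' tT).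
Qed.

Lemma continuous_ito_difference w : {within `[0, T], continuous (fun t => M t w - M' t w)}.
Proof.
have [_ _ _ cM _] := iM; have [_ _ _ cM' _] := iM'.
exact: continuous_within_sub.
Qed.

Let cN i w : {within `[0, T], continuous (fun t => N i t w)}.
Proof.
have [_ _ _ cM _] := iM; have [_ _ _ cM' _] := iM'.
move=> t; apply: cvgB; [exact: (continuous_coord_process cM)|exact: (continuous_coord_process cM')].
Qed.

Let doob_coord i :
  (\int[P]_w ereal_sup [set (N i t w ^+ 2)%:E | t in `[0%R, T]] <=
   4%:E * \int[P]_w (N i T w ^+ 2)%:E)%E.
Proof.
apply: (doob_sup hF T0) => [t tT|t tT|s t A s0 st tT FA|w].
- exact: ito_difference_square_integrable.
- by apply: measurable_funB; [exact: ito_coord_F_measurable iM tT|exact: ito_coord_F_measurable iM' tT].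
- have sT : 0 <= s <= T by rewrite s0 (le_trans st).
  have t0 := le_trans s0 st.
  have tT' : 0 <= t <= T by rewrite t0.
  have e1 := ito_martingale hF hB i iM s0 st tT FA.
  have e2 := ito_martingale hF hB i iM' s0 st tT FA.
  have mA : measurable A by exact: (filtration_measurable hF s0).
  have A1 w : `|\1_A w : R| <= 1 by rewrite indicE; case: (_ \in _); rewrite ?normr1 ?normr0.
  have int (K Y : R -> Omega -> _) : ito_integral P F B T K Y ->
      P.-integrable setT (EFin \o (fun w => \1_A w * (Y t w i 0 - Y s w i 0))).
    move=> iY; apply: (bounded_integrableM _ A1); first exact: measurable_indic.
    apply: square_integrable_integrable; apply: square_integrableB.
      exact: (ito_square_integrable hF hB i iY tT').
    exact: (ito_square_integrable hF hB i iY sT).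
  rewrite -[RHS](subrr 0) -[X in _ = X - _]e1 -[X in _ = _ - X]e2.
  rewrite -RintegralB; [|exact: measurableT|exact: int iM|exact: int iM'].
  by apply: eq_Rintegral => w _; rewrite /N; ring.
- exact: cN.
Qed.

(** The scalar inequality is applied to each coordinate. The supremum of the sum of squares is at
    most the sum of the suprema, and the right-hand sides add up to the Euclidean norm, so the
    constant stays 4 in every dimension. *)
Lemma ito_difference_doob :
  (\int[P]_w ereal_sup [set (enorm (M t w - M' t w) ^+ 2)%:E | t in `[0%R, T]] <=
   4%:E * \int[P]_w (enorm (M T w - M' T w) ^+ 2)%:E)%E.
Proof.
pose s i w := ereal_sup [set (N i t w ^+ 2)%:E | t in `[0%R, T]].
have mN t i : 0 <= t <= T -> measurable_fun setT (fun w => N i t w ^+ 2).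
  by move=> tT; apply: measurable_funX; have [] := ito_difference_square_integrable i tT.
have TT : 0 <= T <= T by rewrite lexx ltW.
have ms i : measurable_fun setT (s i).
  apply: (measurable_sup_process (f := fun t w => N i t w ^+ 2) T0).
  - move=> w; apply: (@within_continuous_comp _ _ _ _ _ (fun a : R => a ^+ 2)) => [a _|].
      exact: exprn_continuous.
    exact: cN.
  - by move=> t; exact: mN.
  - by move=> t w; exact: sqr_ge0.
have s0 i w : (0 <= s i w)%E.
  by apply: (sup_process_ge0 (f := fun t w => N i t w ^+ 2) T0) => t v; exact: sqr_ge0.
have NE t w : enorm (M t w - M' t w) ^+ 2 = \sum_i N i t w ^+ 2.
  by rewrite sqr_enorm_cV; apply: eq_bigr => i _; rewrite !mxE.
apply: (@le_trans _ _ (\int[P]_w \sum_i s i w)%E).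
  apply: ge0_le_lower_integral => w _.
    apply: (sup_process_ge0 (f := fun t w => enorm (M t w - M' t w) ^+ 2) T0).
    by move=> t v; exact: sqr_ge0.
  apply: ub_ereal_sup => _ [t /= + <-]; rewrite in_itv/= => tT.
  rewrite NE -sumEFin; apply: lee_sum => i _.
  exact: (sup_process_ge (fun t w => N i t w ^+ 2)).
rewrite (ge0_integral_sum P measurableT ms (fun i w _ => s0 i w)).
apply: (le_trans (lee_sum _ (fun i _ => doob_coord i))).
rewrite -ge0_sume_distrr => [|i _]; last by apply: integral_ge0 => w _; rewrite lee_fin sqr_ge0.
apply: lee_wpmul2l; first by rewrite lee_fin.
have mNE i : measurable_fun setT (fun w => (N i T w ^+ 2)%:E) by apply/measurable_EFinP; exact: mN.
have NE0 i w : setT w -> (0 <= (N i T w ^+ 2)%:E)%E by rewrite lee_fin sqr_ge0.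
rewrite -(ge0_integral_sum P measurableT mNE NE0).
by under [leRHS]eq_integral => w _ do rewrite NE -sumEFin.
Qed.

End ito_difference.

(* k is the constant of Gronwall's lemma; c is that of the Ito isometry
   [ito_dist_le]. *)
Definition stability_constant {R : realType} (d : nat) (T L c : R) : R :=
  let k := 3 * ((4 * T * d%:R + c) * (4 * L ^+ 2)) + 1 in
  3 * (1 + (4 * T * d%:R + 4 * c) * (4 * L ^+ 2) * (6 * expR (2 * k * T) * T)).

(** * The mean-square estimate for two solutions *)

Section two_solutions.
Context {R : realType} {disp : measure_display} {Omega : measurableType disp}.
Variables (P : probability Omega R) (F : R -> set (set Omega)).
Context {d : nat}.
Variable B : R -> Omega -> 'cV[R]_d.
Hypotheses (hF : usual_filtration P F) (hB : brownian_motion P F B).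
Variable T : R.
Hypothesis T0 : 0 < T.
Variables (b : R -> 'cV[R]_d -> P2 R d -> 'cV[R]_d) (sigma : R -> 'cV[R]_d -> P2 R d -> 'M[R]_d).
Variables (C L : R).
Hypotheses (C0 : 0 < C) (L0 : 0 < L).
Hypothesis growth : forall (t : R) (x : 'cV[R]_d) (mu : P2 R d), 0 <= t <= T ->
  enorm (b t x mu) + enorm (sigma t x mu) <= C * (1 + enorm x).
Hypothesis lipschitz : forall (t : R) (x x' : 'cV[R]_d) (mu mu' : P2 R d), 0 <= t <= T ->
  ((enorm (b t x mu - b t x' mu'))%:E <= L%:E * ((enorm (x - x'))%:E + W2 mu mu'))%E /\
  ((enorm (sigma t x mu - sigma t x' mu'))%:E <= L%:E * ((enorm (x - x'))%:E + W2 mu mu'))%E.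
Local Notation leb := (@lebesgue_measure R).

Variables (x x' : 'cV[R]_d) (X X' : R -> Omega -> 'cV[R]_d).
Variables (mu mu' : R -> P2 R d) (M M' : R -> Omega -> 'cV[R]_d).
Hypotheses (aX : adapted F `[0, T] X) (aX' : adapted F `[0, T] X').
Hypotheses (cX : forall w, {within `[0, T], continuous (fun t => X t w)})
  (cX' : forall w, {within `[0, T], continuous (fun t => X' t w)}).
Hypotheses (nX : (L2C_norm P T X < +oo)%E) (nX' : (L2C_norm P T X' < +oo)%E).
Hypotheses (lX : forall t : R, 0 <= t <= T -> has_law P (X t) (mu t))
  (lX' : forall t : R, 0 <= t <= T -> has_law P (X' t) (mu' t)).
Hypotheses (iM : ito_integral P F B T (fun t w => sigma t (X t w) (mu t)) M)
  (iM' : ito_integral P F B T (fun t w => sigma t (X' t w) (mu' t)) M').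
Local Notation drift t w :=
  (vec_integral t (fun s => b s (X s w) (mu s)) - vec_integral t (fun s => b s (X' s w) (mu' s))).
Hypothesis eqD : {ae P, forall w, forall t : R, 0 <= t <= T ->
  X t w - X' t w = (x - x') + drift t w + (M t w - M' t w)}.

Let D t w := X t w - X' t w.
Let Dc (z : R * Omega) := D (clip T z.1) z.2.
Let supD w := ereal_sup [set (enorm (D t w) ^+ 2)%:E | t in `[0%R, T]].

Let cD w : {within `[0, T], continuous (fun t => D t w)}.
Proof. exact: continuous_within_sub. Qed.

Let mD t i : 0 <= t <= T -> measurable_fun setT (fun w => D t w i 0).
Proof.
move=> tT; under eq_fun do rewrite !mxE.
by apply: measurable_funB; apply: (adapted_measurable_coord hF _ _ tT).
Qed.

Let measurable_supD : measurable_fun setT supD.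
Proof.
apply: (measurable_sup_process (f := fun t w => enorm (D t w) ^+ 2) T0).
- by move=> w; exact: continuous_sqr_enorm_process.
- move=> t tT; apply: measurable_funX; apply: measurable_enorm => i j.
  by rewrite (ord1 j); exact: mD.
- by move=> t w; exact: sqr_ge0.
Qed.

Let sup0 (Y : R -> Omega -> 'cV[R]_d) w :
  (0 <= ereal_sup [set (enorm (Y t w) ^+ 2)%:E | t in `[0%R, T]])%E.
Proof. by apply: (sup_process_ge0 (f := fun t w => enorm (Y t w) ^+ 2) T0) => t v; exact: sqr_ge0. Qed.

(** This finiteness makes [phir] faithful to [phi] and provides the bound [K0] that enters
    [gronwall]. *)
Let supD_lty : (\int[P]_w supD w < +oo)%E.
Proof.
pose sX w := ereal_sup [set (enorm (X t w) ^+ 2)%:E | t in `[0%R, T]].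
pose sX' w := ereal_sup [set (enorm (X' t w) ^+ 2)%:E | t in `[0%R, T]].
have m1 : measurable_fun setT sX by exact: (measurable_sup_sqr_enorm hF T0 aX cX).
have m2 : measurable_fun setT sX' by exact: (measurable_sup_sqr_enorm hF T0 aX' cX').
have p1 w : (0 <= sX w)%E by exact: sup0.
have p2 w : (0 <= sX' w)%E by exact: sup0.
have e : (\int[P]_w (2%:E * (sX w + sX' w)) = 2%:E * (\int[P]_w sX w + \int[P]_w sX' w))%E.
  rewrite ge0_integralZl_EFin//.
  - by rewrite (ge0_integralD P measurableT (fun w _ => p1 w) m1 (fun w _ => p2 w) m2).
  - by move=> w _; exact: adde_ge0.
  - exact: emeasurable_funD.
apply: (@le_lt_trans _ _ (\int[P]_w (2%:E * (sX w + sX' w)))%E).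
  apply: ge0_le_lower_integral => w _; first exact: sup0.
  apply: ub_ereal_sup => _ [t /= + <-]; rewrite in_itv/= => tT.
  apply: (@le_trans _ _ (2%:E * ((enorm (X t w) ^+ 2)%:E + (enorm (X' t w) ^+ 2)%:E))%E).
    by rewrite -EFinD -EFinM lee_fin sqr_enormB.
  apply: lee_wpmul2l; first by rewrite lee_fin.
  by apply: leeD; [apply: (sup_process_ge (fun t w => enorm (X t w) ^+ 2))|
    apply: (sup_process_ge (fun t w => enorm (X' t w) ^+ 2))].
rewrite e lte_mul_pinfty ?lee_fin//; apply: lte_add_pinfty; exact: ereal_sup_sqr_enorm_lty.
Qed.

Let mDc i j : measurable_fun setT (fun z => Dc z i j).
Proof.
rewrite (ord1 j) /Dc /D; under eq_fun do rewrite !mxE.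
apply: measurable_funB; first exact: (measurable_clip_process hF T0 aX cX).
exact: (measurable_clip_process hF T0 aX' cX').
Qed.

Let msDc : measurable_fun setT (fun z => (enorm (Dc z) ^+ 2)%:E).
Proof. by apply/measurable_EFinP; apply: measurable_funX; exact: measurable_enorm. Qed.

Let phi s := (\int[P]_w (enorm (Dc (s, w)) ^+ 2)%:E)%E.

Let phi_le s : (phi s <= \int[P]_w supD w)%E.
Proof.
apply: ge0_le_lower_integral => w _; first by rewrite lee_fin sqr_ge0.
by apply: (sup_process_ge (fun t w => enorm (D t w) ^+ 2)); exact: clip_itv.
Qed.

Let phi0 s : (0 <= phi s)%E.
Proof. by apply: integral_ge0 => w _; rewrite lee_fin sqr_ge0. Qed.

Let phir s := fine (phi s).

Let phirE s : (phir s)%:E = phi s.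
Proof. by rewrite fineK// ge0_fin_numE// (le_lt_trans (phi_le s)). Qed.

Let K0 := fine (\int[P]_w supD w)%E.

Let phir_itv s : 0 <= phir s <= K0.
Proof.
rewrite fine_ge0//= fine_le//; first by rewrite -phirE.
by rewrite ge0_fin_numE// (le_trans (phi0 s)).
Qed.

Let mphir : measurable_fun setT phir.
Proof.
apply: (measurableT_comp (f := fine)); first exact: fine_measurable.
apply: (@measurable_space_integral _ _ _ P (fun z => (enorm (Dc z) ^+ 2)%:E)) => //.
by move=> z; rewrite lee_fin sqr_ge0.
Qed.

(** The Lipschitz bound with the Wasserstein distance replaced by the mean-square distance. It
    dominates the differences of both coefficients on [[0, T]] and, unlike the drift itself, is
    known to be jointly measurable. *)
Let h (z : R * Omega) := L * (enorm (Dc z) + Num.sqrt (phir z.1)).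

Let h0 z : 0 <= h z.
Proof. by rewrite /h mulr_ge0 ?(ltW L0)// addr_ge0 ?enorm_ge0// sqrtr_ge0. Qed.

Let mh : measurable_fun setT h.
Proof.
apply: measurable_funM => //; apply: measurable_funD; first exact: measurable_enorm.
apply: (measurableT_comp (f := @Num.sqrt R)).
  by apply: continuous_measurable_fun; exact: sqrt_continuous.
exact: (measurableT_comp mphir measurable_fst).
Qed.

Let mh2 : measurable_fun setT (fun z => h z ^+ 2).
Proof. exact: measurable_funX. Qed.

Let lip_h s w : 0 <= s <= T ->
  enorm (b s (X s w) (mu s) - b s (X' s w) (mu' s)) <= h (s, w) /\
  enorm (sigma s (X s w) (mu s) - sigma s (X' s w) (mu' s)) <= h (s, w).
Proof.
move=> sT; have [lb ls] := lipschitz (X s w) (X' s w) (mu s) (mu' s) sT.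
have W : (W2 (mu s) (mu' s) <= (Num.sqrt (phir s))%:E)%E.
  apply: (le_trans (W2_le (adapted_measurable_borel hF aX sT) (adapted_measurable_borel hF aX' sT) (lX sT) (lX' sT))).
  rewrite (_ : (\int[P]_w _)%E = phi s); last first.
    by apply: eq_integral => w' _; rewrite /Dc /= clip_id.
  by rewrite -phirE poweR_EFin powR12_sqrt//; case/andP: (phir_itv s).
have hE : (L%:E * ((enorm (X s w - X' s w))%:E + W2 (mu s) (mu' s)) <= (h (s, w))%:E)%E.
  rewrite /h EFinM; apply: lee_wpmul2l; first by rewrite lee_fin ltW.
  by rewrite EFinD /Dc /= clip_id//; exact: leeD2l.
by rewrite -!lee_fin; split; [exact: le_trans lb hE|exact: le_trans ls hE].
Qed.

Let h_bounded w : exists K : R, forall s, h (s, w) <= K.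
Proof.
have [K hK] := enorm_process_bounded T0 cD w.
exists (L * (K + Num.sqrt K0)) => s.
rewrite /h ler_wpM2l ?(ltW L0)// lerD//; first by apply: hK; exact: clip_itv.
by apply: ler_wsqrtr; case/andP: (phir_itv s).
Qed.

(** The growth condition bounds the drift along a continuous path, so that its lower integrals are
    finite, as [le_Rintegral_dist] demands. *)
Let b_bounded (Y : R -> Omega -> 'cV[R]_d) (nu : R -> P2 R d) w :
  (forall w, {within `[0, T], continuous (fun t => Y t w)}) ->
  exists K : R, forall s i, 0 <= s <= T -> `|b s (Y s w) (nu s) i 0| <= K.
Proof.
move=> cY; have [K hK] := enorm_process_bounded T0 cY w.
exists (C * (1 + K)) => s i sT.
apply: (le_trans (coord_le_enorm _ _ _)).
apply: (@le_trans _ _ (C * (1 + enorm (Y s w)))).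
  by apply: le_trans (growth (Y s w) (nu s) sT); rewrite lerDl enorm_ge0.
by rewrite ler_wpM2l ?(ltW C0)// lerD2l hK.
Qed.

Let Z t w := (\int[leb]_(s in `[0%R, t]) (h (s, w) ^+ 2)%:E)%E.

(** The 4 is the square of the factor 2 in [le_Rintegral_dist], [T] comes from the Cauchy-Schwarz
    inequality on [[0, t]], and [d] from estimating each coordinate of the drift by the same [h]. *)
Let drift_le t w : 0 <= t <= T ->
  ((enorm (drift t w) ^+ 2)%:E <= (4 * T * d%:R)%:E * Z t w)%E.
Proof.
move=> tT; have /andP[t0 tT'] := tT.
have mI : measurable (`[0%R, t]%classic : set R) by [].
have lebI : leb `[0%R, t] = t%:E.
  rewrite lebesgue_measure_itv/= lte_fin; case: ltP => [_|t0']; first by rewrite sube0.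
  by congr EFin; apply/eqP; rewrite eq_le t0 t0'.
have mhw : measurable_fun (`[0%R, t]%classic : set R) (fun s => h (s, w)).
  by apply: measurable_funTS; exact: (@measurable_fun_pair1 _ _ _ (measurableTypeR R) Omega _ h w mh).
have cst_lty (c : R) : (\int[leb]_(s in `[0%R, t]) (cst c%:E) s < +oo)%E.
  rewrite (_ : (\int[leb]_(s in _) _)%E = (c%:E * t%:E)%E) ?ltry//.
  by rewrite -lebI; exact: (@integral_cst _ (measurableTypeR R) R leb _ mI c%:E).
have [Kh hKh] := h_bounded w.
have hfin : (\int[leb]_(s in `[0%R, t]) (h (s, w))%:E < +oo)%E.
  apply: le_lt_trans (cst_lty Kh); apply: ge0_le_lower_integral => s _.
    by rewrite lee_fin.
  by rewrite lee_fin hKh.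
have hi : leb.-integrable `[0%R, t] (EFin \o (fun s => h (s, w))).
  by apply: ge0_integrableR => //; exact: hfin.
have h2i : leb.-integrable `[0%R, t] (EFin \o (fun s => h (s, w) ^+ 2)).
  apply: ge0_integrableR => [|s _|]; [exact: measurable_funX|exact: sqr_ge0|].
  apply: le_lt_trans (cst_lty (Kh ^+ 2)); apply: ge0_le_lower_integral => s _.
    by rewrite lee_fin sqr_ge0.
  by rewrite lee_fin ler_pXn2r ?nnegrE// (le_trans _ (hKh s)).
have [Kb hKb] := b_bounded mu w cX; have [Kb' hKb'] := b_bounded mu' w cX'.
have coordle i : (drift t w) i 0 ^+ 2 <= 4 * T * Rintegral leb `[0%R, t] (fun s => h (s, w) ^+ 2).
  rewrite !mxE.
  have := @le_Rintegral_dist _ (measurableTypeR R) R leb `[0%R, t]%classic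
    (fun s => b s (X s w) (mu s) i 0) (fun s => b s (X' s w) (mu' s) i 0)
    (fun s => h (s, w)) (cst (Num.max Kb Kb')) mI.
  set I1 := Rintegral _ _ _; set I2 := Rintegral _ _ _; set Ih := Rintegral _ _ _.
  move=> key.
  have {key}key : `|I1 - I2| <= 2 * Ih.
    apply: key; last exact: hfin.
    - move=> s /=; rewrite in_itv/= => /andP[s0 st].
      by rewrite le_max hKb// s0 (le_trans st).
    - move=> s /=; rewrite in_itv/= => /andP[s0 st].
      by rewrite le_max hKb' ?orbT// s0 (le_trans st).
    - move=> s /=; rewrite in_itv/= => /andP[s0 st].
      have sT : 0 <= s <= T by rewrite s0 (le_trans st).
      have [+ _] := lip_h w sT; apply: le_trans.
      by rewrite (le_trans _ (coord_le_enorm _ i 0))// !mxE.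
    - exact: mhw.
    - exact: cst_lty.
  have Ih0 : 0 <= Ih by apply: Rintegral_ge0 => s _.
  have cs := @Rintegral_sqr_le _ (measurableTypeR R) R leb _ _ t mI lebI hi h2i.
  rewrite -[leLHS]real_normK ?num_real//.
  apply: (@le_trans _ _ ((2 * Ih) ^+ 2)).
    by rewrite ler_pXn2r ?nnegrE// mulr_ge0.
  rewrite exprMn -mulrA (_ : 2 ^+ 2 = 4); last by ring.
  rewrite ler_pM2l// (le_trans cs)// ler_wpM2r//.
  by apply: Rintegral_ge0 => s _; exact: sqr_ge0.
rewrite /Z -(@EFin_Rintegral _ (measurableTypeR R) R leb _ (fun s => h (s, w) ^+ 2) mI h2i) -EFinM lee_fin sqr_enorm_cV.
apply: (le_trans (ler_sum _ (fun i _ => coordle i))).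
by rewrite sumr_const card_ord -[leLHS]mulr_natr mulrAC.
Qed.

Let Z0 t w : (0 <= Z t w)%E.
Proof. by apply: integral_ge0 => s _; rewrite lee_fin sqr_ge0. Qed.

Let mZ t : measurable_fun setT (Z t).
Proof.
apply: (@measurable_time_integral _ _ _ _ (fun z => (h z ^+ 2)%:E)) => //.
- exact/measurable_EFinP.
- by move=> z; rewrite lee_fin sqr_ge0.
Qed.

Let le_Z t w : t <= T -> (Z t w <= Z T w)%E.
Proof.
move=> tT; apply: ge0_subset_integral => //.
- apply/measurable_EFinP/measurable_funTS.
  exact: (@measurable_fun_pair1 _ _ _ (measurableTypeR R) Omega _ _ w mh2).
- by move=> s _; rewrite lee_fin sqr_ge0.
- by move=> s /=; rewrite !in_itv/= => /andP[-> /le_trans]; apply.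
Qed.

Let Phi t := (\int[leb]_(s in `[0%R, t]) (phir s)%:E)%E.

(** At each time [h ^ 2] is at most [2 L ^ 2] times the sum of [enorm (Dc z) ^ 2] and [phir]. Both
    summands have mean [phir], which gives [4 L ^ 2] after Tonelli's theorem. *)
Let EZ_le t : (\int[P]_w Z t w <= (4 * L ^+ 2)%:E * Phi t)%E.
Proof.
rewrite /Z (@tonelli_time _ _ _ P `[0%R, t]%classic (fun z => (h z ^+ 2)%:E))//; last 2 first.
- exact/measurable_EFinP.
- by move=> z; rewrite lee_fin sqr_ge0.
rewrite /Phi -ge0_integralZl_EFin//; last 3 first.
- by move=> s _; rewrite lee_fin; case/andP: (phir_itv s).
- by apply/measurable_EFinP; exact: measurable_funTS.
- by rewrite mulr_ge0// sqr_ge0.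
apply: ge0_le_lower_integral => s _.
  by apply: integral_ge0 => w _; rewrite lee_fin sqr_ge0.
have ps : 0 <= phir s by case/andP: (phir_itv s).
apply: (@le_trans _ _ (\int[P]_w ((2 * L ^+ 2)%:E * ((enorm (Dc (s, w)) ^+ 2)%:E + (phir s)%:E)))%E).
  apply: ge0_le_lower_integral => w _; first by rewrite lee_fin sqr_ge0.
  rewrite -EFinD -EFinM lee_fin /h exprMn /= [leRHS]mulrAC [leRHS]mulrC ler_wpM2l ?sqr_ge0//.
  have := sqr_sqrtr ps; set q := Num.sqrt _; set a := enorm _ => <-.
  by have := sqr_ge0 (a - q); rewrite sqrrB sqrrD; lra.
have msw : measurable_fun setT (fun w => (enorm (Dc (s, w)) ^+ 2)%:E).
  exact: (@measurable_fun_pair2 _ _ _ (measurableTypeR R) Omega _ _ s msDc).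
rewrite ge0_integralZl_EFin//; last 3 first.
- by move=> w _; rewrite adde_ge0// lee_fin ?sqr_ge0.
- exact: emeasurable_funD.
- by rewrite mulr_ge0// sqr_ge0.
have e0 w : setT w -> (0 <= (enorm (Dc (s, w)) ^+ 2)%:E)%E by rewrite lee_fin sqr_ge0.
have p0 (w : Omega) : setT w -> (0 <= (cst (phir s)%:E) w)%E by rewrite lee_fin.
rewrite (ge0_integralD P measurableT e0 msw p0 (measurable_cst _)).
rewrite -/(phi s) -phirE (integral_cst P measurableT).
rewrite [X in ((phir s)%:E * X)%E](_ : _ = 1%E); last exact: probability_setT.
by rewrite mule1 -EFinD -!EFinM lee_fin; lra.
Qed.

Variable c : R.
Hypothesis c0 : 0 <= c.
Hypothesis ito_le : forall t, 0 <= t <= T -> (\int[P]_w (enorm (M t w - M' t w) ^+ 2)%:E <=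
   c%:E * time_space_integral P t (fun z =>
     (enorm (time_patch T (fun t w => sigma t (X t w) (mu t)) z.1 z.2 -
             time_patch T (fun t w => sigma t (X' t w) (mu' t)) z.1 z.2) ^+ 2)%R))%E.

Let N_le t : 0 <= t <= T ->
  (\int[P]_w (enorm (M t w - M' t w) ^+ 2)%:E <= (c * (4 * L ^+ 2))%:E * Phi t)%E.
Proof.
move=> tT; have /andP[t0 tT'] := tT; apply: le_trans (ito_le tT) _.
rewrite EFinM -muleA; apply: lee_wpmul2l; first by rewrite lee_fin.
apply: le_trans (EZ_le t).
apply: (@le_time_space_integral _ _ _ P t _ (fun z => h z ^+ 2)).
  by move=> z; exact: sqr_ge0.
move=> s w /andP[s0 st] /=.
have sT : 0 <= s <= T by rewrite s0 (le_trans st).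
rewrite /time_patch sT ler_pXn2r ?nnegrE ?enorm_ge0//.
by have [_] := lip_h w sT.
Qed.

Let mN t : 0 <= t <= T -> measurable_fun setT (fun w => (enorm (M t w - M' t w) ^+ 2)%:E).
Proof.
move=> tT; have /andP[t0 _] := tT.
apply/measurable_EFinP; apply: measurable_funX; apply: measurable_enorm => i j.
rewrite (ord1 j); under eq_fun do rewrite !mxE.
by apply: measurable_funB; apply: (F_measurable_measurable hF t0);
  [exact: ito_coord_F_measurable iM tT|exact: ito_coord_F_measurable iM' tT].
Qed.

Let phir_le t : 0 <= t <= T ->
  ((phir t)%:E <= (3 * enorm (x - x') ^+ 2)%:E +
     (3 * ((4 * T * d%:R + c) * (4 * L ^+ 2)))%:E * Phi t)%E.
Proof.
move=> tT; set a0 := enorm (x - x') ^+ 2.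
have K1 : 0 <= 4 * T * d%:R by rewrite mulr_ge0// mulr_ge0// ltW.
pose n2 w := (enorm (M t w - M' t w) ^+ 2)%:E.
have n20 w : (0 <= n2 w)%E by rewrite lee_fin sqr_ge0.
(* The equation holds only almost surely, and the almost sure comparison of integrals asks for
   measurable functions; hence the measurable [Z] stands in for the drift. *)
pose f2 w := (3%:E * (a0%:E + (4 * T * d%:R)%:E * Z t w + n2 w))%E.
have kZ0 w : (0 <= (4 * T * d%:R)%:E * Z t w)%E by rewrite mule_ge0// lee_fin.
have mkZ : measurable_fun setT (fun w => (4 * T * d%:R)%:E * Z t w)%E by exact: emeasurable_funM.
have a00 : 0 <= a0 by exact: sqr_ge0.
have m1 : measurable_fun setT (fun w => a0%:E + (4 * T * d%:R)%:E * Z t w)%E by exact: emeasurable_funD.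
have p1 w : (0 <= a0%:E + (4 * T * d%:R)%:E * Z t w)%E by rewrite adde_ge0// lee_fin.
have m2 : measurable_fun setT (fun w => a0%:E + (4 * T * d%:R)%:E * Z t w + n2 w)%E.
  by apply: emeasurable_funD => //; exact: mN.
have p2 w : (0 <= a0%:E + (4 * T * d%:R)%:E * Z t w + n2 w)%E by rewrite adde_ge0.
apply: (@le_trans _ _ (\int[P]_w f2 w)%E).
  rewrite phirE; apply: ae_ge0_le_integral => //.
  - by move=> w _; rewrite lee_fin sqr_ge0.
  - exact: (@measurable_fun_pair2 _ _ _ (measurableTypeR R) Omega _ _ t msDc).
  - by move=> w _; rewrite mule_ge0// lee_fin.
  - exact: emeasurable_funM.
  - apply: filterS eqD => w /(_ t tT) e _.
    rewrite /Dc /D /= (clip_id tT) e.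
    apply: (@le_trans _ _ (3%:E * (a0%:E + (enorm (drift t w) ^+ 2)%:E + n2 w))%E).
      by rewrite -!EFinD -EFinM lee_fin; exact: sqr_enormD3.
    apply: lee_wpmul2l; first by rewrite lee_fin.
    by rewrite leeD2r// leeD2l// drift_le.
rewrite /f2 ge0_integralZl_EFin// (ge0_integralD P measurableT (fun w _ => p1 w) m1 (fun w _ => n20 w) (mN tT)).
have a00' : forall w : Omega, setT w -> (0 <= (cst a0%:E) w)%E by move=> w _; rewrite lee_fin.
rewrite (ge0_integralD P measurableT a00' (measurable_cst _) (fun w _ => kZ0 w) mkZ).
rewrite (integral_cst P measurableT) [X in (a0%:E * X)%E](_ : _ = 1%E); last exact: probability_setT.
rewrite mule1 ge0_integralZl_EFin//.
rewrite [(3 * a0)%:E]EFinM [(3 * (_ * _))%:E]EFinM -muleA -muleDr; last 2 first.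
- by [].
- apply: ge0_adde_def; rewrite inE ?lee_fin// mule_ge0//; first by rewrite lee_fin mulr_ge0// ?addr_ge0// mulr_ge0// sqr_ge0.
  by apply: integral_ge0 => s _; rewrite lee_fin; case/andP: (phir_itv s).
apply: lee_wpmul2l; first by rewrite lee_fin.
rewrite -addeA leeD2l// (mulrDl (4 * T * d%:R) c) EFinD ge0_muleDl; last 2 first.
- by rewrite lee_fin mulr_ge0// mulr_ge0// sqr_ge0.
- by rewrite lee_fin mulr_ge0// mulr_ge0// sqr_ge0.
apply: leeD; last exact: N_le.
rewrite (EFinM (4 * T * d%:R)) -muleA; apply: lee_wpmul2l; first by rewrite lee_fin.
exact: EZ_le.
Qed.

Let a0 := enorm (x - x') ^+ 2.
(** The summand 1 keeps [k] positive, as [gronwall] requires, also when [d] and [c] are zero. *)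
Let k := 3 * ((4 * T * d%:R + c) * (4 * L ^+ 2)) + 1.

Let k0 : 0 < k.
Proof.
rewrite /k ltr_wpDl// mulr_ge0// mulr_ge0//; last by rewrite mulr_ge0// sqr_ge0.
by rewrite addr_ge0// mulr_ge0// mulr_ge0// ltW.
Qed.

Let Phi0 t : (0 <= Phi t)%E.
Proof. by apply: integral_ge0 => s _; rewrite lee_fin; case/andP: (phir_itv s). Qed.

Let phir_gronwall t : 0 <= t <= T -> phir t <= 6 * expR (2 * k * T) * a0.
Proof.
(* The 6 is the 2 of [gronwall] times the 3 in front of [a0] in [phir_le]. *)
move=> tT; apply: (@le_trans _ _ (2 * (3 * a0) * expR (2 * k * T))); last by rewrite le_eqVlt; apply/orP; left; apply/eqP; ring.
apply: (@gronwall R T (3 * a0) k K0 phir) => //.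
- exact: ltW.
- by rewrite mulr_ge0// sqr_ge0.
- move=> s sT; apply: (le_trans (phir_le sT)); apply: leeD2l.
  by apply: lee_wpmul2r; [exact: Phi0|rewrite lee_fin lerDl].
Qed.

Let Phi_le : (Phi T <= (6 * expR (2 * k * T) * T * a0)%:E)%E.
Proof.
apply: (@le_trans _ _ (\int[leb]_(s in `[0%R, T]) (cst (6 * expR (2 * k * T) * a0)%:E) s)%E).
  apply: ge0_le_lower_integral => s /=; first by rewrite lee_fin; case/andP: (phir_itv s).
  by rewrite in_itv/= => sT; rewrite lee_fin phir_gronwall.
rewrite (_ : (\int[leb]_(s in _) _)%E = ((6 * expR (2 * k * T) * a0)%:E * leb `[0%R, T])%E); last first.
  by apply: (@integral_cst _ (measurableTypeR R) R leb).
by rewrite lebesgue_measure_itv/= lte_fin T0 sube0 -EFinM mulrAC.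
Qed.

(** The three-term splitting is repeated with the supremum under the expectation. The drift bound
    increases with time, so its value at [T] covers all times; Doob's inequality treats the
    martingale part, at the price of a factor 4. Both terms are then multiples of [Phi T], which
    Gronwall's lemma has bounded by a multiple of [a0]. *)
Lemma integral_sup_sqr_dist_le :
  (\int[P]_w ereal_sup [set (enorm (X t w - X' t w) ^+ 2)%:E | t in `[0%R, T]] <=
   (stability_constant d T L c * enorm (x - x') ^+ 2)%:E)%E.
Proof.
pose n w := ereal_sup [set (enorm (M t w - M' t w) ^+ 2)%:E | t in `[0%R, T]].
have n0 w : (0 <= n w)%E.
  by apply: (sup_process_ge0 (f := fun t w => enorm (M t w - M' t w) ^+ 2) T0) => t v; exact: sqr_ge0.
have TT : 0 <= T <= T by rewrite lexx ltW.
have mn : measurable_fun setT n.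
  apply: (measurable_sup_process (f := fun t w => enorm (M t w - M' t w) ^+ 2) T0).
  - move=> w; apply: (continuous_sqr_enorm_process (X := fun t w => M t w - M' t w)) => w'.
    exact: (continuous_ito_difference iM iM').
  - by move=> t tT; apply/measurable_EFinP; exact: mN.
  - by move=> t w; exact: sqr_ge0.
have K1 : 0 <= 4 * T * d%:R by rewrite mulr_ge0// mulr_ge0// ltW.
have kZ0 w : (0 <= (4 * T * d%:R)%:E * Z T w)%E by rewrite mule_ge0// lee_fin.
have mkZ : measurable_fun setT (fun w => (4 * T * d%:R)%:E * Z T w)%E by exact: emeasurable_funM.
have a00 : 0 <= a0 by exact: sqr_ge0.
have m1 : measurable_fun setT (fun w => a0%:E + (4 * T * d%:R)%:E * Z T w)%E by exact: emeasurable_funD.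
have p1 w : (0 <= a0%:E + (4 * T * d%:R)%:E * Z T w)%E by rewrite adde_ge0// lee_fin.
have m2 : measurable_fun setT (fun w => a0%:E + (4 * T * d%:R)%:E * Z T w + n w)%E by exact: emeasurable_funD.
have p2 w : (0 <= a0%:E + (4 * T * d%:R)%:E * Z T w + n w)%E by rewrite adde_ge0.
apply: (@le_trans _ _ (\int[P]_w (3%:E * (a0%:E + (4 * T * d%:R)%:E * Z T w + n w)))%E).
  apply: ae_ge0_le_integral.
  - exact: measurableT.
  - by move=> w _; exact: sup0 (fun t w => X t w - X' t w) w.
  - exact: measurable_supD.
  - by move=> w _; rewrite mule_ge0// lee_fin.
  - exact: emeasurable_funM.
  - apply: filterS eqD => w e _.
    apply: ub_ereal_sup => _ [t /= + <-]; rewrite in_itv/= => tT; rewrite (e _ tT).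
    apply: (@le_trans _ _ (3%:E * (a0%:E + (enorm (drift t w) ^+ 2)%:E + (enorm (M t w - M' t w) ^+ 2)%:E))%E).
      by rewrite -!EFinD -EFinM lee_fin; exact: sqr_enormD3.
    apply: lee_wpmul2l; first by rewrite lee_fin.
    apply: leeD; last exact: (sup_process_ge (fun t w => enorm (M t w - M' t w) ^+ 2)).
    apply: leeD2l; apply: (le_trans (drift_le w tT)).
    apply: lee_wpmul2l; first by rewrite lee_fin.
    by apply: le_Z; case/andP: tT.
rewrite ge0_integralZl_EFin// (ge0_integralD P measurableT (fun w _ => p1 w) m1 (fun w _ => n0 w) mn).
have a00' : forall w : Omega, setT w -> (0 <= (cst a0%:E) w)%E by move=> w _; rewrite lee_fin.
rewrite (ge0_integralD P measurableT a00' (measurable_cst _) (fun w _ => kZ0 w) mkZ).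
rewrite (integral_cst P measurableT) [X in (a0%:E * X)%E](_ : _ = 1%E); last exact: probability_setT.
rewrite mule1 ge0_integralZl_EFin//.
set G := 6 * expR (2 * k * T) * T * a0.
have EZ : (\int[P]_w Z T w <= (4 * L ^+ 2 * G)%:E)%E.
  rewrite EFinM; apply: (le_trans (EZ_le T)).
  by apply: lee_wpmul2l; [rewrite lee_fin mulr_ge0// sqr_ge0|exact: Phi_le].
have EN : (\int[P]_w n w <= (4 * (c * (4 * L ^+ 2) * G))%:E)%E.
  rewrite EFinM; apply: (le_trans (ito_difference_doob hF hB T0 iM iM')).
  apply: lee_wpmul2l; first by rewrite lee_fin.
  rewrite EFinM; apply: (le_trans (N_le TT)).
  by apply: lee_wpmul2l; [rewrite lee_fin mulr_ge0// mulr_ge0// sqr_ge0|exact: Phi_le].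
have -> : stability_constant d T L c * enorm (x - x') ^+ 2 =
    3 * (a0 + (4 * T * d%:R) * (4 * L ^+ 2 * G) + 4 * (c * (4 * L ^+ 2) * G)).
  by rewrite /stability_constant -/k -/a0 /G; ring.
rewrite [leRHS]EFinM; apply: lee_wpmul2l; first by rewrite lee_fin.
rewrite EFinD; apply: leeD; last exact: EN.
rewrite EFinD; apply: leeD2l.
by rewrite (EFinM (4 * T * d%:R)); apply: lee_wpmul2l; rewrite ?lee_fin.
Qed.

End two_solutions.

Lemma stability_constant_ge0 {R : realType} (d : nat) (T L c : R) : 0 < T -> 0 <= c ->
  0 <= stability_constant d T L c.
Proof.
move=> /ltW T0 c0; rewrite /stability_constant mulr_ge0// addr_ge0//.
rewrite mulr_ge0//; last by rewrite mulr_ge0// mulr_ge0// expR_ge0.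
rewrite mulr_ge0//; last by rewrite mulr_ge0// sqr_ge0.
by rewrite addr_ge0// ?mulr_ge0// mulr_ge0.
Qed.

Theorem theorem5p1 (R : realType) (disp : measure_display)
  (Omega : measurableType disp) (P : probability Omega R)
  (F : R -> set (set Omega)) (d : nat) (B : R -> Omega -> 'cV[R]_d)
  (hF : usual_filtration P F) (hB : brownian_motion P F B)
  (T : R) (hT : 0 < T)
  (b : R -> 'cV[R]_d -> P2 R d -> 'cV[R]_d)
  (sigma : R -> 'cV[R]_d -> P2 R d -> 'M[R]_d)
  (hb : borel_measurable <<s open >>
    [set z : R * 'cV[R]_d * P2 R d | 0 <= z.1.1 <= T]
    (fun z => b z.1.1 z.1.2 z.2))
  (hsigma : borel_measurable <<s open >>
    [set z : R * 'cV[R]_d * P2 R d | 0 <= z.1.1 <= T]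
    (fun z => sigma z.1.1 z.1.2 z.2))
  (growth : exists2 C : R, 0 < C &
    forall (t : R) (x : 'cV[R]_d) (mu : P2 R d), 0 <= t <= T ->
      enorm (b t x mu) + enorm (sigma t x mu) <= C * (1 + enorm x))
  (lipschitz : exists2 L : R, 0 < L &
    forall (t : R) (x x' : 'cV[R]_d) (mu mu' : P2 R d), 0 <= t <= T ->
      ((enorm (b t x mu - b t x' mu'))%:E <=
         L%:E * ((enorm (x - x'))%:E + W2 mu mu'))%E /\
      ((enorm (sigma t x mu - sigma t x' mu'))%:E <=
         L%:E * ((enorm (x - x'))%:E + W2 mu mu'))%E)
  (X : 'cV[R]_d -> R -> Omega -> 'cV[R]_d)
  (hX : forall x, mckean_vlasov_solution P F B T b sigma x (X x)) :
  forall x : 'cV[R]_d,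
    L2C_norm P T (fun t w => X y t w - X x t w) @[y --> x] --> 0%E.

Proof.
move=> x.
have [C C0 hC] := growth; have [L L0 hL] := lipschitz.
have [c c0 hc] := ito_dist_le hF hB hT.
set K := stability_constant d T L c.
have K0 : 0 <= K by exact: stability_constant_ge0.
(* The solution map is in fact Lipschitz, with constant [Num.sqrt K]: neither [L] nor [c] depends on
   the initial values. *)
have dist_le y : (L2C_norm P T (fun t w => (X y t w - X x t w)%R) <= (Num.sqrt K * enorm (y - x))%:E)%E.
  have [aX cX nX [mu [M [lX iM eX]]]] := hX y.
  have [aX' cX' nX' [mu' [M' [lX' iM' eX']]]] := hX x.
  have eD : {ae P, forall w, forall t : R, 0 <= t <= T -> X y t w - X x t w = (y - x) +
      (vec_integral t (fun s => b s (X y s w) (mu s)) - vec_integral t (fun s => b s (X x s w) (mu' s))) +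
      (M t w - M' t w)}.
    apply: filterS2 eX eX' => w e e' t tT.
    by rewrite (e t tT) (e' t tT) !opprD [LHS]addrACA; congr (_ + _); rewrite addrACA.
  have := integral_sup_sqr_dist_le hF hB hT C0 L0 hC hL aX aX' cX cX' nX nX' lX lX' iM iM' eD c0
    (fun t tT => hc _ _ _ _ t iM iM' tT).
  rewrite -/K /L2C_norm => le.
  apply: (@le_trans _ _ ((K * enorm (y - x) ^+ 2)%:E `^ 2^-1)%E).
    apply: gt0_ler_poweR le; first by rewrite invr_ge0.
      rewrite in_itv/= leey andbT; apply: integral_ge0 => w _.
      by apply: (sup_process_ge0 (f := fun t w => enorm (X y t w - X x t w) ^+ 2) hT) => t v; exact: sqr_ge0.
    by rewrite in_itv/= leey andbT lee_fin mulr_ge0// sqr_ge0.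
  rewrite poweR_EFin lee_fin powR12_sqrt; last by rewrite mulr_ge0// sqr_ge0.
  by rewrite sqrtrM// sqrtr_sqr ger0_norm ?enorm_ge0.
apply: (@squeeze_cvge _ (nbhs x) _ R (fun=> 0%E) _ (fun y => (Num.sqrt K * enorm (y - x))%:E)).
- apply: nearW => y; rewrite dist_le andbT; exact: poweR_ge0.
- exact: cvg_cst.
- have h : enorm (y - x) @[y --> x] --> (0 : R).
    have h' : (y - x) @[y --> x] --> (0 : 'cV[R]_d).
      have FF : Filter (nbhs x) by exact: nbhs_filter.
      have cst_x := @cvg_cst _ x _ (nbhs x) FF.
      by rewrite -(subrr x); exact: (@cvgB _ _ _ (nbhs x) FF id (fun=> x) x x cvg_id cst_x).
    rewrite -(@enorm0 R d 1).
    exact: (continuous_cvg (h := @enorm R d 1) _ (@continuous_enorm R d 1 0) h').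
  apply: cvg_EFin; first exact: nearW.
  rewrite -(mulr0 (Num.sqrt K)); apply: cvgM; [exact: cvg_cst|exact: h].
Qed.
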